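(* Let $C_1,\ldots,C_{p+1}\subset GL(n,\mathbf{C})$ be conjugacy classes of diagonalizable matrices with $\prod_{j=1}^{p+1}\det(C_j)=1$, and let $d_j$ be the dimension of $C_j$. Suppose that $q>1$, that the eigenvalues $\sigma_{k,j}$ of the classes $C_j$ are relatively generic and that $\xi$ is not a primitive root of unity of order $q$. A) If $d_1+\cdots+d_{p+1}=2n^2$, then a $(p+1)$-tuple of matrices $M_j\in C_j$ satisfying $M_1\cdots M_{p+1}=I$ (if it exists) has trivial centralizer if and only if it is irreducible. B) If $d_1+\cdots+d_{p+1}\ge 2n^2+2$ and if there exist $(p+1)$-tuples of matrices $M_j\in C_j$ satisfying $M_1\cdots M_{p+1}=I$, then there exist irreducible such $(p+1)$-tuples as well.
   Context: The number $q$ is the greatest common divisor of the multiplicities of all eigenvalues of all classes $C_j$. The number $\xi$ is the product over all $j$ of the eigenvalues of $C_j$ taken with multiplicities divided by $q$; one has $\xi^q=1$, and $m_0\in\{0,\ldots,q-1\}$ is defined by $\xi=\exp(2\pi i m_0/q)$. Write $(m_0,q)$ for the greatest common divisor, with $(0,q)=q$; $\xi$ is primitive if and only if $(m_0,q)=1$. Relatively generic eigenvalues. Let $\sigma_{1,j},\ldots,\sigma_{n,j}$ be the eigenvalues (with multiplicity) of $C_j$. A non-genericity relation is an equality $\prod_{j=1}^{p+1}\prod_{k\in\Phi_j}\sigma_{k,j}=1$ with $\Phi_j\subset\{1,\ldots,n\}$, $\#\Phi_1=\cdots=\#\Phi_{p+1}=\kappa$, $1\le\kappa<n$. If $(m_0,q)>1$,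 then there holds the relation $(\gamma^* )$: the product of all eigenvalues, taken with multiplicities divided by $(m_0,q)$, equals $1$. Its multiples $s(\gamma^* )$, $1\le s<(m_0,q)$, are the relations obtained when the eigenvalues are taken with multiplicities divided by $(m_0,q)$ and then multiplied by $s$. The eigenvalues are called relatively generic if $q>1$, $(m_0,q)>1$ and the only non-genericity relations they satisfy are $(\gamma^* )$ and its multiples. A $(p+1)$-tuple of $n\times n$-matrices has trivial centralizer if only scalar matrices commute with all of them; it is irreducible if the matrices have no common proper non-zero invariant subspace. *)

(* Defs.v *)
From HB Require Import structures.
From mathcomp Require Import all_boot all_order all_algebra.
From mathcomp Require Import mpoly.
From mathcomp Require Import complex reals trigo.
Set Implicit Arguments.
Unset Strict Implicit.
Unset Printing Implicit Defensive.
Import Order.TTheory GRing.Theory Num.Theory.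
Local Open Scope ring_scope.
Local Open Scope complex_scope.

(* e^(i t) *)
Definition expi (R : realType) (t : R) : R[i] := cos t +i* sin t.

Section Matrices.
Variables (F : fieldType) (n : nat).

Definition conj_class (A : 'M[F]_n) (B : 'M[F]_n) : Prop :=
  exists2 P : 'M[F]_n, P \in unitmx & B = P *m A *m invmx P.

(* Matrices are read as points of affine n^2-space through mxvec. *)
Definition alg_independent_on (S : 'M[F]_n -> Prop) (d : nat)
    (f : 'I_d -> {mpoly F[n * n]}) : Prop :=
  forall P : {mpoly F[d]},
    (forall X, S X -> P.@[fun i => (f i).@[mxvec X 0]] = 0) -> P = 0.

(* The dimension of S (for S constructible, e.g. an orbit: the dimension of
   its Zariski closure) is the transcendence degree of the ring of polynomial
   functions on S. *)
Definition has_dimension (S : 'M[F]_n -> Prop) (d : nat) : Prop :=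
  (exists f : 'I_d -> {mpoly F[n * n]}, alg_independent_on S f) /\
  (forall (e : nat) (f : 'I_e -> {mpoly F[n * n]}),
     alg_independent_on S f -> (e <= d)%N).

Variable p : nat.

Definition trivial_centralizer (M : 'I_p.+1 -> 'M[F]_n) : Prop :=
  forall X : 'M[F]_n, (forall j, X *m M j = M j *m X) ->
    exists a : F, X = a%:M.

Definition irreducible_tuple (M : 'I_p.+1 -> 'M[F]_n) : Prop :=
  forall U : {vspace 'cV[F]_n},
    (forall j v, v \in U -> M j *m v \in U) -> U = 0%VS \/ U = fullv.

(* The factors are multiplied in increasing order of their indices. *)
Definition product_one_in_classes (A M : 'I_p.+1 -> 'M[F]_n) : Prop :=
  (forall j, conj_class (A j) (M j)) /\ \prod_(j < p.+1) M j = 1%:M.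

End Matrices.

(* sigma j lists the eigenvalues of the j-th class with multiplicity. *)
Section Eigenvalues.
Variables (F : fieldType) (n p : nat) (sigma : 'I_p.+1 -> 'I_n -> F).

Definition mult (j : 'I_p.+1) (a : F) : nat := #|[set k | sigma j k == a]|.

Definition mult_gcd : nat :=
  \big[gcdn/0%N]_(j < p.+1) \big[gcdn/0%N]_(k < n) mult j (sigma j k).

(* undup: each distinct eigenvalue contributes one factor. *)
Definition xi : F :=
  \prod_(j < p.+1) \prod_(a <- undup (codom (sigma j)))
    a ^+ (mult j a %/ mult_gcd).

Definition nongenericity_relation (Phi : 'I_p.+1 -> {set 'I_n}) : Prop :=
  (exists2 kappa : nat,
     (1 <= kappa < n)%N & forall j, #|Phi j| = kappa) /\
  \prod_(j < p.+1) \prod_(k in Phi j) sigma j k = 1.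

(* Phi selects the eigenvalues with multiplicities divided by g and then
   multiplied by s.  For g = gcdn m0 q and 1 <= s < g this is the s-th multiple
   of the relation gamma-star, and for s = 1 gamma-star itself. *)
Definition is_multiple (g s : nat) (Phi : 'I_p.+1 -> {set 'I_n}) : Prop :=
  forall j (a : F), #|[set k in Phi j | sigma j k == a]| = (s * (mult j a %/ g))%N.

(* gamma-star always holds when 1 < gcdn m0 q, so only the absence of other
   relations is required. *)
Definition relatively_generic (m0 : nat) : Prop :=
  [/\ (1 < mult_gcd)%N, (1 < gcdn m0 mult_gcd)%N
    & forall Phi, nongenericity_relation Phi ->
      exists2 s : nat, (1 <= s < gcdn m0 mult_gcd)%N
        & is_multiple (gcdn m0 mult_gcd) s Phi].

End Eigenvalues.

(* Main.v *)
(* Let g = gcd(m0, q) and let chi_j be the g-th root of the characteristic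
   polynomial of C_j.  By relative genericity every diagonalizable tuple of
   intermediate size with product 1 whose characteristic polynomials divide
   those of the C_j has characteristic polynomials chi_j^s for a single s; call
   s its type.  View tuples with product 1 as modules.  For simple modules of
   types s and t, counting dimensions in the complex
   T |-> (X_j T_j - T_j Y_j)_j |-> derivative of the product gives
   dim Ext - dim Hom - dim Hom' = s t (sum_j rho_j - 2 b^2), where rho_j counts
   the pairs of distinct roots of chi_j, b = n / g and sum_j d_j = g^2 sum_j rho_j.

   A) If sum_j rho_j = 2 b^2, there are no nonsplit extensions between
   non-isomorphic simple modules.  Hence, if M is not simple, a simple submodule
   U is a quotient of M, and M ->> U -> M is a non-scalar endomorphism.

   B) If sum_j rho_j >= 2 b^2 + 2 (the sum is even), simple modules of types s
   and t yield one of type s + t: first make them non-isomorphic by a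
   deformation, then take a nonsplit extension, which has trivial centralizer,
   so that the implicit function theorem realizes every tangent vector of the
   variety of solutions, and leave the block triangular matrices along a tangent
   vector whose lower left block is a nontrivial class of the opposite Ext.  By
   Burnside's theorem the result is simple.  Composition factors of a given
   solution are joined in this way.

   The dimension of a conjugacy class of a diagonalizable matrix, the number of
   ordered pairs of positions with distinct eigenvalues, is computed from the
   definition: the corresponding entries are algebraically independent on the
   class because they are independent near a diagonal matrix, and more functions
   are dependent by counting monomials in a rational parametrization. *)
Require Import Defs.
From HB Require Import structures.
From mathcomp Require Import all_boot all_order all_algebra.
From mathcomp Require Import perm mpoly.
From mathcomp Require Import complex classical_sets reals trigo.
From mathcomp Require Import ring lra zify.
From Stdlib Require Import Classical.
Set Implicit Arguments.
Unset Strict Implicit.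
Unset Printing Implicit Defensive.
Import Order.TTheory GRing.Theory Num.Theory.
Local Open Scope ring_scope.
Local Open Scope complex_scope.

(** * Simple modules and Burnside's theorem *)

(** Two linear maps govern everything because the tangent space of a class of diagonalizable
    matrices at [X] is the image of [T |-> X T - T X], and because the corner of a block triangular
    matrix that stays diagonalizable has the form [X T - T Y]. The obstacle in B is the trace:
    determinants are constant on classes, so for [X = Y] the derivative of the product reaches only
    traceless matrices. Switching on the lower left block of an extension may give the two diagonal
    blocks of the linearized product opposite nonzero traces, which no motion inside [U] and [V]
    cancels. One linear condition on the class removes them, so Ext needs dimension at least 2;
    hence the margin 2 and the parity argument. The same defect lets the implicit function theorem
    make the product only scalar; its determinant and its closeness to 1 then make it 1. In A the
    vanishing of Ext serves beyond simple modules: a submodule and its quotient with no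
    homomorphisms between them split off. So each proper nonzero stable [W] has a nonzero map to
    [M/W], and an induction along such [W] carries [U] to the top of [M]. *)

Section Modules.
Variables (F : fieldType) (J : Type).

Definition intertwines m n (X : J -> 'M[F]_m) (Y : J -> 'M[F]_n)
  (T : 'M[F]_(m, n)) := forall j, X j *m T = T *m Y j.

(* Families of matrices act on row vectors, from the right. *)
Definition simple m (X : J -> 'M[F]_m) := (0 < m)%N /\
  forall k (W : 'M[F]_(k, m)), (forall j, stablemx W (X j)) ->
    W = 0 \/ row_full W.

Definition block_family m n (X : J -> 'M[F]_m) (B : J -> 'M[F]_(m, n))
  (Y : J -> 'M[F]_n) (j : J) : 'M[F]_(m + n) := block_mx (X j) (B j) 0 (Y j).

Lemma intertwines_comp m n k (X : J -> 'M[F]_m) (Y : J -> 'M_n) (Z : J -> 'M_k)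
    (S : 'M_(m, n)) (T : 'M_(n, k)) :
  intertwines X Y S -> intertwines Y Z T -> intertwines X Z (S *m T).
Proof. by move=> hS hT j; rewrite mulmxA hS -!mulmxA hT. Qed.

Lemma intertwines_kermx m n (X : J -> 'M[F]_m) (Y : J -> 'M_n) T :
  intertwines X Y T -> forall j, stablemx (kermx T) (X j).
Proof.
by move=> hT j; apply/sub_kermxP; rewrite -mulmxA hT mulmxA mulmx_ker mul0mx.
Qed.

Lemma intertwines_stable m n (X : J -> 'M[F]_m) (Y : J -> 'M_n) T :
  intertwines X Y T -> forall j, stablemx T (Y j).
Proof. by move=> hT j; rewrite -hT submxMl. Qed.

Lemma simple_row_free m n (X : J -> 'M[F]_m) (Y : J -> 'M_n) T :
  simple X -> intertwines X Y T -> T <> 0 -> row_free T.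
Proof.
move=> [m0 sX] hT nT; rewrite -kermx_eq0.
case: (sX _ _ (intertwines_kermx hT)) => [->//|fK].
by case: nT; rewrite -[T]mul1mx; apply/sub_kermxP; rewrite submx_full.
Qed.

Lemma simple_row_full m n (X : J -> 'M[F]_m) (Y : J -> 'M_n) T :
  simple Y -> intertwines X Y T -> T <> 0 -> row_full T.
Proof. by move=> [n0 sY] hT nT; case: (sY _ _ (intertwines_stable hT)). Qed.

(** The equality of [y + x] and [n] is only propositional, so the change of basis is a rectangular
    [P] with two-sided inverse [P'] rather than a cast. Since rows are acted on from the right, in
    [block_family Y B X] the block [X] is the submodule and [Y] the quotient. *)
Lemma stable_block n (M : J -> 'M[F]_n) k (W : 'M[F]_(k, n)) :
  (forall j, stablemx W (M j)) ->
  exists y x (P : 'M[F]_(y + x, n)) (P' : 'M[F]_(n, y + x)) Y B X,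
  [/\ x = \rank W, (y + x = n)%N, P *m P' = 1%:M /\ P' *m P = 1%:M,
    forall j, P *m M j = block_family Y B X j *m P & (dsubmx P :=: W)%MS].
Proof.
move=> sW; set y := \rank (complmx W); set x := \rank W.
set P := col_mx (row_base (complmx W)) (row_base W).
have yx : (y + x = n)%N by rewrite /y mxrank_compl subnK ?rank_leq_col.
have fP : row_full P.
  rewrite -sub1mx -addsmxE.
  rewrite (adds_eqmx (eq_row_base _) (eq_row_base _)) addsmxC submx_full //.
  exact: addsmx_compl_full.
have rP : row_free P by apply/eqP; rewrite (eqP fP); exact/esym.
pose P' := pinvmx P.
have PP' : P *m P' = 1%:M by apply: mulmxVp.
have P'P : P' *m P = 1%:M by apply: mulVpmx.
pose Z j := P *m M j *m P'.
exists y, x, P, P', (fun j => ulsubmx (Z j)), (fun j => ursubmx (Z j)),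
  (fun j => drsubmx (Z j)); split=> //; last by rewrite col_mxKd; apply: eq_row_base.
move=> j; rewrite /block_family.
have -> : 0 = dlsubmx (Z j).
  have PP'd : row_base W *m P' = row_mx 0 1%:M.
    rewrite -[row_base W](col_mxKd (row_base (complmx W))) -/P mul_dsub_mx PP'.
    by rewrite scalar_mx_block /block_mx col_mxKd.
  have : (row_base W *m M j <= row_base W)%MS by rewrite stablemx_row_base.
  case/submxP=> D hD.
  rewrite /Z /dlsubmx -!mul_dsub_mx {1}/P col_mxKd hD -mulmxA PP'd.
  by rewrite mul_mx_row row_mxKl mulmx0.
by rewrite /= submxK /Z -[RHS]mulmxA P'P mulmx1.
Qed.

Lemma block_quotient n y x (M : J -> 'M[F]_n) (P : 'M[F]_(y + x, n))
    (P' : 'M[F]_(n, y + x)) Y B X :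
  P *m P' = 1%:M -> P' *m P = 1%:M ->
  (forall j, P *m M j = block_family Y B X j *m P) ->
  intertwines M Y (P' *m col_mx 1%:M 0).
Proof.
move=> PP' P'P hM j.
have -> : M j = P' *m block_family Y B X j *m P.
  by rewrite -mulmxA -hM mulmxA P'P mul1mx.
rewrite -!mulmxA; congr (_ *m _); rewrite (mulmxA P) PP' mul1mx.
rewrite /block_family mul_block_col mul_col_mx.
by rewrite !mulmx1 !mulmx0 !mul0mx mul1mx !addr0.
Qed.

Lemma block_sub n y x (M : J -> 'M[F]_n) (P : 'M[F]_(y + x, n)) Y B X :
  (forall j, P *m M j = block_family Y B X j *m P) ->
  intertwines X M (row_mx 0 1%:M *m P).
Proof.
move=> hM j; rewrite -!mulmxA hM !mulmxA; congr (_ *m _).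
rewrite /block_family mul_row_block mul_mx_row.
by rewrite !mulmx0 !mul0mx mulmx1 mul1mx !add0r.
Qed.

Lemma not_simple n (M : J -> 'M[F]_n) : (0 < n)%N -> ~ simple M ->
  exists k (W : 'M[F]_(k, n)),
  [/\ forall j, stablemx W (M j), (0 < \rank W)%N & (\rank W < n)%N].
Proof.
move=> n0 nM; apply: NNPP => H; apply: nM; split=> // k W sW.
have [->|nW] := eqVneq W 0; [by left|right].
apply: contra_notT H => fW; exists k, W; split=> //.
  by rewrite lt0n mxrank_eq0.
by rewrite ltn_neqAle fW rank_leq_col.
Qed.

Lemma exists_simple_sub n (M : J -> 'M[F]_n) : (0 < n)%N ->
  exists u (U : J -> 'M[F]_u) (I : 'M[F]_(u, n)),
  [/\ simple U, row_free I & intertwines U M I].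
Proof.
elim/ltn_ind: n M => n IH M n0.
have [sM|nM] := classic (simple M).
  exists n, M, 1%:M; split=> //; first by rewrite row_free_unit unitmx1.
  by move=> j; rewrite mulmx1 mul1mx.
have [k [W [sW W0 Wn]]] := not_simple n0 nM.
have [y [x [P [P' [Y [B [X [hx yx [PP' P'P] hM _]]]]]]]] := stable_block sW.
have [||u [U [I [sU fI hI]]]] := IH x _ X; [by rewrite hx|by rewrite hx|].
exists u, U, (I *m (row_mx 0 1%:M *m P)); split=> //.
  rewrite -kermx_eq0; apply/eqP/row_matrixP => i.
  rewrite row0; have := row_sub i (kermx (I *m (row_mx 0 1%:M *m P))).
  move/sub_kermxP; rewrite !mulmxA => H.
  have : row i (kermx (I *m row_mx 0 1%:M *m P)) *m I = 0.
    have := congr1 (fun Z => Z *m P' *m col_mx 0 1%:M) H.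
    rewrite -!mulmxA (mulmxA P) PP' mul1mx mul_row_col mul0mx mulmx1 add0r.
    by rewrite !mulmx1 mul0mx.
  by move/eqP; rewrite -[X in _ == X](mul0mx _ I) (inj_eq (row_free_inj fI)) => /eqP.
by apply: (intertwines_comp hI); apply: block_sub hM.
Qed.

Lemma exists_simple_quotient n (M : J -> 'M[F]_n) : (0 < n)%N ->
  exists u (U : J -> 'M[F]_u) (Q : 'M[F]_(n, u)),
  [/\ simple U, row_full Q & intertwines M U Q].
Proof.
elim/ltn_ind: n M => n IH M n0.
have [sM|nM] := classic (simple M).
  exists n, M, 1%:M; split=> //; first by rewrite row_full_unit unitmx1.
  by move=> j; rewrite mulmx1 mul1mx.
have [k [W [sW W0 Wn]]] := not_simple n0 nM.
have [y [x [P [P' [Y [B [X [hx yx [PP' P'P] hM _]]]]]]]] := stable_block sW.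
have [||u [U [Q [sU fQ hQ]]]] := IH y _ Y; [lia|lia|].
exists u, U, (P' *m col_mx 1%:M 0 *m Q); split=> //.
  rewrite -sub1mx; apply/submxP.
  have [Q' Q'Q] : exists Q', Q' *m Q = 1%:M by exists (pinvmx Q); rewrite mulVpmx.
  exists (Q' *m row_mx 1%:M 0 *m P).
  rewrite -!mulmxA (mulmxA P) PP' mul1mx (mulmxA (row_mx _ _)) mul_row_col.
  by rewrite mul1mx mul0mx addr0 mul1mx Q'Q.
by apply: intertwines_comp hQ; apply: block_quotient PP' P'P hM.
Qed.

End Modules.

Lemma schur (F : closedFieldType) J m (X : J -> 'M[F]_m) T :
  simple X -> intertwines X X T -> exists a, T = a%:M.
Proof.
move=> sX hT; have m0 := sX.1.
have : size (char_poly T) != 1%N by rewrite size_char_poly; case: m m0 {X T sX hT}.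
case/closed_rootP=> a; rewrite -eigenvalue_root_char => ea.
exists a; apply: NNPP => nT.
have : row_free (T - a%:M).
  apply: simple_row_free sX _ _ => [j|/subr0_eq//].
  by rewrite mulmxBl mulmxBr hT scalar_mxC.
by move: ea; rewrite /eigenvalue /eigenspace kermx_eq0 => /negPf->.
Qed.

Lemma exists_row_neq0 (F : fieldType) m n (A : 'M[F]_(m, n)) :
  A != 0 -> exists i, row i A != 0.
Proof.
move=> nA; apply: NNPP => H; case/eqP: nA; apply/row_matrixP => i.
by rewrite row0; apply/eqP/negPn/negP => ni; apply: H; exists i.
Qed.

(** A row space of maximal rank inside [P] is all of [P]. This turns subspaces described by a
    proposition, such as orbits given by an existential, into matrices. *)
Lemma subspace_rowspace (F : fieldType) m (P : 'rV[F]_m -> Prop) :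
  P 0 -> (forall a u v, P u -> P v -> P (a *: u + v)) ->
  exists k (W : 'M[F]_(k, m)), forall w, P w <-> (w <= W)%MS.
Proof.
move=> P0 PL.
have lin k (W : 'M[F]_(k, m)) : (forall i, P (row i W)) ->
    forall w, (w <= W)%MS -> P w.
  move=> hW w /submxP[D ->]; rewrite mulmx_sum_row.
  by elim/big_rec: _ => // i u _ Pu; apply: PL.
have H d k (W : 'M[F]_(k, m)) : (m - \rank W <= d)%N -> (forall i, P (row i W)) ->
    exists k (W : 'M[F]_(k, m)), forall w, P w <-> (w <= W)%MS.
  elim: d k W => [|d IH] k W hr hW.
    exists k, W => w; split; last exact: lin.
    by rewrite submx_full // /row_full eqn_leq rank_leq_col -subn_eq0 -leqn0.
  have [all_in|] := classic (forall w, P w -> (w <= W)%MS).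
    by exists k, W => w; split; [exact: all_in|exact: lin].
  move=> /not_all_ex_not-[w nPw]; have [Pw /negP nw] := imply_to_and _ _ nPw.
  apply: (IH _ (col_mx W w)).
    have : (\rank W < \rank (col_mx W w))%N.
      apply: rank_ltmx; rewrite ltmxE -addsmxE addsmxSl /=.
      by rewrite col_mx_sub negb_and nw orbT.
    by lia.
  move=> i; case: (split_ordP i) => j ->; first by rewrite rowKu.
  by rewrite rowKd row_id.
by apply: (H m 0 0); [rewrite leq_subr|case].
Qed.

Inductive ncpoly (F J : Type) :=
  NCconst of F | NCvar of J | NCadd of ncpoly F J & ncpoly F J
| NCmul of ncpoly F J & ncpoly F J.

Section NCPoly.
Variables (F : fieldType) (J : Type).
Local Notation poly := (ncpoly F J).

Fixpoint nceval m (X : J -> 'M[F]_m) (f : poly) : 'M[F]_m :=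
  match f with
  | NCconst a => a%:M
  | NCvar j => X j
  | NCadd f g => nceval X f + nceval X g
  | NCmul f g => nceval X f *m nceval X g
  end.

(* The off-diagonal block of the value at [block_family X B Y]; for [Y = X] it
   is the derivative at [X] in the direction [B]. *)
Fixpoint ncoff m n (X : J -> 'M[F]_m) (B : J -> 'M[F]_(m, n)) (Y : J -> 'M[F]_n)
    (f : poly) : 'M[F]_(m, n) :=
  match f with
  | NCconst a => 0
  | NCvar j => B j
  | NCadd f g => ncoff X B Y f + ncoff X B Y g
  | NCmul f g => nceval X f *m ncoff X B Y g + ncoff X B Y f *m nceval Y g
  end.

Lemma nceval_block m n (X : J -> 'M[F]_m) (B : J -> 'M[F]_(m, n))
    (Y : J -> 'M[F]_n) f :
  nceval (block_family X B Y) f =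
  block_mx (nceval X f) (ncoff X B Y f) 0 (nceval Y f).
Proof.
elim: f => [a|j|f IHf g IHg|f IHf g IHg] //=.
- by rewrite scalar_mx_block.
- by rewrite IHf IHg add_block_mx addr0.
- by rewrite IHf IHg mulmx_block !mulmx0 !mul0mx !addr0 add0r.
Qed.

Lemma nceval_intertwines m n (X : J -> 'M[F]_m) (Y : J -> 'M[F]_n) T f :
  intertwines X Y T -> nceval X f *m T = T *m nceval Y f.
Proof.
move=> hT; elim: f => [a|j|f IHf g IHg|f IHf g IHg] //=.
- by rewrite scalar_mxC.
- by rewrite mulmxDl mulmxDr IHf IHg.
- by rewrite -mulmxA IHg !mulmxA IHf.
Qed.

Lemma nceval_stable m k (W : 'M[F]_(k, m)) (X : J -> 'M[F]_m) f :
  (forall j, stablemx W (X j)) -> stablemx W (nceval X f).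
Proof.
move=> sW; elim: f => [a|j|f IHf g IHg|f IHf g IHg] //=.
- exact: stablemxC.
- exact: stablemxD.
- exact: stablemxM.
Qed.

Lemma nceval_sum m (X : J -> 'M[F]_m) (I : finType) (E : I -> 'M[F]_m) :
  (forall i, exists f, nceval X f = E i) -> exists f, nceval X f = \sum_i E i.
Proof.
move=> hE; elim/big_rec: _ => [|i E' _ [g <-]].
  by exists (NCconst _ 0); rewrite /= raddf0.
by have [f <-] := hE i; exists (NCadd f g).
Qed.

Lemma simple_transitive m (X : J -> 'M[F]_m) (v w : 'rV[F]_m) :
  simple X -> v != 0 -> exists f, w = v *m nceval X f.
Proof.
move=> [m0 sX] v0.
have [||k [W hW]] := @subspace_rowspace F m (fun w => exists f, w = v *m nceval X f).
- by exists (NCconst _ 0); rewrite /= raddf0 mulmx0.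
- move=> a _ _ [f ->] [g ->]; exists (NCadd (NCmul (NCconst _ a) f) g).
  by rewrite /= mul_scalar_mx mulmxDr scalemxAr.
apply/hW; suff fW : row_full W by rewrite submx_full.
case: (sX _ W) => // [j|W0].
  apply/row_subP => i; rewrite row_mul; apply/hW.
  have [f ->] := (hW (row i W)).2 (row_sub i W).
  by exists (NCmul f (NCvar _ j)); rewrite mulmxA.
have : (v <= W)%MS by apply/hW; exists (NCconst _ 1); rewrite /= mulmx1.
by rewrite W0 => /submx0null v00; rewrite v00 eqxx in v0.
Qed.

End NCPoly.

(* Burnside's theorem, by the descent of Lomonosov and Rosenthal to an element
   of rank one. *)
Section Burnside.
Variables (F : closedFieldType) (J : Type) (m : nat) (X : J -> 'M[F]_m).
Hypothesis sX : simple X.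

Let image E := exists f, nceval X f = E.

Lemma nceval_rank1 : exists2 E, image E & \rank E = 1%N.
Proof.
have m0 := sX.1.
suff H r E : (\rank E <= r.+1)%N -> E != 0 -> image E ->
    exists2 E, image E & \rank E = 1%N.
  apply: (H m 1%:M); first by rewrite (leq_trans (rank_leq_row _)).
    by rewrite -mxrank_eq0 mxrank1 -lt0n.
  by exists (NCconst _ 1).
elim: r E => [|r IH] E hr nE hE.
  by exists E => //; apply/eqP; rewrite eqn_leq hr lt0n mxrank_eq0.
have [|r1] := eqVneq (\rank E) 1%N; first by exists E.
have r2 : (1 < \rank E)%N by rewrite ltn_neqAle eq_sym r1 lt0n mxrank_eq0.
have [i1 ni1] := exists_row_neq0 nE.
(* In rank at least 2 some row [i2] of [E] is no multiple of row [i1]. The element [a] sends row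
   [i1] to the basis vector [i2], so row [i1] of [E a E] is row [i2] of [E], and [E a E - l E] never
   vanishes; for an eigenvalue [l] of [a E] on the row space of [E] its rank drops. *)
have [i2 ni2] : exists i, ~ (row i E <= row i1 E)%MS.
  apply: not_all_ex_not => /row_subP /mxrankS.
  by rewrite leqNgt (leq_ltn_trans (rank_leq_row _)).
have [f hf] := simple_transitive (delta_mx 0 i2) sX ni1.
have [g hg] := hE; set a := nceval X f in hf.
set R := row_base E.
have /submxP[B hB] : (R *m (a *m E) <= R)%MS.
  by rewrite eq_row_base mulmxA submxMl.
have [l el] : exists l, eigenvalue B l.
  have : size (char_poly B) != 1%N by rewrite size_char_poly; case: (\rank E) r2.
  by case/closed_rootP=> l; rewrite -eigenvalue_root_char => el; exists l.
have EE : E *m (a *m E) - l *: E = col_base E *m (B - l%:M) *m R.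
  have CR : col_base E *m R = E by apply: mulmx_base.
  rewrite mulmxBr mulmxBl -(mulmxA _ B) -hB [col_base E *m (R *m _)]mulmxA CR.
  by rewrite mul_mx_scalar -scalemxAl CR.
apply: (IH (E *m (a *m E) - l *: E)).
- rewrite -ltnS; apply: leq_trans hr.
  rewrite EE (leq_ltn_trans (mxrankM_maxl _ _)) // (leq_ltn_trans (mxrankM_maxr _ _)) //.
  rewrite ltn_neqAle rank_leq_row andbT.
  by move: el; rewrite /eigenvalue /eigenspace kermx_eq0.
- apply/eqP => /(congr1 (row i1)); rewrite row0 linearB /= linearZ /= row_mul mulmxA -hf.
  by move/subr0_eq; rewrite -rowE => h; apply: ni2; rewrite h scalemx_sub.
- exists (NCadd (NCmul g (NCmul f g)) (NCmul (NCconst _ (- l)) g)).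
  by rewrite /= hg mul_scalar_mx scaleNr.
Qed.

Lemma burnside E : image E.
Proof.
have [E1 [g hg] rE1] := nceval_rank1.
have [c [r hE1]] : exists c r, E1 = (c : 'cV[F]_m) *m (r : 'rV[F]_m).
  move: (mulmx_base E1); move: (col_base E1) (row_base E1); rewrite rE1.
  by move=> c r <-; exists c, r.
have nE1 : E1 != 0 by rewrite -mxrank_eq0 rE1.
have nr : r != 0 by apply: contra nE1 => /eqP r0; rewrite hE1 r0 mulmx0.
have nc : c != 0 by apply: contra nE1 => /eqP c0; rewrite hE1 c0 mul0mx.
(* By duality: a nonzero row [u] killing every [nceval X f *m c] could be moved to each basis row,
   which would force [c = 0]. *)
have left_trans x : exists f, x = nceval X f *m c.
  have [||k [W hW]] := @subspace_rowspace F m (fun w => exists f, w^T = nceval X f *m c).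
  - by exists (NCconst _ 0); rewrite trmx0 /= raddf0 mul0mx.
  - move=> a u v [f hf] [h hh]; exists (NCadd (NCmul (NCconst _ a) f) h).
    by rewrite linearD linearZ /= hf hh mul_scalar_mx mulmxDl scalemxAl.
  rewrite -[x]trmxK; apply/hW; apply: contraNT (nc) => nx.
  have : ~~ row_full W by apply: contra nx => /submx_full->.
  move=> nW; have : kermx W^T != 0 by rewrite kermx_eq0 /row_free mxrank_tr.
  move=> /exists_row_neq0[i ni].
  set u := row i _ in ni.
  have uW : u *m W^T = 0 by apply/sub_kermxP; apply: row_sub.
  have uc f : u *m (nceval X f *m c) = 0.
    have : ((nceval X f *m c)^T <= W)%MS by apply/hW; exists f; rewrite trmxK.
    by case/submxP=> D hD; rewrite -[_ *m c]trmxK hD trmx_mul mulmxA uW mul0mx.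
  apply/eqP/matrixP => j k'; rewrite ord1.
  have [f hf] := simple_transitive (delta_mx 0 j) sX ni.
  have := uc f; rewrite mulmxA -hf -rowE => /matrixP/(_ 0 0).
  by rewrite !mxE.
have -> : E = \sum_i col i E *m delta_mx 0 i.
  rewrite -{1}[E]mulmx1; apply/matrixP => i j; rewrite summxE !mxE.
  by apply: eq_bigr => k _; rewrite !mxE big_ord1 !mxE eqxx /= eq_sym.
apply: nceval_sum => i.
have [f1 h1] := left_trans (col i E).
have [f2 h2] := simple_transitive (delta_mx 0 i) sX nr.
by exists (NCmul (NCmul f1 g) f2); rewrite /= h1 h2 hg hE1 !mulmxA.
Qed.

End Burnside.

(** The trace form is a perfect pairing. Surjectivity of a linear map is thereby reduced to a
    computation with its transpose. *)
Lemma trace_dual (F : fieldType) m n (P : 'M[F]_(m, n) -> Prop) :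
  P 0 -> (forall a u v, P u -> P v -> P (a *: u + v)) ->
  (forall S : 'M_(n, m), (forall Z, P Z -> \tr (S *m Z) = 0) -> S = 0) ->
  forall Z, P Z.
Proof.
move=> P0 PL hP.
have [||k [W hW]] := @subspace_rowspace F _ (fun w => P (vec_mx w)).
- by rewrite linear0.
- by move=> a u v Pu Pv; rewrite linearP; apply: PL.
suff fW : row_full W.
  by move=> Z; rewrite -(mxvecK Z); apply/hW; rewrite submx_full.
apply: contraT => nW; have : kermx W^T != 0 by rewrite kermx_eq0 /row_free mxrank_tr.
case/exists_row_neq0=> i; set u := row i _ => nu.
have uW : u *m W^T = 0 by apply/sub_kermxP; apply: row_sub.
have : (vec_mx u)^T = 0 :> 'M_(n, m).
  apply: hP => Z PZ.
  have : (mxvec Z <= W)%MS by apply/hW; rewrite mxvecK.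
  case/submxP=> D hD; have : u *m (mxvec Z)^T = 0 by rewrite hD trmx_mul mulmxA uW mul0mx.
  move/matrixP/(_ 0 0); rewrite !mxE (reindex _ (curry_mxvec_bij m n)) /=.
  rewrite (eq_bigr (fun p => u 0 (mxvec_index p.1 p.2) *
    (mxvec Z)^T (mxvec_index p.1 p.2) 0)) /=; last by case.
  rewrite -(pair_bigA _ (fun i j => u 0 (mxvec_index i j) * (mxvec Z)^T (mxvec_index i j) 0)) /= => <-.
  rewrite /mxtrace exchange_big /=; apply: eq_bigr => j _; rewrite !mxE.
  by apply: eq_bigr => l _; rewrite !mxE mxvecE.
move/(congr1 trmx); rewrite trmxK trmx0 => /(congr1 mxvec); rewrite vec_mxK linear0 => u0.
by rewrite u0 eqxx in nu.
Qed.

Lemma mxtrace_eq0 (F : fieldType) m n (A : 'M[F]_(m, n)) :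
  (forall T, \tr (A *m T) = 0) -> A = 0.
Proof.
move=> hA; apply/matrixP => i j; rewrite mxE -(hA (delta_mx j i)) /mxtrace.
rewrite (bigD1 i) //= big1 => [|k nki]; rewrite !mxE.
  rewrite (bigD1 j) //= big1 => [|l nlj]; rewrite !mxE ?eqxx ?mulr1 ?addr0 //.
  by rewrite (negPf nlj) mulr0.
by rewrite big1 // => l _; rewrite !mxE (negPf nki) andbF mulr0.
Qed.

(** * Derivatives of products and cocycles *)

Section Cocycles.
Variables (F : fieldType) (N : nat).

(** Padding with 1 makes partial products functions of a plain natural number, so that
    [prefix X j.+1] carries no bound. *)
Definition ext_family m (X : 'I_N -> 'M[F]_m) (i : nat) : 'M[F]_m :=
  if insub i is Some j then X j else 1.

Definition prefix m (X : 'I_N -> 'M[F]_m) k : 'M[F]_m :=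
  \prod_(i < k) ext_family X i.

Lemma ext_familyE m (X : 'I_N -> 'M[F]_m) (j : 'I_N) : ext_family X j = X j.
Proof. by rewrite /ext_family valK. Qed.

Lemma prefix0 m (X : 'I_N -> 'M[F]_m) : prefix X 0 = 1%:M.
Proof. by rewrite /prefix big_ord0. Qed.

Lemma prefixS m (X : 'I_N -> 'M[F]_m) (j : 'I_N) :
  prefix X j.+1 = prefix X j *m X j.
Proof. by rewrite /prefix big_ord_recr /= ext_familyE. Qed.

Lemma prefixN m (X : 'I_N -> 'M[F]_m) : prefix X N = \prod_(j < N) X j.
Proof. by rewrite /prefix; apply: eq_bigr => j _; rewrite ext_familyE. Qed.

Lemma prefix_ind m (X : 'I_N -> 'M[F]_m) (P : nat -> Prop) :
  P 0%N -> (forall j : 'I_N, P j -> P j.+1) -> forall k, (k <= N)%N -> P k.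
Proof.
move=> P0 PS; elim=> [//|k IH] hk.
by apply: (PS (Ordinal hk)); apply: IH; apply: ltnW.
Qed.

Lemma prefix_unit m (X : 'I_N -> 'M[F]_m) k :
  (forall j, X j \in unitmx) -> prefix X k \in unitmx.
Proof.
move=> uX; rewrite /prefix; elim/big_rec: _ => [|i A _ uA]; first exact: unitmx1.
rewrite unitmx_mul uA andbT /ext_family; case: insubP => [j _ _|_] //.
exact: unitmx1.
Qed.

Lemma prod1_unit m (X : 'I_N -> 'M[F]_m) :
  \prod_(j < N) X j = 1%:M -> forall j, X j \in unitmx.
Proof.
move=> pX j; rewrite unitmxE unitfE; have : \det (\prod_(j < N) X j) != 0.
  by rewrite pX det1 oner_neq0.
have -> : \det (\prod_(j < N) X j) = \prod_(j < N) \det (X j).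
  by apply: (big_morph (fun A : 'M[F]_m => \det A)); [exact: det_mulmx|exact: det1].
by move/prodf_neq0; apply.
Qed.

Section Pair.
Variables (m n : nat) (X : 'I_N -> 'M[F]_m) (Y : 'I_N -> 'M[F]_n).

Definition ad (T : {ffun 'I_N -> 'M[F]_(m, n)}) : {ffun 'I_N -> 'M[F]_(m, n)} :=
  [ffun j => X j *m T j - T j *m Y j].

(* Up to the factor [\prod_j Y j], the derivative of the product of
   [block_mx (X j) (B j) 0 (Y j)] with respect to B. *)
Definition prod_deriv (B : {ffun 'I_N -> 'M[F]_(m, n)}) : 'M[F]_(m, n) :=
  \sum_(j < N) prefix X j *m B j *m invmx (prefix Y j.+1).

Lemma ad_apply T j : ad T j = X j *m T j - T j *m Y j.
Proof. by rewrite ffunE. Qed.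

Lemma ad_linear : linear ad.
Proof.
move=> a u v; apply/ffunP => j; rewrite !ffunE /=.
rewrite mulmxDr mulmxDl -!scalemxAr -!scalemxAl scalerBr !opprD !addrA.
by congr (_ + _); rewrite addrAC.
Qed.
HB.instance Definition _ := GRing.isLinear.Build F
  {ffun 'I_N -> 'M[F]_(m, n)} {ffun 'I_N -> 'M[F]_(m, n)} *:%R ad ad_linear.

Lemma prod_deriv_linear : linear prod_deriv.
Proof.
move=> a u v; rewrite /prod_deriv scaler_sumr -big_split /=; apply: eq_bigr => j _.
by rewrite !ffunE mulmxDr mulmxDl -!scalemxAr -!scalemxAl.
Qed.
HB.instance Definition _ := GRing.isLinear.Build F
  {ffun 'I_N -> 'M[F]_(m, n)} 'M[F]_(m, n) *:%R prod_deriv prod_deriv_linear.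

Lemma adZ a T : ad (a *: T) = a *: ad T.
Proof. by rewrite -[a *: T]addr0 ad_linear (raddf0 ad) addr0. Qed.

Lemma prod_derivZ a B : prod_deriv (a *: B) = a *: prod_deriv B.
Proof. by rewrite -[a *: B]addr0 prod_deriv_linear (raddf0 prod_deriv) addr0. Qed.

Lemma prod_deriv_ad_linear a u v : prod_deriv (ad (a *: u + v)) =
  a *: prod_deriv (ad u) + prod_deriv (ad v).
Proof. by rewrite ad_linear prod_deriv_linear. Qed.

Lemma prod_deriv_ad0 : prod_deriv (ad 0) = 0.
Proof. by rewrite (raddf0 ad) (raddf0 prod_deriv). Qed.

Definition const_family (C : 'M[F]_(m, n)) : {ffun 'I_N -> 'M[F]_(m, n)} :=
  [ffun=> C].

Lemma const_family_linear : linear const_family.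
Proof. by move=> a u v; apply/ffunP => j; rewrite !ffunE. Qed.
HB.instance Definition _ := GRing.isLinear.Build F
  'M[F]_(m, n) {ffun 'I_N -> 'M[F]_(m, n)} *:%R const_family const_family_linear.

Lemma dim_mx : dim 'M[F]_(m, n) = (m * n)%N. Proof. by []. Qed.

Lemma dim_family : dim {ffun 'I_N -> 'M[F]_(m, n)} = (N * (m * n))%N.
Proof. by rewrite -[in RHS](card_ord N). Qed.

Hypothesis uX : forall j, X j \in unitmx.
Hypothesis uY : forall j, Y j \in unitmx.

(** Testing on families supported at one index shows that [invmx (prefix Y k) *m S *m prefix X k]
    does not depend on [k]. At [k = 0] it is [S], so [S] intertwines all prefixes, hence all
    factors. Thus the cokernel of the complex is dual to the homomorphisms from [Y] to [X]. *)
Lemma prod_deriv_duality (S : 'M[F]_(n, m)) :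
  (forall T, \tr (S *m prod_deriv (ad T)) = 0) -> intertwines Y X S.
Proof.
move=> hS.
have step (j : 'I_N) :
    invmx (prefix Y j.+1) *m S *m prefix X j.+1 =
    invmx (prefix Y j) *m S *m prefix X j.
  set Z := invmx (prefix Y j.+1) *m S *m prefix X j.
  have -> : invmx (prefix Y j.+1) *m S *m prefix X j.+1 = Z *m X j.
    by rewrite (prefixS X) !mulmxA.
  have -> : invmx (prefix Y j) *m S *m prefix X j = Y j *m Z.
    rewrite /Z !mulmxA; congr (_ *m _ *m _).
    apply: (can_inj (mulKmx (prefix_unit j uY))).
    by rewrite !mulmxA -prefixS !mulmxV ?prefix_unit.
  apply/subr0_eq/mxtrace_eq0 => T.
  rewrite -(hS [ffun j' => if j' == j then T else 0]) /prod_deriv.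
  rewrite (bigD1 j) //= big1 => [|i nij]; last first.
    by rewrite !ffunE (negPf nij) mulmx0 mul0mx subrr mulmx0 mul0mx.
  rewrite addr0 !ffunE eqxx.
  transitivity (\tr (Z *m (X j *m T - T *m Y j))).
    rewrite mulmxBl mulmxBr !linearB /= -!mulmxA; congr (_ - _).
    by rewrite mxtrace_mulC -!mulmxA.
  by rewrite [in RHS]mulmxA [RHS]mxtrace_mulC /Z !mulmxA.
have all_eq k : (k <= N)%N -> S *m prefix X k = prefix Y k *m S.
  move=> hk; apply: (canRL (mulKVmx (prefix_unit k uY))).
  rewrite mulmxA; move: k hk; apply: (prefix_ind X); first by rewrite !prefix0 invmx1 mul1mx mulmx1.
  by move=> j; rewrite step.
move=> j; apply: (can_inj (mulKmx (prefix_unit j uY))).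
rewrite !mulmxA -(prefixS Y) -(all_eq j.+1) // (prefixS X) mulmxA all_eq //.
exact: ltnW.
Qed.

Lemma prod_deriv_surj :
  (forall S, intertwines Y X S -> S = 0) -> forall Z, exists T, prod_deriv (ad T) = Z.
Proof.
move=> hom0; apply: (@trace_dual F _ _ (fun Z => exists T, prod_deriv (ad T) = Z)).
- by exists 0; rewrite prod_deriv_ad0.
- by move=> a _ _ [T1 <-] [T2 <-]; exists (a *: T1 + T2); apply: prod_deriv_ad_linear.
- by move=> S hS; apply/hom0/prod_deriv_duality => T; apply: hS; exists T.
Qed.

Hypothesis pX : \prod_(j < N) X j = 1%:M.
Hypothesis pY : \prod_(j < N) Y j = 1%:M.

Lemma ad_const C j : ad (const_family C) j = X j *m C - C *m Y j.
Proof. by rewrite ad_apply ffunE. Qed.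

(** Conjugating all factors by the same matrix preserves a product equal to 1; to first order this
    is a telescoping sum in [Q]. *)
Lemma prod_deriv_const C : prod_deriv (ad (const_family C)) = 0.
Proof.
pose Q k := prefix X k *m C *m invmx (prefix Y k).
rewrite /prod_deriv (eq_bigr (fun j : 'I_N => Q j.+1 - Q j)); last first.
  move=> j _; rewrite !ffunE /Q mulmxBr mulmxBl !mulmxA -prefixS; congr (_ - _).
  rewrite -!mulmxA; congr (_ *m (_ *m _)).
  apply: (can_inj (mulmxK (prefix_unit j.+1 uY))).
  by rewrite mulmxKV ?prefix_unit // (prefixS Y) mulKmx ?prefix_unit.
rewrite -(big_mkord xpredT (fun k => Q k.+1 - Q k)) telescope_sumr // /Q !prefixN pX pY.
by rewrite !prefix0 invmx1 !mulmx1 !mul1mx subrr.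
Qed.

(* Counting dimensions: the kernel of [prod_deriv \o ad] has dimension at least
   [N m n - m n], and families [T] with [ad T = ad (const_family C)] form a
   space of dimension at most [\dim (lker ad) + m n]. *)
Lemma nontrivial_cocycle (l : {linear {ffun 'I_N -> 'M[F]_(m, n)} -> F^o}) :
  (\dim (lker (linfun ad)) + 2 * (m * n) + 1 < N * (m * n))%N ->
  exists T, [/\ prod_deriv (ad T) = 0, l T = 0 &
    ~ exists C, ad T = ad (const_family C)].
Proof.
move=> hdim.
(* Adding [l] to the target costs one more dimension, whence the [+ 1] in [hdim]. *)
pose f T := (prod_deriv (ad T), l T).
have flin : linear f by move=> a u v; rewrite /f !linearP.
pose fL : {linear _ -> ('M[F]_(m, n) * F^o)%type} := HB.pack f (GRing.isLinear.Build _ _ _ _ f flin).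
pose V := lker (linfun fL).
pose W := (lker (linfun ad) + limg (linfun const_family))%VS.
have dV : (N * (m * n) <= \dim V + (m * n + 1))%N.
  have h : (\dim V + \dim (limg (linfun fL)) = N * (m * n))%N.
    by rewrite -dim_family -dimvf -(limg_ker_dim (linfun fL) fullv) capfv.
  have := dimvS (subvf (limg (linfun fL))); rewrite dimvf.
  have -> : dim ('M[F]_(m, n) * F^o)%type = (m * n + 1)%N by [].
  lia.
have dW : (\dim W <= \dim (lker (linfun ad)) + m * n)%N.
  apply: leq_trans (dimv_add_leqif _ _).1 _; rewrite leq_add2l.
  by rewrite -dim_mx -dimvf -(limg_ker_dim (linfun const_family) fullv) leq_addl.
have : ~~ (V <= W)%VS by apply: contraL hdim => /dimvS; lia.
case/subvPn=> T; rewrite memv_ker lfunE /= => /eqP[hT lT] nW.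
exists T; split=> // -[C hC]; case/negP: nW.
have -> : T = (T - const_family C) + const_family C by rewrite subrK.
apply: memv_add; first by rewrite memv_ker lfunE /= linearB /= hC subrr.
by rewrite -[const_family C](lfunE const_family) memv_img ?memvf.
Qed.

(** Without homomorphisms from [Y] to [X] the map [prod_deriv \o ad] is onto, which gives the
    dimension of its kernel [V]; without homomorphisms from [X] to [Y] the constant families meet
    the kernel of [ad] trivially, which gives the dimension of [W]. As [W] lies in [V], [hdim] makes
    them equal. *)
Lemma cocycle_trivial :
  (forall S, intertwines Y X S -> S = 0) -> (forall S, intertwines X Y S -> S = 0) ->
  (N * (m * n) <= \dim (lker (linfun ad)) + 2 * (m * n))%N ->
  forall T, prod_deriv (ad T) = 0 -> exists C, ad T = ad (const_family C).
Proof.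
move=> hYX hXY hdim T hT.
pose f T := prod_deriv (ad T).
have flin : linear f by move=> a u v; rewrite /f !linearP.
pose fL : {linear _ -> 'M[F]_(m, n)} := HB.pack f (GRing.isLinear.Build _ _ _ _ f flin).
pose V := lker (linfun fL).
pose W := (lker (linfun ad) + limg (linfun const_family))%VS.
have ad_const0 C : ad (const_family C) = 0 -> C = 0.
  move=> h; apply: hXY => j; apply/subr0_eq.
  by move/ffunP/(_ j): h; rewrite !ffunE.
have dV : (\dim V + m * n = N * (m * n))%N.
  suff fullE : limg (linfun fL) = fullv.
    by rewrite -dim_family -dimvf -(limg_ker_dim (linfun fL) fullv) capfv fullE dimvf dim_mx.
  apply/vspaceP => Z; rewrite memvf; have [T' <-] := prod_deriv_surj hYX Z.
  by rewrite -[prod_deriv (ad T')](lfunE fL) memv_img ?memvf.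
have dW : (\dim (lker (linfun ad)) + m * n = \dim W)%N.
  rewrite dimv_disjoint_sum.
    congr (_ + _)%N; rewrite limg_dim_eq ?dimvf //.
    apply/eqP; rewrite -subv0; apply/subvP => C; rewrite memv_cap memvf memv_ker lfunE.
    by move=> /= /eqP C0; rewrite (ad_const0 C) ?mem0v // C0 linear0.
  apply/eqP; rewrite -subv0; apply/subvP => T'; rewrite memv_cap memv_ker lfunE /=.
  case/andP=> /eqP hT' /memv_imgP[C _ hC]; rewrite hC lfunE /= in hT' *.
  by rewrite (ad_const0 C hT') linear0 mem0v.
have sWV : (W <= V)%VS.
  apply/subvP => T' /memv_addP[T1 h1 [_ /memv_imgP[C _ ->] ->]].
  move: h1; rewrite !memv_ker !lfunE /= => /eqP h1; rewrite /f (linearD ad) /= h1 add0r.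
  by rewrite prod_deriv_const.
have : T \in W.
  suff -> : W = V by rewrite memv_ker lfunE /= /f hT.
  by apply/eqP; rewrite eqEdim sWV; lia.
case/memv_addP=> T1; rewrite memv_ker lfunE /= => /eqP h1 [_ /memv_imgP[C _ ->]] ->.
by exists C; rewrite linearD /= h1 add0r lfunE.
Qed.

End Pair.
End Cocycles.

Section CocycleDimensions.
Variables (F : fieldType) (N : nat).

(** Conjugating the factors does not change the determinant of the product, and the trace is the
    derivative of the determinant at 1. *)
Lemma mxtrace_prod_deriv m (X : 'I_N -> 'M[F]_m) T :
  (forall j, X j \in unitmx) -> \tr (prod_deriv X X (ad X X T)) = 0.
Proof.
move=> uX; rewrite /prod_deriv linear_sum /= big1 // => j _; rewrite ffunE.
have iE : invmx (prefix X j.+1) *m prefix X j = invmx (X j).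
  apply: (can_inj (mulKmx (prefix_unit j.+1 uX))).
  by rewrite mulKVmx ?prefix_unit // prefixS -mulmxA mulmxV ?mulmx1.
rewrite mxtrace_mulC mulmxA iE mulmxBr linearB /= mulKmx //.
by rewrite mulmxA mxtrace_mulC mulmxA mulmxV // mul1mx subrr.
Qed.

(** If only scalars commute with [X], the orthogonal of the image consists of scalars. As [m] is
    invertible in [F], adding the scalar matrices fills the whole space, and the trace separates the
    two summands. *)
Lemma prod_deriv_surj_traceless m (X : 'I_N -> 'M[F]_m) :
  (forall j, X j \in unitmx) -> m%:R != 0 :> F ->
  (forall S, intertwines X X S -> exists a, S = a%:M) ->
  forall Z, \tr Z = 0 -> exists T, prod_deriv X X (ad X X T) = Z.
Proof.
move=> uX m0 cX Z tZ.
have [||S hS|T [a hZ]] := @trace_dual F m m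
  (fun Z => exists T a, Z = prod_deriv X X (ad X X T) + a%:M) _ _ _ Z.
- by exists 0, 0; rewrite prod_deriv_ad0 raddf0 addr0.
- move=> a _ _ [T1 [a1 ->]] [T2 [a2 ->]]; exists (a *: T1 + T2), (a * a1 + a2).
  by rewrite prod_deriv_ad_linear scalerDr raddfD /= -scale_scalar_mx addrACA.
- have [|s sS] := cX S.
    by apply: prod_deriv_duality => // T; apply: hS; exists T, 0; rewrite raddf0 addr0.
  have := hS 1%:M; rewrite sS mulmx1 mxtrace_scalar => /(_ _)/eqP.
  rewrite -mulr_natr mulf_eq0 (negPf m0) orbF => s0.
  by rewrite (eqP (s0 _)) ?raddf0 //; exists 0, 1; rewrite prod_deriv_ad0 add0r.
- exists T; move: tZ; rewrite hZ raddfD /= mxtrace_prod_deriv // add0r.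
  rewrite mxtrace_scalar => /eqP; rewrite -mulr_natr mulf_eq0 (negPf m0) orbF => /eqP->.
  by rewrite raddf0 addr0.
Qed.

Lemma diagonal_ad m n (A P : 'M[F]_m) (B Q : 'M[F]_n) d e T :
  Q \in unitmx -> P *m A = diag_mx (\row_i d i) *m P ->
  Q *m B = diag_mx (\row_i e i) *m Q ->
  P *m (A *m T - T *m B) *m invmx Q =
  \matrix_(i, k) ((d i - e k) * (P *m T *m invmx Q) i k).
Proof.
move=> uQ hA hB.
have hB' : B *m invmx Q = invmx Q *m diag_mx (\row_i e i).
  by apply: (can_inj (mulKmx uQ)); rewrite mulmxA hB mulmxK // mulKVmx.
rewrite mulmxBr mulmxBl [P *m (A *m T)]mulmxA hA -!mulmxA hB'.
rewrite [P *m (T *m _)]mulmxA [T *m (_ *m _)]mulmxA [P *m (_ *m _)]mulmxA.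
rewrite [P *m (T *m _)]mulmxA mul_diag_mx mul_mx_diag.
by apply/matrixP => i k; rewrite !mxE mulrBl [e k * _]mulrC.
Qed.

Definition diagonalized m (X P : 'I_N -> 'M[F]_m) (d : 'I_N -> 'I_m -> F) :=
  forall j, P j \in unitmx /\ P j *m X j = diag_mx (\row_i d j i) *m P j.

(** In eigenbases [ad] multiplies the entry [(i, k)] by [d j i - e j k], so the kernel consists of
    the matrices supported where the eigenvalues coincide. *)
Lemma dim_lker_ad m n (X P : 'I_N -> 'M[F]_m) (Y Q : 'I_N -> 'M[F]_n) d e :
  diagonalized X P d -> diagonalized Y Q e ->
  \dim (lker (linfun (ad X Y))) = (\sum_(j < N) \sum_(i < m) \sum_(k < n) (d j i == e j k))%N.
Proof.
move=> hX hY.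
pose eqv (x : 'I_N * ('I_m * 'I_n)) := d x.1 x.2.1 == e x.1 x.2.2.
pose g (v : {ffun {x | eqv x} -> F^o}) (x : 'I_N * ('I_m * 'I_n)) : F :=
  if insub x is Some y then v y else 0.
pose f (v : {ffun {x | eqv x} -> F^o}) : {ffun 'I_N -> 'M[F]_(m, n)} :=
  [ffun j => invmx (P j) *m (\matrix_(i, k) g v (j, (i, k))) *m Q j].
have gE v y : g v (val y) = v y by rewrite /g valK.
have flin : linear f.
  move=> a u v; apply/ffunP => j; rewrite !ffunE scalemxAl scalemxAr -mulmxDl -mulmxDr.
  congr (_ *m _ *m _); apply/matrixP => i k; rewrite !mxE /g.
  by case: insubP => [y _ _|_]; rewrite ?mulr0 ?addr0 // !ffunE.
pose fL : {linear _ -> _} := HB.pack f (GRing.isLinear.Build _ _ _ _ f flin).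
have uP j : P j \in unitmx by have [] := hX j.
have uQ j : Q j \in unitmx by have [] := hY j.
have uQV j : invmx (Q j) \in unitmx by rewrite unitmx_inv.
have fK v j i k : (P j *m f v j *m invmx (Q j)) i k = g v (j, (i, k)).
  by rewrite ffunE !mulmxA mulmxV // mul1mx mulmxK // mxE.
have adE T j : P j *m ad X Y T j *m invmx (Q j) =
    \matrix_(i, k) ((d j i - e j k) * (P j *m T j *m invmx (Q j)) i k).
  have [_ hXj] := hX j; have [_ hYj] := hY j.
  by rewrite ffunE; apply: diagonal_ad.
have kerE : lker (linfun (ad X Y)) = limg (linfun fL).
  apply/vspaceP => T; rewrite memv_ker lfunE /=; apply/eqP/memv_imgP.
    move=> hT; pose U j := P j *m T j *m invmx (Q j).
    exists [ffun x => U (val x).1 (val x).2.1 (val x).2.2]; first exact: memvf.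
    rewrite (lfunE fL) /=; apply/ffunP => j.
    apply: (can_inj (mulKmx (uP j))); apply: (can_inj (mulmxK (uQV j))).
    apply/matrixP => i k; rewrite fK /g; case: insubP => [y _ ey|]; first by rewrite ffunE ey.
    rewrite /eqv /= -subr_eq0 => nz; have /matrixP/(_ i k) := adE T j.
    rewrite hT ffunE mulmx0 mul0mx !mxE => /esym/eqP.
    by rewrite mulf_eq0 (negPf nz) => /eqP.
  case=> v _ ->; rewrite (lfunE fL) /=; apply/ffunP => j.
  apply: (can_inj (mulKmx (uP j))); apply: (can_inj (mulmxK (uQV j))).
  rewrite adE [in RHS]ffunE mulmx0 mul0mx; apply/matrixP => i k; rewrite [LHS]mxE [RHS]mxE fK /g.
  case: insubP => [y ey _|]; last by rewrite mulr0.
  by rewrite (eqP ey) subrr mul0r.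
rewrite kerE limg_dim_eq; last first.
  apply/eqP; rewrite -subv0; apply/subvP => v; rewrite memv_cap memvf memv_ker (lfunE fL) memv0.
  move=> /= /eqP v0; apply/eqP/ffunP => y; rewrite -gE.
  case: (val y) => j [i k]; rewrite -fK v0.
  by rewrite ffunE mulmx0 mul0mx mxE ffunE.
rewrite dimvf.
have -> : dim {ffun {x | eqv x} -> F^o} = #|{: {x | eqv x}}| by apply: muln1.
rewrite card_sig -sum1_card big_mkcond /=.
rewrite -(pair_bigA _ (fun j y => if eqv (j, y) then 1 else 0)%N) /=.
apply: eq_bigr => j _.
rewrite -(pair_bigA _ (fun i k => if eqv (j, (i, k)) then 1 else 0)%N) /=.
by apply: eq_bigr => i _; apply: eq_bigr => k _; rewrite /eqv /=; case: eqP.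
Qed.

End CocycleDimensions.

Lemma big_flatten_nseq (F : Type) (f : F -> nat) s (es : seq F) :
  (\sum_(a <- flatten (nseq s es)) f a = s * \sum_(a <- es) f a)%N.
Proof. by elim: s => [|s IH] /=; rewrite ?big_nil // big_cat IH mulSn. Qed.

(** * Semisimple families and their types *)

Section Types.
Variable F : fieldType.

(** For duplicate-free [rs] this is diagonalizability with spectrum in [rs], in a polynomial form
    that passes at once to diagonal blocks and makes sense in size 0. *)
Definition annihilated (rs : seq F) m (A : 'M[F]_m) :=
  \prod_(a <- rs) (A - a%:M) = 0.

Lemma prod_sub_intertwines (rs : seq F) m n (A : 'M[F]_m) (B : 'M[F]_n) T :
  A *m T = T *m B ->
  (\prod_(a <- rs) (A - a%:M)) *m T = T *m (\prod_(a <- rs) (B - a%:M)).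
Proof.
move=> hT; elim: rs => [|a rs IH]; first by rewrite !big_nil mul1mx mulmx1.
rewrite !big_cons -[in LHS]mulmxA IH !mulmxA; congr (_ *m _).
by rewrite mulmxBl mulmxBr hT scalar_mxC.
Qed.

Lemma annihilated_conj rs m n (A : 'M[F]_m) (B : 'M[F]_n) T T' :
  A *m T = T *m B -> T *m T' = 1%:M -> annihilated rs B -> annihilated rs A.
Proof.
move=> hT TT' hB; rewrite /annihilated -[LHS]mulmx1 -TT' mulmxA.
by rewrite (prod_sub_intertwines _ hT) hB mulmx0 mul0mx.
Qed.

Lemma annihilated_block rs m n (A : 'M[F]_m) B (D : 'M[F]_n) :
  annihilated rs (block_mx A B 0 D) -> annihilated rs A /\ annihilated rs D.
Proof.
move=> h; split.
  have := @prod_sub_intertwines rs _ _ (block_mx A B 0 D) A (col_mx 1%:M 0).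
  rewrite h mul0mx mul_block_col mul_col_mx !mulmx1 !mulmx0 !addr0 mul1mx mul0mx.
  by move=> /(_ erefl)/esym; rewrite mul_col_mx mul1mx -col_mx0 => /eq_col_mx[].
have := @prod_sub_intertwines rs _ _ D (block_mx A B 0 D) (row_mx 0 1%:M).
rewrite h mulmx0 mul_row_block mul_mx_row !mulmx1 !mul0mx !mulmx0 !add0r mul1mx.
by move=> /(_ erefl); rewrite mul_mx_row mulmx1 -row_mx0 => /eq_row_mx[].
Qed.

Lemma char_poly_conj m n (e : m = n) (A : 'M[F]_m) (B : 'M[F]_n) P P' :
  P *m P' = 1%:M -> A *m P = P *m B -> char_poly A = char_poly B.
Proof.
subst n => PP' h; have [uP _] := mulmx1_unit PP'.
have nP : \det (map_mx polyC P) != 0.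
  by rewrite det_map_mx polyC_eq0 -unitfE -unitmxE.
apply: (mulIf nP); rewrite /char_poly [RHS]mulrC -!det_mulmx; congr (\det _).
by rewrite /char_poly_mx mulmxBl mulmxBr scalar_mxC -!map_mxM h.
Qed.

Lemma char_poly_block m n (A : 'M[F]_m) B (D : 'M[F]_n) :
  char_poly (block_mx A B 0 D) = char_poly A * char_poly D.
Proof.
rewrite /char_poly /char_poly_mx map_block_mx scalar_mx_block opp_block_mx.
by rewrite add_block_mx map_mx0 oppr0 !addr0 det_ublock.
Qed.

Lemma annihilated_diag rs m (A : 'M[F]_m) : uniq rs -> annihilated rs A ->
  exists P d, P \in unitmx /\ P *m A = diag_mx (\row_i d i) *m P.
Proof.
case: m A => [|m] A urs hA.
  by exists 1%:M, (fun=> 0); rewrite unitmx1 !thinmx0.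
have /diagonalizableP : exists2 rs, uniq rs & mxminpoly A %| \prod_(x <- rs) ('X - x%:P).
  exists rs => //; apply: mxminpoly_min; rewrite rmorph_prod -[RHS]hA.
  by apply: eq_bigr => a _; rewrite rmorphB /= horner_mx_X horner_mx_C.
case=> P uP /diagonalizable_forPex[D /(simmxP uP) hP].
exists P, (D 0); split=> //; rewrite hP; congr (diag_mx _ *m _).
by apply/rowP => i; rewrite mxE.
Qed.

Lemma char_poly_diagonal m (A P : 'M[F]_m) d : P \in unitmx ->
  P *m A = diag_mx (\row_i d i) *m P -> char_poly A = \prod_i ('X - (d i)%:P).
Proof.
move=> uP hP; rewrite -(@char_poly_conj _ _ erefl _ _ _ _ (mulmxV uP) (esym hP)).
rewrite char_poly_trig ?diag_mx_is_trig //.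
by apply: eq_bigr => i _; rewrite !mxE eqxx.
Qed.

Lemma diag_char_poly m (A P : 'M[F]_m) d (es : seq F) : P \in unitmx ->
  P *m A = diag_mx (\row_i d i) *m P -> char_poly A = \prod_(a <- es) ('X - a%:P) ->
  perm_eq [seq d i | i <- enum 'I_m] es.
Proof.
move=> uP hP hA; apply: prod_XsubC_eq.
by rewrite -hA big_map (char_poly_diagonal uP hP) enumT.
Qed.

Lemma prod_flatten_nseq s (es : seq F) :
  \prod_(a <- flatten (nseq s es)) ('X - a%:P) = (\prod_(a <- es) ('X - a%:P)) ^+ s.
Proof. by elim: s => [|s IH] /=; rewrite ?big_nil // big_cat IH exprS. Qed.

Lemma deriv_prod_XsubC_root (rs : seq F) a : uniq rs -> a \in rs ->
  (\prod_(b <- rs) ('X - b%:P))^`().[a] != 0.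
Proof.
move=> urs ars; rewrite (perm_big _ (perm_to_rem ars)) big_cons /= derivM.
rewrite hornerD !hornerM derivXsubC hornerC mul1r hornerXsubC subrr mul0r addr0.
rewrite -/(root _ _) root_prod_XsubC.
by rewrite mem_rem_uniqF.
Qed.

(* Solve [B = A *m T - T *m D] in coordinates where A and D are diagonal. *)
Lemma annihilated_block_split rs m n (A : 'M[F]_m) B (D : 'M[F]_n) :
  uniq rs -> annihilated rs (block_mx A B 0 D) -> exists T, B = A *m T - T *m D.
Proof.
move=> urs hM; have [hA hD] := annihilated_block hM.
have [P [d [uP hP]]] := annihilated_diag urs hA.
have [Q [e [uQ hQ]]] := annihilated_diag urs hD.
have [B' hB'] : exists B', B' = P *m B *m invmx Q by exists (P *m B *m invmx Q).
pose M' := block_mx (diag_mx (\row_i d i)) B' 0 (diag_mx (\row_i e i)).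
pose p l : {poly F} := \prod_(b <- l) ('X - b%:P).
(* A polynomial evaluated at a triangular block matrix has, where [d i = e k], the corner entry
   [B' i k] times its derivative at [d i]. The roots in [rs] are simple, so annihilation forces
   [B' i k = 0] there, and the other entries can be divided by [d i - e k]. *)
have off l : exists2 U, \prod_(b <- l) (M' - b%:M) =
      block_mx (diag_mx (\row_i (p l).[d i])) U 0 (diag_mx (\row_i (p l).[e i])) &
    forall i k, d i = e k -> U i k = B' i k * (p l)^`().[d i].
  elim: l => [|b l [U hl hU]].
    exists 0 => [|i k _]; last by rewrite /p big_nil derivC hornerC mulr0 mxE.
    rewrite big_nil -[1]/(1%:M) scalar_mx_block; congr block_mx;
      by apply/matrixP => i j; rewrite !mxE /p big_nil hornerC.
  exists (diag_mx (\row_i (d i - b)) *m U + B' *m diag_mx (\row_i (p l).[e i])).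
    rewrite big_cons hl scalar_mx_block /M' opp_block_mx add_block_mx.
    rewrite !subr0 -mulmxE mulmx_block !mul0mx !mulmx0 !addr0 !add0r.
    have diagB q (c : 'I_q -> F) :
        diag_mx (\row_i c i) - b%:M = diag_mx (\row_i (c i - b)).
      by apply/matrixP => i j; rewrite !mxE; case: eqP => [->|]; rewrite ?mulr1n ?mulr0n ?subrr.
    have diagM q (c : 'I_q -> F) : diag_mx (\row_i (c i - b)) *m
        diag_mx (\row_i (p l).[c i]) = diag_mx (\row_i (p (b :: l)).[c i]).
      rewrite mulmx_diag; congr diag_mx; apply/rowP => i; rewrite !mxE /p big_cons.
      by rewrite hornerM hornerXsubC.
    by rewrite !diagB !diagM.
  move=> i k dk; rewrite mul_diag_mx mul_mx_diag !mxE hU // -dk /p big_cons.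
  rewrite derivM hornerD !hornerM derivXsubC hornerC mul1r hornerXsubC.
  ring.
have hM' : annihilated rs M'.
  pose R := block_mx P 0 0 Q; pose R' := block_mx (invmx P) 0 0 (invmx Q).
  apply: (@annihilated_conj rs _ _ _ (block_mx A B 0 D) R R') => //.
    rewrite /M' /R !mulmx_block !mul0mx !mulmx0 !addr0 !add0r hP hQ.
    by rewrite hB' mulmxKV.
  by rewrite mulmx_block !mul0mx !mulmx0 !addr0 !add0r !mulmxV // -scalar_mx_block.
have B'0 i k : d i = e k -> B' i k = 0.
  move=> dk; have [U] := off rs; rewrite hM' -[0]/(0 : 'M_(m + n)) -block_mx0.
  case/eq_block_mx => h1 h2 _ _ hU; move: (hU i k dk); rewrite -h2 mxE => /esym/eqP.
  rewrite mulf_eq0 => /orP[/eqP->//|]; rewrite (negPf (deriv_prod_XsubC_root urs _)) //.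
  rewrite -root_prod_XsubC /root -/(p rs); have /matrixP/(_ i i) := h1.
  by rewrite !mxE eqxx mulr1n => <-.
exists (invmx P *m (\matrix_(i, k) (B' i k / (d i - e k))) *m Q).
apply: (can_inj (mulKmx uP)); have uQ' : invmx Q \in unitmx by rewrite unitmx_inv.
apply: (can_inj (mulmxK uQ')); rewrite (diagonal_ad _ uQ hP hQ) -hB'.
rewrite !mulmxA mulmxV // mul1mx mulmxK //; apply/matrixP => i k.
rewrite [RHS]mxE [X in _ = _ * X]mxE.
have [dk|ne] := eqVneq (d i) (e k); first by rewrite B'0 // mul0r mulr0.
by rewrite mulrC divfK // subr_eq0.
Qed.

End Types.

Section BlockProducts.
Variables (F : fieldType) (N : nat).

Lemma prefix_block m n (X : 'I_N -> 'M[F]_m) (B : {ffun 'I_N -> 'M[F]_(m, n)})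
    (Y : 'I_N -> 'M[F]_n) k : (k <= N)%N -> (forall j, Y j \in unitmx) ->
  prefix (block_family X B Y) k = block_mx (prefix X k)
   ((\sum_(j < N | (j < k)%N) prefix X j *m B j *m invmx (prefix Y j.+1)) *m prefix Y k)
   0 (prefix Y k).
Proof.
move=> hk uY; move: k hk; apply: (prefix_ind (block_family X B Y)) => [|j IH].
  by rewrite !prefix0 big_pred0 // mul0mx -scalar_mx_block.
rewrite prefixS IH /block_family mulmx_block !mulmx0 !mul0mx !addr0 add0r -!prefixS.
congr block_mx; rewrite [in RHS](bigD1 j) //= [in RHS]mulmxDl mulmxKV ?prefix_unit //.
congr (_ + _); rewrite -mulmxA -prefixS; congr (_ *m _).
by apply: eq_bigl => i; rewrite [in RHS]ltnS ltn_neqAle andbC.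
Qed.

Lemma prod_block m n (X : 'I_N -> 'M[F]_m) (B : {ffun 'I_N -> 'M[F]_(m, n)})
    (Y : 'I_N -> 'M[F]_n) : (forall j, Y j \in unitmx) ->
  \prod_(j < N) block_family X B Y j = block_mx (\prod_(j < N) X j)
    (prod_deriv X Y B *m \prod_(j < N) Y j) 0 (\prod_(j < N) Y j).
Proof.
move=> uY; rewrite -!prefixN prefix_block //; congr (block_mx _ (_ *m _) _ _).
by apply: eq_bigl => j; rewrite ltn_ord.
Qed.

End BlockProducts.

Lemma count_coincidences (F : eqType) (l : seq F) s t m n (d : 'I_m -> F) (e : 'I_n -> F) :
  perm_eq [seq d i | i <- enum 'I_m] (flatten (nseq s l)) ->
  perm_eq [seq e k | k <- enum 'I_n] (flatten (nseq t l)) ->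
  (\sum_(i < m) \sum_(k < n) (d i == e k) =
   s * t * \sum_(a <- l) \sum_(b <- l) (a == b))%N.
Proof.
move=> hd he.
have sum_enum q (c : 'I_q -> F) r (f : F -> nat) :
    perm_eq [seq c i | i <- enum 'I_q] (flatten (nseq r l)) ->
    (\sum_(i < q) f (c i) = r * \sum_(a <- l) f a)%N.
  move=> hc; rewrite -big_flatten_nseq -(perm_big _ hc) big_map.
  by rewrite enumT.
rewrite (sum_enum _ _ _ (fun a => \sum_(k < n) (a == e k))%N hd) -mulnA.
congr (_ * _)%N; rewrite big_distrr /=; apply: eq_bigr => a _.
exact: (sum_enum _ _ _ (fun b => nat_of_bool (a == b)) he).
Qed.

Section Objects.
Variables (F : fieldType) (p : nat) (es : 'I_p.+1 -> seq F).

Definition semisimple_family m (X : 'I_p.+1 -> 'M[F]_m) :=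
  (forall j, annihilated (undup (es j)) (X j)) /\ \prod_(j < p.+1) X j = 1%:M.

Definition typed s m (X : 'I_p.+1 -> 'M[F]_m) :=
  semisimple_family X /\
  forall j, char_poly (X j) = (\prod_(a <- es j) ('X - a%:P)) ^+ s.

(** When all [es j] have size [b], this is [p.+1 * (b * b)] minus the sum of the [rho_j]: pairs of
    equal roots are counted, diagonal pairs included. *)
Definition coincidences :=
  (\sum_(j < p.+1) \sum_(a <- es j) \sum_(b <- es j) (a == b))%N.

Lemma typed_unit s m (X : 'I_p.+1 -> 'M[F]_m) : typed s X -> forall j, X j \in unitmx.
Proof. by case=> -[_ /prod1_unit]. Qed.

Lemma typed_size b s m (X : 'I_p.+1 -> 'M[F]_m) :
  (forall j, size (es j) = b) -> typed s X -> m = (s * b)%N.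
Proof.
move=> hb [_ /(_ ord0)]; rewrite -prod_flatten_nseq => /(congr1 (fun q : {poly F} => size q)).
rewrite size_char_poly size_prod_XsubC => -[->].
by rewrite size_flatten /shape map_nseq hb sumn_nseq mulnC.
Qed.

Lemma typed_diagonalized s m (X : 'I_p.+1 -> 'M[F]_m) : typed s X ->
  exists P d, diagonalized X P d /\
    forall j, perm_eq [seq d j i | i <- enum 'I_m] (flatten (nseq s (es j))).
Proof.
move=> [[hX _] cX].
have /fin_all_exists[P hP] : forall j, exists Pj, exists d, Pj \in unitmx /\
    Pj *m X j = diag_mx (\row_i d i) *m Pj.
  by move=> j; apply: annihilated_diag (hX j); apply: undup_uniq.
have /fin_all_exists[d hd] := hP.
exists P, d; split=> // j; have [uP hPj] := hd j.
by apply: diag_char_poly uP hPj _; rewrite cX prod_flatten_nseq.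
Qed.

Lemma dim_lker_typed s t m n (X : 'I_p.+1 -> 'M[F]_m) (Y : 'I_p.+1 -> 'M[F]_n) :
  typed s X -> typed t Y ->
  \dim (lker (linfun (ad X Y))) = (s * t * coincidences)%N.
Proof.
move=> /typed_diagonalized[P [d [hP hd]]] /typed_diagonalized[Q [e [hQ he]]].
rewrite (dim_lker_ad hP hQ) /coincidences big_distrr /=; apply: eq_bigr => j _.
exact: count_coincidences (hd j) (he j).
Qed.

Lemma typed_conj s m (X X' P : 'I_p.+1 -> 'M[F]_m) : typed s X ->
  (forall j, P j \in unitmx) -> (forall j, X' j *m P j = P j *m X j) ->
  \prod_(j < p.+1) X' j = 1%:M -> typed s X'.
Proof.
move=> [[hX _] cX] uP hP pX'; split; last first.
  by move=> j; rewrite (char_poly_conj erefl (mulmxV (uP j)) (hP j)).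
by split=> // j; apply: annihilated_conj (hP j) (mulmxV (uP j)) (hX j).
Qed.

(** A corner of the form [ad U V T] is removed in each matrix separately by a unipotent conjugation
    with corner [T j], so every matrix stays diagonalizable; the vanishing of [prod_deriv] keeps the
    product equal to 1. *)
Lemma typed_extension s t m n (U : 'I_p.+1 -> 'M[F]_m) (V : 'I_p.+1 -> 'M[F]_n) T :
  typed s U -> typed t V -> prod_deriv U V (ad U V T) = 0 ->
  typed (s + t) (block_family U (ad U V T) V).
Proof.
move=> hU hV hT; have [[aU pU] cU] := hU; have [[aV pV] cV] := hV.
split; last by move=> j; rewrite char_poly_block cU cV exprD.
split; last first.
  rewrite prod_block; last exact: typed_unit hV.
  by rewrite hT mul0mx pU pV -scalar_mx_block.
move=> j; pose R := block_mx 1%:M (T j) 0 (1%:M : 'M[F]_n).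
pose R' := block_mx 1%:M (- T j) 0 (1%:M : 'M[F]_n).
have RR' : R' *m R = 1%:M.
  by rewrite mulmx_block !mulmx0 !mul0mx !mulmx1 !mul1mx !addr0 !add0r subrr -scalar_mx_block.
apply: (@annihilated_conj _ _ _ _ _ (block_mx (U j) 0 0 (V j)) R' R) => //.
  rewrite /block_family !mulmx_block !mulmx0 !mul0mx !mulmx1 !mul1mx !addr0 !add0r.
  by rewrite ffunE mulmxN mulNmx addrC addrAC subrr add0r.
have blk rs : \prod_(a <- rs) (block_mx (U j) 0 0 (V j) - a%:M) =
    block_mx (\prod_(a <- rs) (U j - a%:M)) 0 0 (\prod_(a <- rs) (V j - a%:M)).
  elim: rs => [|a rs IH]; first by rewrite !big_nil -[1]/(1%:M) scalar_mx_block.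
  rewrite !big_cons IH scalar_mx_block opp_block_mx add_block_mx !subr0 -!mulmxE.
  by rewrite mulmx_block !mulmx0 !mul0mx !addr0 !add0r.
by rewrite /annihilated blk aU aV block_mx0.
Qed.

(** The converse of [typed_extension]: any extension that stays in diagonalizable classes with
    product 1 comes from a cocycle of the complex. *)
Lemma semisimple_split n y x (M : 'I_p.+1 -> 'M[F]_n) (P : 'M[F]_(y + x, n)) P' Y B X :
  (y + x = n)%N -> semisimple_family M -> P *m P' = 1%:M ->
  (forall j, P *m M j = block_family Y B X j *m P) ->
  [/\ semisimple_family Y, semisimple_family X,
    forall j, char_poly (M j) = char_poly (Y j) * char_poly (X j) &
    exists T, (forall j, B j = ad Y X T j) /\ prod_deriv Y X (ad Y X T) = 0].
Proof.
move=> yx [aM pM] PP' hM.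
have ablk j : annihilated (undup (es j)) (block_mx (Y j) (B j) 0 (X j)).
  by apply: annihilated_conj (esym (hM j)) PP' (aM j).
have pblk : \prod_(j < p.+1) block_family Y B X j = 1%:M.
  have : (\prod_(j < p.+1) block_family Y B X j) *m P = P.
    rewrite -[RHS]mulmx1 -pM; elim: (index_enum _) => [|j r IH].
      by rewrite !big_nil mul1mx mulmx1.
    by rewrite !big_cons -!mulmxE -mulmxA IH !mulmxA hM.
  by move/(congr1 (mulmx^~ P')); rewrite -mulmxA PP' mulmx1.
have uX j : X j \in unitmx.
  have := prod1_unit pblk j; rewrite !unitmxE /block_family det_ublock unitrM.
  by case/andP.
have BE : block_family Y B X =1 block_family Y [ffun j => B j] X.
  by move=> j; rewrite /block_family ffunE.
move: pblk; rewrite (eq_bigr _ (fun j _ => BE j)) prod_block // scalar_mx_block.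
case/eq_block_mx => pY hB _ pX.
split.
- by split=> // j; have [] := annihilated_block (ablk j).
- by split=> // j; have [] := annihilated_block (ablk j).
- by move=> j; rewrite -(char_poly_block _ (B j)) (char_poly_conj yx PP' (esym (hM j))).
have /fin_all_exists[T hT] : forall j, exists Tj, B j = Y j *m Tj - Tj *m X j.
  by move=> j; apply: annihilated_block_split (ablk j); apply: undup_uniq.
exists (finfun T); have hBT j : B j = ad Y X (finfun T) j by rewrite !ffunE.
split=> //; rewrite -[LHS]mulmx1 -pX -[RHS]hB; congr (prod_deriv _ _ _ *m _).
by apply/ffunP => j; rewrite -hBT ffunE.
Qed.

End Objects.

(** * Simplicity from a trivial centralizer *)

Section SimplicityCriterion.
Variables (F : fieldType) (p : nat) (es : 'I_p.+1 -> seq F) (b g n : nat).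
Hypothesis size_es : forall j, size (es j) = b.
Hypothesis subtyped : forall m (X : 'I_p.+1 -> 'M[F]_m), semisimple_family es X ->
  (0 < m < n)%N ->
  (forall j, char_poly (X j) %| (\prod_(a <- es j) ('X - a%:P)) ^+ g) ->
  exists2 s, (0 < s < g)%N & typed es s X.
Hypothesis dim_le : (p.+1 * (b * b) <= coincidences es + 2 * (b * b))%N.

Variable M : 'I_p.+1 -> 'M[F]_n.
Hypothesis typedM : typed es g M.
Hypothesis centM : forall T, intertwines M M T -> exists a, T = a%:M.

(** Suppose no nonzero map goes from the submodule [X] to the quotient [Y]. A map from [Y] to [X]
    yields the nilpotent endomorphism M -> Y -> X -> M, which must be a scalar, hence 0. With both
    Hom spaces zero, [cocycle_trivial] splits the extension, and the projection is a non-scalar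
    endomorphism. *)
Lemma hom_sub_quotient k (W : 'M[F]_(k, n)) y x (P : 'M[F]_(y + x, n)) P' Y B X :
  (y + x = n)%N -> P *m P' = 1%:M -> P' *m P = 1%:M ->
  (forall j, P *m M j = block_family Y B X j *m P) -> (0 < y)%N -> (0 < x)%N ->
  exists2 S, intertwines X Y S & S <> 0.
Proof.
move=> yx PP' P'P hM y0 x0; apply: NNPP => nhom.
have [hY hX hc [T [hB hT]]] := semisimple_split yx typedM.1 PP' hM.
have [t _ tY] : exists2 t, (0 < t < g)%N & typed es t Y.
  by apply: subtyped => // [|j]; [lia|rewrite -typedM.2 hc dvdp_mulr].
have [s _ sX] : exists2 s, (0 < s < g)%N & typed es s X.
  by apply: subtyped => // [|j]; [lia|rewrite -typedM.2 hc dvdp_mull].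
have endo E : (forall j, block_family Y B X j *m E = E *m block_family Y B X j) ->
    exists a, E = a%:M.
  move=> hE; have [|a ha] := centM (T := P' *m E *m P).
    move=> j; have -> : M j = P' *m block_family Y B X j *m P.
      by rewrite -mulmxA -hM mulmxA P'P mul1mx.
    rewrite -!mulmxA !(mulmxA P) PP' !mul1mx; congr (_ *m _).
    by rewrite !mulmxA hE.
  exists a; have : P *m (P' *m E *m P) *m P' = P *m a%:M *m P' by rewrite ha.
  by rewrite !mulmxA PP' mul1mx -mulmxA PP' mulmx1 -mulmxA -scalar_mxC mulmxA PP' mul1mx.
have one_neq0 q : (0 < q)%N -> (1%:M : 'M[F]_q) <> 0.
  by case: q => // q _ /matrixP/(_ 0 0)/eqP; rewrite !mxE eqxx oner_eq0.
have scalar0 q a : (0 < q)%N -> (a%:M : 'M[F]_q) = 0 -> a = 0.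
  by case: q => // q _ /matrixP/(_ 0 0); rewrite !mxE eqxx.
have homYX S : intertwines Y X S -> S = 0.
  move=> hS; have [|a] := endo (block_mx 0 S 0 0).
    move=> j; rewrite !mulmx_block !mulmx0 !mul0mx !addr0 !add0r.
    by rewrite hS.
  by rewrite scalar_mx_block => /eq_block_mx[_ -> _ _].
have homXY S : intertwines X Y S -> S = 0.
  by move=> hS; apply: NNPP => nS; apply: nhom; exists S.
have [|C hC] := cocycle_trivial (typed_unit sX) tY.1.2 sX.1.2 homXY homYX _ hT.
  rewrite (dim_lker_typed tY sX) (typed_size size_es tY) (typed_size size_es sX).
  have := leq_mul (leqnn (t * s)) dim_le; rewrite mulnDr; lia.
have [|a] := endo (block_mx 1%:M C 0 0).
  move=> j; have := hB j; rewrite hC !ffunE => hBj.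
  rewrite !mulmx_block !mulmx0 !mul0mx !addr0 !mul1mx mulmx1 hBj.
  by congr block_mx; rewrite ?subrK ?mulmx0 ?mul0mx.
rewrite scalar_mx_block => /eq_block_mx[h1 _ _ /esym h2].
by move: h1; rewrite (scalar0 _ _ x0 h2) raddf0; apply: one_neq0.
Qed.

Section Socle.
Variables (u : nat) (U : 'I_p.+1 -> 'M[F]_u) (i : 'M[F]_(u, n)).
Hypotheses (sU : simple U) (fi : row_free i) (hi : intertwines U M i).

(* Every nonzero homomorphism defined on the row space of W has an image that
   contains a copy of U. *)
Let sees_U k (W : 'M[F]_(k, n)) := forall l (Z : 'I_p.+1 -> 'M[F]_l) (f : 'M[F]_(n, l)),
  (forall j, W *m M j *m f = W *m f *m Z j) -> W *m f <> 0 ->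
  exists2 h, intertwines U Z h & h <> 0.

(** A nonzero map from [W] to the quotient by [W] exists by [hom_sub_quotient], so that quotient
    contains a copy of [U], namely the image of [h]; [W'] is its preimage. A nonzero map on [W']
    either is nonzero on [W], or vanishes there and factors through this copy of [U]. *)
Lemma grow k (W : 'M[F]_(k, n)) : (forall j, stablemx W (M j)) ->
  W != 0 -> (\rank W < n)%N -> sees_U W ->
  exists W' : 'M[F]_n, [/\ forall j, stablemx W' (M j), (\rank W < \rank W')%N & sees_U W'].
Proof.
move=> sW nW rW seesW.
have [y [x [P [P' [Y [B [X [hx yx [PP' P'P] hM dP]]]]]]]] := stable_block sW.
have x0 : (0 < x)%N by rewrite hx lt0n mxrank_eq0.
have y0 : (0 < y)%N by lia.
have [S hS nS] := hom_sub_quotient W yx PP' P'P hM y0 x0.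
pose th : 'M_(n, y) := P' *m col_mx 1%:M 0.
have hth : intertwines M Y th := block_quotient PP' P'P hM.
pose th' : 'M_(y, n) := row_mx 1%:M 0 *m P.
have th'K : th' *m th = 1%:M.
  by rewrite /th' /th -!mulmxA (mulmxA P) PP' mul1mx mul_row_col mul1mx mul0mx addr0.
have WE : (W :=: dsubmx P)%MS by apply: eqmx_sym.
have dPE : dsubmx P = row_mx 0 1%:M *m P.
  by rewrite -{2}[P]vsubmxK mul_row_col mul0mx mul1mx add0r.
have Wth : W *m th = 0.
  have /submxP[D ->] : (W <= dsubmx P)%MS by rewrite WE.
  rewrite dPE /th -!mulmxA (mulmxA P) PP' mul1mx.
  by rewrite mul_row_col mulmx0 mul0mx addr0 mulmx0.
have kerth m (A : 'M_(m, n)) : A *m th = 0 -> (A <= W)%MS.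
  move=> hA; rewrite WE dPE; apply/submxP; exists (A *m P' *m col_mx 0 1%:M).
  have -> : A = A *m P' *m P by rewrite -mulmxA P'P mulmx1.
  rewrite -[in RHS](mulmxA A P' P) P'P mulmx1 mulmxA; congr (_ *m _).
  rewrite -[A *m P']hsubmxK; have -> : lsubmx (A *m P') = 0.
    by move: hA; rewrite /th mulmxA -{1}[A *m P']hsubmxK mul_row_col mulmx1 mulmx0 addr0.
  by rewrite mul_row_col mulmx0 add0r mulmx1 mul_mx_row mulmx0 mulmx1.
have [h hh nh] : exists2 h, intertwines U Y h & h <> 0.
  apply: (seesW _ Y (P' *m col_mx 0 1%:M *m S)) => [j|].
    have /submxP[D ->] : (W <= dsubmx P)%MS by rewrite WE.
    rewrite -!(mulmxA D) dPE; congr (_ *m _).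
    rewrite -(mulmxA _ P) hM /block_family !mulmxA.
    rewrite mul_row_block !mul0mx !mul1mx !add0r -!mulmxA !(mulmxA P) PP' !mul1mx.
    rewrite !(mulmxA (row_mx _ _)) !mul_row_col !mul0mx !mulmx1 !add0r mul1mx.
    exact: hS.
  move=> h0; apply: nS.
  have /submxP[D hD] : (dsubmx P <= W)%MS by rewrite WE.
  have : dsubmx P *m (P' *m col_mx 0 1%:M *m S) = 0 by rewrite hD -mulmxA h0 mulmx0.
  rewrite dPE -!mulmxA (mulmxA P) PP' mul1mx mulmxA mul_row_col mul0mx mul1mx add0r.
  by rewrite mul1mx.
pose W' := kermx (th *m cokermx h).
have W'E m (A : 'M_(m, n)) : (A <= W')%MS = (A *m th <= h)%MS.
  by rewrite sub_kermx mulmxA -submxE.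
have [h' h'th] : exists h', h' *m th = h.
  by exists (h *m th'); rewrite -mulmxA th'K mulmx1.
have h'W' : (h' <= W')%MS by rewrite W'E h'th.
have WW' : (W <= W')%MS by rewrite W'E Wth sub0mx.
exists W'; split.
- move=> j; rewrite W'E -mulmxA hth mulmxA.
  apply: submx_trans (submxMr _ _) (intertwines_stable hh j).
  by rewrite -W'E.
- apply: rank_ltmx; rewrite ltmxE WW' /=; apply/negP => W'W; apply: nh.
  have /submxP[D hD] := submx_trans h'W' W'W.
  by rewrite -h'th hD -mulmxA Wth mulmx0.
move=> l Z f hf nf.
have onW' m (A : 'M_(m, n)) j : (A <= W')%MS -> A *m M j *m f = A *m f *m Z j.
  by case/submxP=> D ->; rewrite -!(mulmxA D) hf -!mulmxA.
have [Wf|nWf] := classic (W *m f = 0); last first.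
  by apply: seesW nWf => j; apply: onW'.
(* The lift [h'] of [h] is a homomorphism only modulo [W], but [f] vanishes on [W]. *)
exists (h' *m f) => [j|h'f].
  rewrite -onW' // mulmxA; apply/subr0_eq; rewrite -mulmxBl.
  have : (U j *m h' - h' *m M j <= W)%MS.
    by apply: kerth; rewrite mulmxBl -!mulmxA hth h'th (mulmxA h') h'th hh subrr.
  by case/submxP=> D ->; rewrite -mulmxA Wf mulmx0.
apply: nf; have /submxP[D hD] : (W' *m th <= h)%MS by rewrite -W'E.
have : (W' - D *m h' <= W)%MS.
  by apply: kerth; rewrite mulmxBl -(mulmxA D) h'th hD subrr.
case/submxP=> E /(congr1 (mulmx^~ f)); rewrite mulmxBl -!mulmxA h'f Wf !mulmx0 subr0.
exact.
Qed.

Lemma sees_U_full : sees_U 1%:M.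
Proof.
suff H d k (W : 'M[F]_(k, n)) : (n - \rank W <= d)%N ->
    (forall j, stablemx W (M j)) -> W != 0 -> sees_U W -> sees_U 1%:M.
  apply: (H n u i); first exact: leq_subr.
  - exact: intertwines_stable hi.
  - by rewrite -mxrank_eq0 (eqP fi) -lt0n; case: sU.
  - move=> l Z f hf nf; exists (i *m f) => // j.
    by rewrite mulmxA hi hf.
elim: d k W => [|d IH] k W hr sW nW seesW; have [rW|rW] := leqP n (\rank W).
- have fW : row_full W by rewrite /row_full eqn_leq rank_leq_col.
  move=> l Z f hf nf; apply: (seesW l Z f) => [j|h0].
    by have := congr1 (mulmx W) (hf j); rewrite !mul1mx !mulmxA.
  by apply: nf; rewrite -(mulVpmx fW) -mulmxA h0 mulmx0.
- by move: hr; rewrite leqNgt subn_gt0 rW.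
- have fW : row_full W by rewrite /row_full eqn_leq rank_leq_col.
  move=> l Z f hf nf; apply: (seesW l Z f) => [j|h0].
    by have := congr1 (mulmx W) (hf j); rewrite !mul1mx !mulmxA.
  by apply: nf; rewrite -(mulVpmx fW) -mulmxA h0 mulmx0.
have [W' [sW' rW' seesW']] := grow sW nW rW seesW.
apply: (IH _ W') => //; first by lia.
by rewrite -mxrank_eq0; lia.
Qed.

End Socle.

(** The simple quotient [V] is taken below a proper quotient [Y] of [M], so that its size is less
    than [n]. Then the endomorphism M -> V -> U -> M, nonzero by [sees_U_full], has rank less than
    [n] and cannot be scalar. *)
Lemma trivial_centralizer_simple : (0 < n)%N -> simple M.
Proof.
move=> n0; apply: NNPP => nM.
have [u [U [i [sU fi hi]]]] := exists_simple_sub M n0.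
have [k [W [sW W0 Wn]]] := not_simple n0 nM.
have [y [x [P [P' [Y [B [X [hx yx [PP' P'P] hM _]]]]]]]] := stable_block sW.
have y0 : (0 < y)%N by lia.
have [v [V [Q [sV fQ hQ]]]] := exists_simple_quotient Y y0.
pose th := P' *m col_mx 1%:M 0 *m Q.
have hth : intertwines M V th.
  by apply: intertwines_comp hQ; apply: block_quotient PP' P'P hM.
have nth : th <> 0.
  move=> th0; have : row_mx 1%:M 0 *m P *m th = Q.
    rewrite /th -!mulmxA (mulmxA P) PP' mul1mx (mulmxA (row_mx _ _)) mul_row_col.
    by rewrite mul1mx mul0mx addr0 mul1mx.
  rewrite th0 mulmx0 => Q0; move: fQ; rewrite -Q0 /row_full mxrank0.
  by case: sV; rewrite lt0n eq_sym => /negPf->.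
have [h hh nh] : exists2 h, intertwines U V h & h <> 0.
  have seesM := @sees_U_full _ _ _ sU fi hi.
  by apply: (seesM _ V th) => [j|]; rewrite !mul1mx.
have hfree := simple_row_free sU hh nh.
have hfull := simple_row_full sV hh nh.
have [h' hh' h'h] : exists2 h', h *m h' = 1%:M & h' *m h = 1%:M.
  by exists (pinvmx h); [apply: mulmxVp|apply: mulVpmx].
have hh'i : intertwines V U h'.
  by move=> j; rewrite -[V j]mul1mx -h'h -(mulmxA h') -hh -!mulmxA hh' mulmx1.
have [a ha] := centM (intertwines_comp hth (intertwines_comp hh'i hi)).
have [a0|a0] := eqVneq a 0.
  apply: nth; move: ha; rewrite a0 raddf0 => h0.
  have [i' ii'] : exists i', i *m i' = 1%:M by exists (pinvmx i); apply: mulmxVp.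
  have : th *m (h' *m i) *m (i' *m h) = th.
    by rewrite -(mulmxA th) -(mulmxA h') (mulmxA i) ii' mul1mx h'h mulmx1.
  by rewrite h0 mul0mx => <-.
have : (n <= v)%N.
  have : \rank (a%:M : 'M[F]_n) = n.
    by apply/eqP; rewrite -/(row_free _) row_free_unit unitmxE det_scalar unitfE expf_neq0.
  rewrite -ha => {1}<-; apply: leq_trans (mxrankM_maxl _ _) (rank_leq_col _).
have : (v <= y)%N by rewrite -(eqP fQ) rank_leq_row.
lia.
Qed.

End SimplicityCriterion.

(** * Strict differentiability and deformations *)

Section Norms.
Variable R : realType.
Local Notation C := R[i].
Local Notation normc := ComplexField.Normc.normc.

Lemma normc_ge0 (x : C) : 0 <= normc x.
Proof. by case: x => a b; apply: sqrtr_ge0. Qed.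

Lemma normc_Re (x : C) : `|complex.Re x| <= normc x.
Proof.
case: x => a b /=; rewrite -sqrtr_sqr ler_sqrt ?addr_ge0 ?sqr_ge0 //.
by rewrite lerDl sqr_ge0.
Qed.

Lemma normc_Im (x : C) : `|complex.Im x| <= normc x.
Proof.
case: x => a b /=; rewrite -sqrtr_sqr ler_sqrt ?addr_ge0 ?sqr_ge0 //.
by rewrite lerDr sqr_ge0.
Qed.

Lemma normc_real (x : R) : normc x%:C = `|x|.
Proof. by rewrite /= expr0n addr0 sqrtr_sqr. Qed.

Lemma normc_le_ReIm (x : C) : normc x <= `|complex.Re x| + `|complex.Im x|.
Proof.
case: x => a b /=; rewrite -[leRHS]ger0_norm ?addr_ge0 // -sqrtr_sqr.
rewrite ler_sqrt ?sqr_ge0 // sqrrD !real_normK ?num_real //.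
by rewrite lerD2r lerDl mulrn_wge0 // mulr_ge0.
Qed.

Definition mxnorm m n (A : 'M[C]_(m, n)) : R := \sum_i \sum_j normc (A i j).

Lemma mxnorm_ge0 m n (A : 'M[C]_(m, n)) : 0 <= mxnorm A.
Proof. by apply: sumr_ge0 => i _; apply: sumr_ge0 => j _; apply: normc_ge0. Qed.

Lemma mxnorm0 m n : mxnorm (0 : 'M[C]_(m, n)) = 0.
Proof. by apply: big1 => i _; apply: big1 => j _; rewrite mxE ComplexField.Normc.normc0. Qed.

Lemma mxnorm_entry m n (A : 'M[C]_(m, n)) i j : normc (A i j) <= mxnorm A.
Proof.
rewrite /mxnorm (bigD1 i) //= (bigD1 j) //= -addrA lerDl addr_ge0 //.
  by apply: sumr_ge0 => k _; apply: normc_ge0.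
by apply: sumr_ge0 => k _; apply: sumr_ge0 => l _; apply: normc_ge0.
Qed.

Lemma mxnorm_eq0 m n (A : 'M[C]_(m, n)) : mxnorm A = 0 -> A = 0.
Proof.
move=> A0; apply/matrixP => i j; rewrite mxE; apply: ComplexField.Normc.eq0_normc.
by apply/eqP; rewrite eq_le normc_ge0 andbT -A0 mxnorm_entry.
Qed.

Lemma mxnormD m n (A B : 'M[C]_(m, n)) : mxnorm (A + B) <= mxnorm A + mxnorm B.
Proof.
rewrite /mxnorm -big_split; apply: ler_sum => i _; rewrite -big_split /=.
by apply: ler_sum => j _; rewrite mxE le_normcD.
Qed.

Lemma mxnormZ m n a (A : 'M[C]_(m, n)) : mxnorm (a *: A) = normc a * mxnorm A.
Proof.
rewrite /mxnorm mulr_sumr; apply: eq_bigr => i _; rewrite mulr_sumr.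
by apply: eq_bigr => j _; rewrite mxE ComplexField.Normc.normcM.
Qed.

Lemma mxnormN m n (A : 'M[C]_(m, n)) : mxnorm (- A) = mxnorm A.
Proof. by apply: eq_bigr => i _; apply: eq_bigr => j _; rewrite mxE normcN. Qed.

Lemma mxnormB m n (A B : 'M[C]_(m, n)) : mxnorm (A - B) <= mxnorm A + mxnorm B.
Proof. by rewrite -(mxnormN B) mxnormD. Qed.

Lemma mxnorm_sum m n (I : Type) (r : seq I) (P : pred I) (E : I -> 'M[C]_(m, n)) :
  mxnorm (\sum_(i <- r | P i) E i) <= \sum_(i <- r | P i) mxnorm (E i).
Proof.
elim/big_rec2: _ => [|i A B _ h]; first by rewrite mxnorm0.
by apply: le_trans (mxnormD _ _) _; rewrite lerD2l.
Qed.

Lemma normc_sum (I : Type) (r : seq I) (P : pred I) (E : I -> C) :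
  normc (\sum_(i <- r | P i) E i) <= \sum_(i <- r | P i) normc (E i).
Proof.
elim/big_rec2: _ => [|i A B _ h]; first by rewrite ComplexField.Normc.normc0.
by apply: le_trans (le_normcD _ _) _; rewrite lerD2l.
Qed.

Lemma mxnormM m n k (A : 'M[C]_(m, n)) (B : 'M[C]_(n, k)) :
  mxnorm (A *m B) <= mxnorm A * mxnorm B.
Proof.
rewrite /mxnorm mulr_suml; apply: ler_sum => i _.
rewrite mulr_suml.
apply: (@le_trans _ _ (\sum_j \sum_l normc (A i l) * normc (B l j))).
  apply: ler_sum => j _; rewrite mxE; apply: le_trans (normc_sum _ _ _) _.
  by apply: ler_sum => l _; rewrite ComplexField.Normc.normcM.
rewrite exchange_big /=; apply: ler_sum => l _; rewrite -mulr_sumr.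
apply: ler_wpM2l; first exact: normc_ge0.
rewrite [leRHS](bigD1 l) //= lerDl.
by apply: sumr_ge0 => q _; apply: sumr_ge0 => s _; apply: normc_ge0.
Qed.

Lemma mxnorm1 n : mxnorm (1%:M : 'M[C]_n) = n%:R.
Proof.
rewrite /mxnorm (eq_bigr (fun=> 1)) ?sumr_const ?card_ord // => i _.
rewrite (bigD1 i) //= big1 => [|j nij]; rewrite mxE.
  by rewrite eqxx ComplexField.Normc.normc1 addr0.
by rewrite eq_sym (negPf nij) ComplexField.Normc.normc0.
Qed.

Lemma linear_bounded m n k l (f : {linear 'M[C]_(m, n) -> 'M[C]_(k, l)}) :
  exists2 K, 0 <= K & forall A, mxnorm (f A) <= K * mxnorm A.
Proof.
exists (\sum_i \sum_j mxnorm (f (delta_mx i j))).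
  by apply: sumr_ge0 => i _; apply: sumr_ge0 => j _; apply: mxnorm_ge0.
move=> A; rewrite {1}[A]matrix_sum_delta linear_sum /=.
apply: le_trans (mxnorm_sum _ _ _) _; rewrite mulr_suml; apply: ler_sum => i _.
rewrite linear_sum /=; apply: le_trans (mxnorm_sum _ _ _) _; rewrite mulr_suml.
apply: ler_sum => j _; rewrite linearZ mxnormZ mulrC ler_wpM2l ?mxnorm_ge0 //.
exact: mxnorm_entry.
Qed.

Lemma le_of_geometric (a b c : R) : (forall k, a <= b + c / 2 ^+ k) -> a <= b.
Proof.
move=> h; rewrite leNgt; apply/negP => ba.
have e0 : 0 < a - b by rewrite subr_gt0.
have [k hk] : exists k, c / (a - b) < 2 ^+ k.
  by exists (Num.bound (c / (a - b))); apply: upper_nthrootP.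
have : c / 2 ^+ k < a - b.
  by rewrite ltr_pdivrMr ?exprn_gt0 // mulrC -ltr_pdivrMr.
have := h k; lra.
Qed.

Lemma half_geometric (c : R) k : c / 2 ^+ k = 2 * (c / 2 ^+ k.+1).
Proof. by rewrite exprS invfM [c * (_ * _)]mulrCA mulVKf ?pnatr_eq0. Qed.

Lemma limit_geometric_real (x : nat -> R) c :
  (forall k, `|x k.+1 - x k| <= c / 2 ^+ k) ->
  exists l, forall k, `|l - x k| <= 2 * c / 2 ^+ k.
Proof.
move=> hx.
(* The steps after index [k] add up to at most [2 * c / 2 ^+ k], so the intervals from [lo k] to
   [hi k] are nested; the supremum of the left ends lies in all of them. *)
pose lo k := x k - 2 * c / 2 ^+ k; pose hi k := x k + 2 * c / 2 ^+ k.
have half := half_geometric c.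
have lo_step k : lo k <= lo k.+1.
  have := hx k; rewrite ler_norml /lo => /andP[h1 h2].
  have := half k; rewrite -!mulrA; lra.
have hi_step k : hi k.+1 <= hi k.
  have := hx k; rewrite ler_norml /hi => /andP[h1 h2].
  have := half k; rewrite -!mulrA; lra.
have c0 k : 0 <= c / 2 ^+ k by apply: le_trans (hx k).
have lo_hi k l : lo k <= hi l.
  have lo_mono m d : lo m <= lo (m + d)%N.
    by elim: d => [|d IH]; rewrite ?addn0 // addnS (le_trans IH).
  have hi_mono m d : hi (m + d)%N <= hi m.
    by elim: d => [|d IH]; rewrite ?addn0 // addnS (le_trans _ IH).
  apply: le_trans (lo_mono k l) _; apply: le_trans (hi_mono l k).
  rewrite addnC /lo /hi; have := c0 (l + k)%N; rewrite -!mulrA; lra.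
pose E := [set y | exists k, y = lo k]%classic.
have supE : has_sup E.
  by split; [exists (lo 0%N), 0%N|exists (hi 0%N) => _ [k ->]].
exists (sup E) => k; rewrite ler_norml; apply/andP; split.
  have : lo k <= sup E by apply: sup_upper_bound => //; exists k.
  by rewrite /lo; lra.
have : sup E <= hi k by apply: ge_sup => [|_ [l ->]] //; case: supE.
by rewrite /hi; lra.
Qed.

Lemma limit_geometric m n (x : nat -> 'M[C]_(m, n)) c :
  (forall k, mxnorm (x k.+1 - x k) <= c / 2 ^+ k) ->
  exists l K, 0 <= K /\ forall k, mxnorm (l - x k) <= K * c / 2 ^+ k.
Proof.
move=> hx.
have hn i j k : normc (x k.+1 i j - x k i j) <= c / 2 ^+ k.
  by apply: le_trans (hx k); have := mxnorm_entry (x k.+1 - x k) i j; rewrite !mxE.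
have [lr hlr] : exists l : 'I_m -> 'I_n -> R, forall i j k,
    `|l i j - complex.Re (x k i j)| <= 2 * c / 2 ^+ k.
  have h i j : exists l, forall k, `|l - complex.Re (x k i j)| <= 2 * c / 2 ^+ k.
    apply: limit_geometric_real => k; apply: le_trans (hn i j k).
    by have := normc_Re (x k.+1 i j - x k i j); case: (x k.+1 i j) (x k i j) => ? ? [].
  have /fin_all_exists[l hl] := fun i => fin_all_exists (h i).
  by exists l => i j k; apply: hl.
have [li hli] : exists l : 'I_m -> 'I_n -> R, forall i j k,
    `|l i j - complex.Im (x k i j)| <= 2 * c / 2 ^+ k.
  have h i j : exists l, forall k, `|l - complex.Im (x k i j)| <= 2 * c / 2 ^+ k.
    apply: limit_geometric_real => k; apply: le_trans (hn i j k).
    by have := normc_Im (x k.+1 i j - x k i j); case: (x k.+1 i j) (x k i j) => ? ? [].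
  have /fin_all_exists[l hl] := fun i => fin_all_exists (h i).
  by exists l => i j k; apply: hl.
exists (\matrix_(i, j) (lr i j +i* li i j)), (4 *+ n *+ m).
split=> [|k]; first by rewrite !mulrn_wge0.
rewrite /mxnorm; apply: (@le_trans _ _ (\sum_(i < m) \sum_(j < n) (4 * (c / 2 ^+ k)))).
  apply: ler_sum => i _; apply: ler_sum => j _; rewrite !mxE.
  apply: le_trans (normc_le_ReIm _) _; have := hlr i j k; have := hli i j k.
  by case: (x k i j) => u v /=; rewrite -!mulrA; lra.
by rewrite !sumr_const !card_ord !mulrnAl mulrA.
Qed.

Lemma contraction_fixpoint m n (Phi : 'M[C]_(m, n) -> 'M[C]_(m, n)) rho :
  2 * mxnorm (Phi 0) <= rho ->
  (forall Y Y', mxnorm Y <= rho -> mxnorm Y' <= rho ->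
    mxnorm (Phi Y - Phi Y') <= mxnorm (Y - Y') / 2) ->
  exists2 Y, mxnorm Y <= 2 * mxnorm (Phi 0) & Phi Y = Y.
Proof.
move=> h0 hPhi; set c := mxnorm (Phi 0) in h0 *.
pose y k := iter k Phi 0.
have c0 : 0 <= c by apply: mxnorm_ge0.
have hk0 k : 0 <= c / 2 ^+ k by rewrite mulr_ge0 // invr_ge0 exprn_ge0.
have half := half_geometric c.
(* The bound on the iterates is the partial sum of the geometric series of steps; it keeps them in
   the ball where [Phi] halves distances. *)
have hy k : mxnorm (y k.+1 - y k) <= c / 2 ^+ k /\ mxnorm (y k) <= 2 * c - 2 * (c / 2 ^+ k).
  elim: k => [|k [IH1 IH2]].
    by rewrite /y /= subr0 mxnorm0 expr0 divr1 subrr.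
  have bk1 : mxnorm (y k.+1) <= 2 * c - 2 * (c / 2 ^+ k.+1).
    have := mxnormD (y k.+1 - y k) (y k); rewrite subrK.
    have := half k; lra.
  split=> //; apply: le_trans (hPhi (y k.+1) (y k) _ _) _.
  - by have := hk0 k.+1; lra.
  - by have := hk0 k; lra.
  - by have := half k; lra.
have [l [K [K0 hl]]] := limit_geometric (fun k => (hy k).1).
have lc : mxnorm l <= 2 * c.
  apply: (@le_of_geometric _ _ (K * c)) => k.
  have := mxnormD (l - y k) (y k); rewrite subrK.
  have := hl k; have := (hy k).2; have := hk0 k; lra.
exists l => //; apply/subr0_eq/mxnorm_eq0/eqP; rewrite eq_le mxnorm_ge0 andbT.
apply: (@le_of_geometric _ _ (2 * (K * c))) => k.
have := mxnormD (Phi l - Phi (y k)) (y k.+1 - l); rewrite addrA subrK.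
have := hl k.+1; rewrite -mxnormN opprB.
have := hPhi l (y k) (le_trans lc h0).
have : mxnorm (y k) <= rho by have := (hy k).2; have := hk0 k; lra.
move=> h1 /(_ h1); have := hl k.
have : K * c / 2 ^+ k = 2 * (K * c / 2 ^+ k.+1) by rewrite -half_geometric.
have : 0 <= K * c / 2 ^+ k by rewrite -mulrA mulr_ge0.
rewrite add0r -!mulrA; lra.
Qed.

End Norms.

Ltac nonneg := repeat first [assumption | apply: addr_ge0 | apply: mulr_ge0
  | apply: exprn_ge0 | exact: ler0n | exact: ler01 | apply: ltW; assumption].

Section StrictDifferentiability.
Variables (R : realType) (N n : nat).
Local Notation C := R[i].
Local Notation normc := ComplexField.Normc.normc.
Local Notation fam := {ffun 'I_N -> 'M[C]_n}.

Definition famnorm (T : fam) : R := \sum_(j < N) mxnorm (T j).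

Lemma famnorm_ge0 T : 0 <= famnorm T.
Proof. by apply: sumr_ge0 => j _; apply: mxnorm_ge0. Qed.

Lemma famnorm0 : famnorm 0 = 0.
Proof. by apply: big1 => j _; rewrite ffunE mxnorm0. Qed.

Lemma famnormD T T' : famnorm (T + T') <= famnorm T + famnorm T'.
Proof.
rewrite /famnorm -big_split; apply: ler_sum => j _.
by rewrite ffunE mxnormD.
Qed.

Lemma famnormZ a T : famnorm (a *: T) = normc a * famnorm T.
Proof. by rewrite /famnorm mulr_sumr; apply: eq_bigr => j _; rewrite ffunE mxnormZ. Qed.

Lemma famnorm_comp (T : fam) j : mxnorm (T j) <= famnorm T.
Proof.
rewrite /famnorm (bigD1 j) //= lerDl; apply: sumr_ge0 => i _; exact: mxnorm_ge0.
Qed.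

(** The remainder is controlled between two arbitrary points, not only against 0, because the
    correction map of [strict_solve] must be a contraction. One constant [K] serves the derivative,
    the values and the remainder. *)
Definition strict_bound (f : fam -> 'M[C]_n) (D : fam -> 'M[C]_n) (r K : R) :=
  [/\ forall T, mxnorm (D T) <= K * famnorm T,
   forall T, famnorm T <= r -> mxnorm (f T) <= K &
   forall T T', famnorm T <= r -> famnorm T' <= r ->
    mxnorm (f T - f T' - D (T - T')) <= K * (famnorm T + famnorm T') * famnorm (T - T')].

(* Strict differentiability at 0, with a quadratic remainder. *)
Definition strict (f : fam -> 'M[C]_n) (v : 'M[C]_n) (D : fam -> 'M[C]_n) :=
  f 0 = v /\ exists r K, [/\ 0 < r, 0 <= K & strict_bound f D r K].

Lemma strict_ext f f' v v' D D' : f =1 f' -> v = v' -> D =1 D' ->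
  strict f v D -> strict f' v' D'.
Proof.
move=> hf <- hD [<- [r [K [r0 K0 [h1 h2 h3]]]]]; split; first by rewrite hf.
exists r, K; split=> //; split=> [T|T|T T']; rewrite -?hf -?hD; [exact: h1|exact: h2|exact: h3].
Qed.

Lemma strict_cst A : strict (fun=> A) A (fun=> 0).
Proof.
split=> //; exists 1, (mxnorm A); split=> //; first exact: mxnorm_ge0.
split=> [T|T _|T T' _ _]; rewrite ?subrr ?subr0 ?mxnorm0 //.
- by rewrite mulr_ge0 ?mxnorm_ge0 ?famnorm_ge0.
- by rewrite !mulr_ge0 ?addr_ge0 ?mxnorm_ge0 ?famnorm_ge0.
Qed.

Lemma strict_affine j : strict (fun T : fam => 1%:M + T j) 1%:M (fun T => T j).
Proof.
split; first by rewrite ffunE addr0.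
exists 1, (n%:R + 1); split=> //; first by rewrite addr_ge0.
split=> [T|T hT|T T' _ _].
- apply: le_trans (famnorm_comp T j) _; rewrite mulrDl mul1r lerDr.
  by rewrite mulr_ge0 ?famnorm_ge0.
- apply: le_trans (mxnormD _ _) _; rewrite mxnorm1 lerD2l.
  exact: le_trans (famnorm_comp T j) hT.
- rewrite !ffunE opprD addrACA subrr add0r subrr mxnorm0.
  by rewrite !mulr_ge0 ?addr_ge0 ?famnorm_ge0.
Qed.

Lemma unitmx_near1 (A : 'M[C]_n) : mxnorm A <= 2^-1 -> 1%:M + A \in unitmx.
Proof.
move=> hA; rewrite -row_free_unit -kermx_eq0; apply/eqP.
set Z := kermx _; have : Z *m (1%:M + A) = 0 by apply: mulmx_ker.
rewrite mulmxDr mulmx1 => /eqP; rewrite addr_eq0 => /eqP ZA.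
apply: mxnorm_eq0; apply/eqP; rewrite eq_le mxnorm_ge0 andbT.
have : mxnorm Z <= mxnorm Z * mxnorm A by rewrite {1}ZA mxnormN mxnormM.
have : mxnorm Z * mxnorm A <= mxnorm Z * 2^-1 by rewrite ler_wpM2l ?mxnorm_ge0.
lra.
Qed.

Lemma mxnorm_inv_near1 (A : 'M[C]_n) : mxnorm A <= 2^-1 ->
  mxnorm (invmx (1%:M + A)) <= 2 * n%:R.
Proof.
move=> hA; have uA := unitmx_near1 hA; set B := invmx _.
have BE : B = 1%:M - B *m A.
  by rewrite -[in RHS](mulVmx uA) -/B mulmxDr mulmx1 addrK.
have : mxnorm B <= n%:R + mxnorm B * mxnorm A.
  rewrite {1}BE; apply: le_trans (mxnormB _ _) _; rewrite mxnorm1 lerD2l.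
  exact: mxnormM.
have : mxnorm B * mxnorm A <= mxnorm B * 2^-1 by rewrite ler_wpM2l ?mxnorm_ge0.
lra.
Qed.

Lemma strict_inv j : strict (fun T : fam => invmx (1%:M + T j)) 1%:M (fun T => - T j).
Proof.
split; first by rewrite ffunE addr0 invmx1.
exists 2^-1, (2 * n%:R + 4 * n%:R ^+ 2 + 1); split.
- by rewrite invr_gt0.
- by rewrite !addr_ge0 ?mulr_ge0 ?exprn_ge0.
have n0 : 0 <= n%:R :> R by [].
split=> [T|T hT|T T' hT hT'].
- rewrite mxnormN; apply: le_trans (famnorm_comp T j) _.
  rewrite [leRHS]mulrDl mul1r lerDr mulr_ge0 ?famnorm_ge0 //.
  by rewrite !addr_ge0 ?mulr_ge0 ?exprn_ge0.
- have := mxnorm_inv_near1 (le_trans (famnorm_comp T j) hT).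
  have : 0 <= n%:R ^+ 2 :> R by rewrite exprn_ge0.
  lra.
have h := le_trans (famnorm_comp T j) hT; have h' := le_trans (famnorm_comp T' j) hT'.
have uA := unitmx_near1 h; have uA' := unitmx_near1 h'.
have bA := mxnorm_inv_near1 h; have bA' := mxnorm_inv_near1 h'.
set A := invmx (1%:M + T j) in bA *; set A' := invmx (1%:M + T' j) in bA' *.
have [D DE] : exists D, D = T j - T' j by exists (T j - T' j).
(* By the resolvent identity [A - A'] is [- A D A'], and [A T j = 1 - A], [A' T' j = 1 - A']; each
   summand on the right therefore carries an explicit small factor [T j] or [T' j] besides [D]. *)
have -> : A - A' - - (T - T') j = A *m T j *m D + A *m D *m (A' *m T' j).
  have AA' : A - A' = - (A *m D *m A').
    have -> : D = (1%:M + T j) - (1%:M + T' j).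
      by rewrite DE opprD addrACA subrr add0r.
    rewrite mulmxBr mulmxBl mulVmx // mul1mx -mulmxA mulmxV // mulmx1.
    by rewrite opprB.
  have AT : A *m T j = 1%:M - A.
    by rewrite -[in RHS](mulVmx uA) -/A mulmxDr mulmx1 addrAC subrr add0r.
  have AT' : A' *m T' j = 1%:M - A'.
    by rewrite -[in RHS](mulVmx uA') -/A' mulmxDr mulmx1 addrAC subrr add0r.
  rewrite AA' AT AT' !ffunE -DE opprK. rewrite [(1%:M - A) *m D]mulmxBl mul1mx.
  by rewrite [A *m D *m (_ - _)]mulmxBr mulmx1 addrA subrK addrC.
have Dle : mxnorm D <= famnorm (T - T').
  by have := famnorm_comp (T - T') j; rewrite !ffunE -DE.
have t1 := famnorm_comp T j; have t1' := famnorm_comp T' j.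
apply: le_trans (mxnormD _ _) _.
have p0 := mxnorm_ge0 D; have pT := mxnorm_ge0 (T j); have pT' := mxnorm_ge0 (T' j).
have e1 : mxnorm (A *m T j *m D) <= 2 * n%:R * famnorm T * famnorm (T - T').
  apply: le_trans (mxnormM _ _) _; apply: ler_pM; rewrite ?mxnorm_ge0 //.
  by apply: le_trans (mxnormM _ _) _; apply: ler_pM; rewrite ?mxnorm_ge0.
have e2 : mxnorm (A *m D *m (A' *m T' j)) <=
    (2 * n%:R * famnorm (T - T')) * (2 * n%:R * famnorm T').
  apply: le_trans (mxnormM _ _) _; apply: ler_pM; rewrite ?mxnorm_ge0 //.
    by apply: le_trans (mxnormM _ _) _; apply: ler_pM; rewrite ?mxnorm_ge0.
  by apply: le_trans (mxnormM _ _) _; apply: ler_pM; rewrite ?mxnorm_ge0.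
apply: le_trans (lerD e1 e2) _.
have := famnorm_ge0 T; have := famnorm_ge0 T'; have := famnorm_ge0 (T - T').
move: (famnorm T) (famnorm T') (famnorm (T - T')) (n%:R : R) n0 => a b d q q0 d0 b0 a0.
rewrite -subr_ge0.
have -> : (2 * q + 4 * q ^+ 2 + 1) * (a + b) * d -
  (2 * q * a * d + 2 * q * d * (2 * q * b)) =
  2 * q * b * d + 4 * q ^+ 2 * a * d + (a + b) * d by ring.
nonneg.
Qed.

Lemma strict_mul f g v w D E : strict f v D -> strict g w E ->
  strict (fun T => f T *m g T) (v *m w) (fun T => D T *m w + v *m E T).
Proof.
move=> [fv [r1 [K1 [r10 K10 [hD1 hf hR1]]]]] [gw [r2 [K2 [r20 K20 [hD2 hg hR2]]]]].
split; first by rewrite fv gw.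
set r := Num.min r1 r2; have r0 : 0 < r by rewrite lt_min r10.
have rr1 T : famnorm T <= r -> famnorm T <= r1 by rewrite le_min => /andP[].
have rr2 T : famnorm T <= r -> famnorm T <= r2 by rewrite le_min => /andP[].
have lip (h : fam -> 'M[C]_n) u (D' : fam -> 'M[C]_n) (r' K : R) (T : fam) : h 0 = u -> 0 < r' -> 0 <= K ->
    (forall T, mxnorm (D' T) <= K * famnorm T) ->
    (forall T T' : fam, famnorm T <= r' -> famnorm T' <= r' ->
       mxnorm (h T - h T' - D' (T - T')) <= K * (famnorm T + famnorm T') * famnorm (T - T')) ->
    famnorm T <= r' -> mxnorm (h T - u) <= K * (1 + r') * famnorm T.
  move=> <- r'0 K0 hD hR hT; have := hR T 0 hT; rewrite famnorm0 => /(_ (ltW r'0)).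
  rewrite !subr0 addr0 => h1.
  have := mxnormD (h T - h 0 - D' T) (D' T); rewrite subrK => /le_trans; apply.
  apply: le_trans (lerD h1 (hD T)) _.
  have t0 := famnorm_ge0 T.
  rewrite mulrDr mulr1 mulrDl addrC lerD2l ler_wpM2r // ler_wpM2l //.
set L1 := K1 * (1 + r1); set L2 := K2 * (1 + r2).
have L10 : 0 <= L1 by rewrite mulr_ge0 // addr_ge0 // ltW.
have L20 : 0 <= L2 by rewrite mulr_ge0 // addr_ge0 // ltW.
have vK : mxnorm v <= K1 by rewrite -fv hf // famnorm0 ltW.
have wK : mxnorm w <= K2 by rewrite -gw hg // famnorm0 ltW.
pose K := 2 * K1 * K2 + K1 * L2 + K2 * L1.
have K0 : 0 <= K by rewrite /K; nonneg.
exists r, K; split=> //; split=> [T|T hT|T T' hT hT'].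
- apply: le_trans (mxnormD _ _) _; have t0 := famnorm_ge0 T.
  have e1 : mxnorm (D T *m w) <= K1 * famnorm T * K2.
    by apply: le_trans (mxnormM _ _) _; apply: ler_pM; rewrite ?mxnorm_ge0.
  have e2 : mxnorm (v *m E T) <= K1 * (K2 * famnorm T).
    by apply: le_trans (mxnormM _ _) _; apply: ler_pM; rewrite ?mxnorm_ge0.
  apply: le_trans (lerD e1 e2) _; rewrite -subr_ge0 /K.
  have -> : (2 * K1 * K2 + K1 * L2 + K2 * L1) * famnorm T -
    (K1 * famnorm T * K2 + K1 * (K2 * famnorm T)) = (K1 * L2 + K2 * L1) * famnorm T by ring.
  nonneg.
- apply: (@le_trans _ _ (K1 * K2)).
    apply: le_trans (mxnormM _ _) _; apply: ler_pM; rewrite ?mxnorm_ge0 //.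
      exact/hf/rr1.
    exact/hg/rr2.
  rewrite -subr_ge0 /K.
  have -> : 2 * K1 * K2 + K1 * L2 + K2 * L1 - K1 * K2 = K1 * K2 + K1 * L2 + K2 * L1 by ring.
  nonneg.
(* Each of the four terms contains a remainder of [f] or [g], or a derivative times a deviation from
   the value at 0; [lip] estimates the deviations. *)
have -> : f T *m g T - f T' *m g T' - (D (T - T') *m w + v *m E (T - T')) =
  (f T - f T' - D (T - T')) *m g T + D (T - T') *m (g T - w) +
  (f T' *m (g T - g T' - E (T - T')) + (f T' - v) *m E (T - T')).
  rewrite !mulmxBl !mulmxBr opprD !addrA.
  move: (f T *m g T) (f T' *m g T) (D (T - T') *m g T) (D (T - T') *m w).
  move: (f T' *m g T') (f T' *m E (T - T')) (v *m E (T - T')).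
  move=> a1 a2 a3 a4 a5 a6 a7.
  by rewrite (addrC (a4 - a5 - a6)) !addrA; apply/matrixP => i j; rewrite !mxE; ring.
have a0 := famnorm_ge0 T; have b0 := famnorm_ge0 T'; have d0 := famnorm_ge0 (T - T').
have e1 : mxnorm ((f T - f T' - D (T - T')) *m g T) <=
    K1 * (famnorm T + famnorm T') * famnorm (T - T') * K2.
  apply: le_trans (mxnormM _ _) _; apply: ler_pM; rewrite ?mxnorm_ge0 //.
    by apply: hR1; apply: rr1.
  exact/hg/rr2.
have e2 : mxnorm (D (T - T') *m (g T - w)) <= K1 * famnorm (T - T') * (L2 * famnorm T).
  apply: le_trans (mxnormM _ _) _; apply: ler_pM; rewrite ?mxnorm_ge0 //.
  by apply: (lip g w E) => //; apply: rr2.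
have e3 : mxnorm (f T' *m (g T - g T' - E (T - T'))) <=
    K1 * (K2 * (famnorm T + famnorm T') * famnorm (T - T')).
  apply: le_trans (mxnormM _ _) _; apply: ler_pM; rewrite ?mxnorm_ge0 //.
    exact/hf/rr1.
  by apply: hR2; apply: rr2.
have e4 : mxnorm ((f T' - v) *m E (T - T')) <= L1 * famnorm T' * (K2 * famnorm (T - T')).
  apply: le_trans (mxnormM _ _) _; apply: ler_pM; rewrite ?mxnorm_ge0 //.
  by apply: (lip f v D) => //; apply: rr1.
apply: le_trans (mxnormD _ _) _.
apply: le_trans (lerD (le_trans (mxnormD _ _) (lerD e1 e2)) (le_trans (mxnormD _ _) (lerD e3 e4))) _.
move: (famnorm T) (famnorm T') (famnorm (T - T')) a0 b0 d0 => a b d a0 b0 d0.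
rewrite -subr_ge0 /K.
have -> : (2 * K1 * K2 + K1 * L2 + K2 * L1) * (a + b) * d -
 (K1 * (a + b) * d * K2 + K1 * d * (L2 * a) + (K1 * (K2 * (a + b) * d) + L1 * b * (K2 * d)))
 = K1 * L2 * b * d + K2 * L1 * a * d by ring.
nonneg.
Qed.

End StrictDifferentiability.

Section Solve.
Variables (R : realType) (N n : nat).
Local Notation C := R[i].
Local Notation fam := {ffun 'I_N -> 'M[C]_n}.

Lemma linear_fam_bounded (G : {linear 'M[C]_n -> fam}) :
  exists2 K, 0 <= K & forall A, famnorm (G A) <= K * mxnorm A.
Proof.
have Glin j : linear (fun A => G A j) by move=> a u v; rewrite linearP !ffunE.
have hj j : exists K, 0 <= K /\ forall A, mxnorm (G A j) <= K * mxnorm A.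
  pose Gj : {linear _ -> 'M[C]_n} := HB.pack (fun A => G A j)
    (GRing.isLinear.Build _ _ _ _ (fun A => G A j) (Glin j)).
  by have [K K0 hK] := linear_bounded Gj; exists K.
have /fin_all_exists[K hK] := hj.
exists (\sum_j K j) => [|A]; first by apply: sumr_ge0 => j _; case: (hK j).
by rewrite /famnorm mulr_suml; apply: ler_sum => j _; case: (hK j).
Qed.

(* An implicit function theorem: S is an approximate solution, corrected by the
   fixed point of a contraction in the direction of the right inverse G. *)
Lemma strict_solve (f : fam -> 'M[C]_n) v D (pr : {linear 'M[C]_n -> 'M[C]_n})
    (G : {linear 'M[C]_n -> fam}) :
  strict f v D -> (forall T T', D (T - T') = D T - D T') ->
  (forall Z, pr (pr Z) = pr Z) -> (forall Z, pr (D (G Z)) = pr Z) ->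
  exists r K, [/\ 0 < r, 0 <= K & forall S y, famnorm S <= r -> mxnorm y <= r ->
    exists2 T, pr (f T) = pr (v + y) &
      famnorm (T - S) <= K * (mxnorm (y - D S) + famnorm S ^+ 2)].
Proof.
move=> [fv [r0 [Kf [r00 Kf0 [hD _ hR]]]]] DB prpr prDG.
have [Kp Kp0 hp] := linear_bounded pr.
have [Kg Kg0 hg] := linear_fam_bounded G.
pose M := Kf + Kp + Kg + 1.
have M1 : 1 <= M by rewrite /M lerDr; nonneg.
have fM : Kf <= M by rewrite /M -!addrA lerDl; nonneg.
have pM : Kp <= M by rewrite /M; lra.
have gM : Kg <= M by rewrite /M; lra.
have M0 : 0 < M by lra.
have M4 : M <= M ^+ 4 by rewrite ler_eXnr.
pose m := Num.min r0 1.
have m0 : 0 < m by rewrite lt_min r00 ltr01.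
have mr0 : m <= r0 by rewrite ge_min lexx.
have m1 : m <= 1 by rewrite ge_min lexx orbT.
(* The contraction constant below is [2 M^3 r + 2 M^4 rho], at most [rho / 4 + m / 8], hence below
   1/2. The choice of [r] also keeps twice the norm of [Phi 0] below [6 M^3 r], which is at most
   [rho]. *)
pose rho := m / (16 * M ^+ 4); pose r := rho / (8 * M ^+ 4).
have M40 : 0 < M ^+ 4 by rewrite exprn_gt0.
have M41 : 1 <= M ^+ 4 by rewrite exprn_ege1.
have rho0 : 0 < rho by rewrite divr_gt0 // mulr_gt0.
have r_gt0 : 0 < r by rewrite divr_gt0 // mulr_gt0.
have Mrho : M ^+ 4 * rho = m / 16 by rewrite /rho; field; rewrite lt0r_neq0.
have Mr : M ^+ 4 * r = rho / 8 by rewrite /r; field; rewrite lt0r_neq0.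
have r_rho : r <= rho by rewrite /r ler_pdivrMr ?mulr_gt0 // ler_peMr ?ltW //; lra.
have rho1 : rho <= 1.
  have : rho <= M ^+ 4 * rho by rewrite ler_peMl // ltW.
  by lra.
have MrhoM : M * rho <= m / 16 by rewrite -Mrho ler_wpM2r // ltW.
exists r, (2 * M ^+ 3); split=> //; first by nonneg.
move=> S y hS hy.
pose T Y := S + G Y.
(* A fixed point [Y] satisfies [Y = pr Y - pr (f (T Y) - v - y)]; applying the idempotent [pr]
   leaves [pr (f (T Y) - v - y) = 0]. *)
pose Phi Y := pr Y - pr (f (T Y) - v - y).
have hT Y : mxnorm Y <= rho -> famnorm (T Y) <= famnorm S + M * rho.
  move=> hY; apply: le_trans (famnormD _ _) _; rewrite lerD2l.
  by apply: le_trans (hg Y) _; apply: ler_pM => //; apply: mxnorm_ge0.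
have rho16 : rho <= m / 16 by rewrite -Mrho ler_peMl // ltW.
have r8 : r <= rho / 8 by rewrite -Mr ler_peMl // ltW.
have rS : famnorm S + M * rho <= m / 8 by lra.
have Sr0 : famnorm S <= r0 by lra.
have Phi0 : mxnorm (Phi 0) <= M ^+ 2 * (mxnorm (y - D S) + famnorm S ^+ 2).
  have -> : Phi 0 = pr ((y - D S) - (f S - f 0 - D S)).
    rewrite /Phi /T !linear0 !addr0 sub0r fv -linearN; congr (pr _).
    by rewrite !opprB; apply/matrixP => i j; rewrite !mxE; ring.
  apply: le_trans (hp _) _.
  have := hR S 0 Sr0; rewrite famnorm0 => /(_ (ltW r00)).
  rewrite addr0 subr0 => h1; have h2 := mxnormB (y - D S) (f S - f 0 - D S).
  have e1 : Kf * famnorm S * famnorm S <= M * famnorm S ^+ 2.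
    by rewrite -mulrA -expr2 ler_wpM2r // exprn_ge0 // famnorm_ge0.
  have e2 : mxnorm (y - D S) <= M * mxnorm (y - D S) by rewrite ler_peMl ?mxnorm_ge0.
  rewrite expr2 -mulrA; apply: ler_pM => //; first exact: mxnorm_ge0.
  apply: le_trans h2 _.
  rewrite mulrDr; lra.
have smallPhi : 2 * mxnorm (Phi 0) <= rho.
  have e1 : mxnorm (y - D S) <= r + M * r.
    apply: le_trans (mxnormB _ _) _; apply: lerD => //.
    apply: le_trans (hD S) _; apply: ler_pM => //; exact: famnorm_ge0.
  have e2 : famnorm S ^+ 2 <= r.
    rewrite expr2 -[r]mulr1; apply: ler_pM; rewrite ?famnorm_ge0 //.
    by apply: le_trans hS _; apply: le_trans r_rho _.
  have e3 : M ^+ 2 * (mxnorm (y - D S) + famnorm S ^+ 2) <= M ^+ 2 * (3 * M * r).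
    apply: ler_wpM2l; first by rewrite exprn_ge0 ?ltW.
    have e3 : r <= M * r by rewrite ler_peMl // ltW.
    move: e1 e2 e3; rewrite -mulrA; move: (M * r) (mxnorm _) (_ ^+ 2) => a b c; lra.
  have e4 : M ^+ 3 * r <= M ^+ 4 * r.
    by apply: ler_wpM2r; [exact: ltW|exact: ler_weXn2l].
  have e5 : M ^+ 2 * (3 * M * r) = 3 * (M ^+ 3 * r) by rewrite !exprS; ring.
  lra.
have contr Y Y' : mxnorm Y <= rho -> mxnorm Y' <= rho ->
    mxnorm (Phi Y - Phi Y') <= mxnorm (Y - Y') / 2.
  move=> hY hY'.
  have -> : Phi Y - Phi Y' = - pr (f (T Y) - f (T Y') - D (T Y - T Y')).
    have TB : T Y - T Y' = G (Y - Y') by rewrite /T linearB opprD addrACA subrr add0r.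
    rewrite TB [pr (_ - D _)]linearB prDG /Phi !linearB /=.
    by apply/matrixP => i j; rewrite !mxE; ring.
  rewrite mxnormN; apply: le_trans (hp _) _.
  have TB : famnorm (T Y - T Y') <= M * mxnorm (Y - Y').
    rewrite /T opprD addrACA subrr add0r -linearB; apply: le_trans (hg _) _.
    by rewrite ler_wpM2r ?mxnorm_ge0.
  have hTY := hT _ hY; have hTY' := hT _ hY'.
  have h1 : mxnorm (f (T Y) - f (T Y') - D (T Y - T Y')) <=
      M * (2 * (r + M * rho)) * (M * mxnorm (Y - Y')).
    apply: le_trans (hR _ _ _ _) _; [lra|lra|].
    apply: ler_pM; rewrite ?famnorm_ge0 ?mulr_ge0 ?addr_ge0 ?famnorm_ge0 //.
    by apply: ler_pM; rewrite ?addr_ge0 ?famnorm_ge0 //; lra.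
  apply: (@le_trans _ _ (M * (M * (2 * (r + M * rho)) * (M * mxnorm (Y - Y'))))).
    by apply: ler_pM; rewrite ?mxnorm_ge0.
  have -> : M * (M * (2 * (r + M * rho)) * (M * mxnorm (Y - Y'))) =
    (2 * (M ^+ 3 * r) + 2 * (M ^+ 4 * rho)) * mxnorm (Y - Y') by rewrite !exprS expr0; ring.
  rewrite [leRHS]mulrC; apply: ler_wpM2r; first exact: mxnorm_ge0.
  have e4 : M ^+ 3 * r <= M ^+ 4 * r.
    by apply: ler_wpM2r; [exact: ltW|exact: ler_weXn2l].
  lra.
have [Y hY PhiY] := contraction_fixpoint smallPhi contr.
exists (T Y).
  have : pr (f (T Y) - v - y) = 0.
    have := congr1 pr PhiY; rewrite /Phi linearB /= !prpr -{2}[pr Y]subr0.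
    by move/addrI/oppr_inj.
  by rewrite -addrA -opprD linearB => /subr0_eq.
rewrite /T addrAC subrr add0r; apply: le_trans (hg _) _.
apply: (@le_trans _ _ (M * (2 * mxnorm (Phi 0)))).
  by apply: ler_pM; rewrite ?mxnorm_ge0.
have -> : 2 * M ^+ 3 * (mxnorm (y - D S) + famnorm S ^+ 2) =
  M * (2 * (M ^+ 2 * (mxnorm (y - D S) + famnorm S ^+ 2))) by rewrite !exprS expr0; ring.
by apply: ler_wpM2l; [exact: ltW|apply: ler_wpM2l].
Qed.

Definition conj_family (X : 'I_N -> 'M[C]_n) (T : fam) (j : 'I_N) : 'M[C]_n :=
  (1%:M + T j) *m X j *m invmx (1%:M + T j).

Lemma strict_conj X j : strict (fun T => conj_family X T j) (X j)
  (fun T => - ad X X T j).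
Proof.
have h := strict_mul (strict_mul (@strict_affine R N n j) (@strict_cst R N n (X j)))
  (@strict_inv R N n j).
apply: strict_ext h => //; first by rewrite mul1mx mulmx1.
by move=> T; rewrite !mulmx0 addr0 mul1mx mulmx1 ffunE opprB mulmxN.
Qed.

Lemma strict_prod_conj X : (forall j, X j \in unitmx) ->
  strict (fun T => \prod_(j < N) conj_family X T j) (\prod_(j < N) X j)
  (fun T => - (prod_deriv X X (ad X X T) *m \prod_(j < N) X j)).
Proof.
move=> uX.
have H k : (k <= N)%N -> strict (fun T => prefix (conj_family X T) k) (prefix X k)
  (fun T => - ((\sum_(j < N | (j < k)%N) prefix X j *m ad X X T j *m
     invmx (prefix X j.+1)) *m prefix X k)).
  move: k; apply: (prefix_ind X) => [|j IH].
    apply: strict_ext (strict_cst N (1%:M : 'M[C]_n)) => [T|//|T]; rewrite ?prefix0 //.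
    by rewrite big_pred0 // mul0mx oppr0.
  apply: strict_ext (strict_mul IH (strict_conj X j)) => [T||T].
  - by rewrite (prefixS (conj_family X T)).
  - by rewrite prefixS.
  rewrite [in RHS](bigD1 j) //= [in RHS]mulmxDl mulmxKV ?prefix_unit //.
  rewrite mulmxN mulNmx opprD addrC -mulmxA -prefixS; congr (_ - (_ *m _)).
  by apply: eq_bigl => i; rewrite [in RHS]ltnS ltn_neqAle andbC.
have := H N (leqnn N); rewrite prefixN; apply: strict_ext => [T|//|T].
  by rewrite prefixN.
by congr (- (_ *m _)); apply: eq_bigl => j; apply: ltn_ord.
Qed.

End Solve.

Section Deformation.
Variables (R : realType) (p n : nat).
Local Notation C := R[i].
Local Notation normc := ComplexField.Normc.normc.
Local Notation fam := {ffun 'I_p.+1 -> 'M[C]_n}.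

(** If [c] is not 1, the powers of [c] below [k] sum to 0, so the differences [c ^+ i - 1] sum to
    [- k]. Each has modulus at most [i] times that of [c - 1], too small for this. *)
Lemma root1_near1 (c : C) k : c ^+ k = 1 -> (0 < k)%N -> k%:R * normc (c - 1) < 1 -> c = 1.
Proof.
move=> ck k0 small; apply/eqP; rewrite -subr_eq0; apply/negPn/negP => nc.
have c1 : normc c = 1.
  apply/eqP; rewrite -(@eqrXn2 _ k) ?normc_ge0 // expr1n -ComplexField.Normc.normc1 -ck.
  by apply/eqP; elim: k {ck k0 small} => [|k IH]; rewrite ?expr0 ?ComplexField.Normc.normc1 //
    !exprS ComplexField.Normc.normcM IH.
have hi i : normc (c ^+ i - 1) <= i%:R * normc (c - 1).
  elim: i => [|i IH]; first by rewrite expr0 subrr ComplexField.Normc.normc0 mul0r.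
  have -> : c ^+ i.+1 - 1 = c ^+ i * (c - 1) + (c ^+ i - 1) by rewrite exprSr; ring.
  apply: le_trans (le_normcD _ _) _; rewrite -add1n natrD mulrDl mul1r.
  apply: lerD => //; rewrite ComplexField.Normc.normcM.
  have -> : normc (c ^+ i) = 1.
    by elim: i {IH} => [|i IH]; rewrite ?expr0 ?ComplexField.Normc.normc1 //
      exprS ComplexField.Normc.normcM IH mulr1.
  by rewrite mul1r.
have := subrX1 c k; rewrite ck subrr => /esym/eqP; rewrite mulf_eq0 (negPf nc) /= => /eqP s0.
have : \sum_(i < k) (c ^+ i - 1) = - k%:R.
  by rewrite sumrB s0 sumr_const card_ord sub0r.
move/(congr1 (fun z => normc z)); rewrite normcN => h.
have : normc (k%:R : C) <= \sum_(i < k) k%:R * normc (c - 1).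
  rewrite -h; apply: le_trans (normc_sum _ _ _) _; apply: ler_sum => i _.
  apply: le_trans (hi i) _; apply: ler_wpM2r; first exact: normc_ge0.
  by rewrite ler_nat ltnW.
have -> : normc (k%:R : C) = k%:R.
  by rewrite -(rmorph_nat (real_complex R)) normc_real normr_nat.
rewrite sumr_const card_ord -(mulr_natl (k%:R * _)) leNgt => /negP; apply.
by rewrite -[ltRHS]mulr1 ltr_pM2l ?ltr0n.
Qed.

Lemma uniform_bounds (I : finType) (P : I -> R -> R -> Prop) :
  (forall i, exists r K, [/\ 0 < r, 0 <= K & P i r K]) ->
  (forall i r r' K K', r' <= r -> K <= K' -> P i r K -> P i r' K') ->
  exists r K, [/\ 0 < r, 0 <= K & forall i, P i r K].
Proof.
move=> /fin_all_exists[r /fin_all_exists[K hP]] mono.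
have r0 i : 0 <= (r i)^-1 by rewrite invr_ge0 ltW //; case: (hP i).
have K0 i : 0 <= K i by case: (hP i).
(* The inverse of a sum of inverses lies below every [r i]; the 1 keeps it positive when [I] is
   empty. *)
exists (\sum_i (r i)^-1 + 1)^-1, (\sum_i K i); split.
- by rewrite invr_gt0 ltr_wpDl // sumr_ge0.
- by rewrite sumr_ge0.
move=> i; have [ri _ hi] := hP i; apply: mono hi.
  rewrite -[leRHS]invrK lef_pV2 ?posrE ?invr_gt0 ?ltr_wpDl ?sumr_ge0 //.
  by rewrite (bigD1 i) //= -addrA lerDl addr_ge0 ?sumr_ge0.
by rewrite (bigD1 i) //= lerDl sumr_ge0.
Qed.

Definition traceless (Z : 'M[C]_n) : 'M[C]_n := Z - (\tr Z / n%:R)%:M.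

Lemma traceless_linear : linear traceless.
Proof.
move=> a u v; rewrite /traceless linearP /= mulrDl -mulrA raddfD /= -scale_scalar_mx.
by rewrite scalerBr opprD addrACA.
Qed.
HB.instance Definition _ := GRing.isLinear.Build C 'M[C]_n 'M[C]_n *:%R traceless traceless_linear.

(** The linearized product is onto the traceless matrices only, so [strict_solve] is applied to the
    traceless part and returns a product equal to a scalar [c]. Conjugation preserves determinants,
    so [c ^+ n = 1], and [c] is close to 1; hence [c = 1]. *)
Theorem deformation (X : 'I_p.+1 -> 'M[C]_n) (S : fam) : (0 < n)%N ->
  \prod_(j < p.+1) X j = 1%:M ->
  (forall T, intertwines X X T -> exists a, T = a%:M) ->
  prod_deriv X X (ad X X S) = 0 ->
  exists r K, [/\ 0 < r, 0 <= K & forall t : R, 0 < t -> t <= r ->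
    exists M P : 'I_p.+1 -> 'M[C]_n, [/\ \prod_(j < p.+1) M j = 1%:M,
      forall j, P j \in unitmx /\ M j *m P j = P j *m X j &
      forall j, mxnorm (M j - X j - t%:C *: ad X X S j) <= K * t ^+ 2]].
Proof.
move=> n0 pX cX hS; have uX := prod1_unit pX.
have nn0 : n%:R != 0 :> C by rewrite pnatr_eq0 -lt0n.
have tr0 Z : \tr (traceless Z) = 0.
  by rewrite linearB /= mxtrace_scalar -(mulr_natr (_ / _)) divfK // subrr.
have tr_id Z : \tr Z = 0 -> traceless Z = Z.
  by move=> h; rewrite /traceless h mul0r raddf0 subr0.
pose L T := prod_deriv X X (ad X X T).
pose Ll : {linear fam -> 'M[C]_n} := HB.pack L
  (GRing.isLinear.Build _ _ _ _ L (@prod_deriv_ad_linear _ _ _ _ X X)).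
pose G Z := - ((linfun Ll)^-1%VF (traceless Z)).
have Glin : linear G.
  by move=> a u v; rewrite /G traceless_linear linearP opprD scalerN.
pose Gl : {linear 'M[C]_n -> fam} := HB.pack G (GRing.isLinear.Build _ _ _ _ G Glin).
have LG Z : L (G Z) = - traceless Z.
  have LE W : L W = linfun Ll W by rewrite (lfunE Ll).
  rewrite /G (raddfN Ll : forall W, L (- W) = - L W) LE limg_lfunVK //.
  have [T <-] := prod_deriv_surj_traceless uX nn0 cX (tr0 Z).
  by rewrite -/(L T) LE memv_img ?memvf.
have [|||r [K [r0 K0 hsolve]]] := @strict_solve R p.+1 n _ _ _ traceless Gl
    (strict_prod_conj uX).
- move=> T T'; rewrite (raddfB (ad X X)) (raddfB (prod_deriv X X)) mulmxBl.
  by rewrite opprB opprK addrC.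
- by move=> Z; apply/tr_id/tr0.
- by move=> Z; rewrite pX mulmx1 [prod_deriv _ _ _]LG opprK; apply/tr_id/tr0.
have [_ [r1 [K1 [r10 K10 [hD1 _ hR1]]]]] := strict_prod_conj uX.
have [rc [Kc [rc0 Kc0 hc]]] : exists rc Kc, [/\ 0 < rc, 0 <= Kc & forall j,
    strict_bound (fun T : fam => conj_family X T j) (fun T => - ad X X T j) rc Kc].
  apply: uniform_bounds => [j|j a a' b b' aa' bb' [h1 h2 h3]].
    by have [_ [a [b [a0 b0 hab]]]] := strict_conj X j; exists a, b.
  split=> [T|T hT|T T' hT hT'].
  - by apply: le_trans (h1 T) _; rewrite ler_wpM2r ?famnorm_ge0.
  - by apply: le_trans (h2 T _) bb'; apply: le_trans hT aa'.
  - apply: le_trans (h3 T T' (le_trans hT aa') (le_trans hT' aa')) _.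
    apply: ler_wpM2r; first exact: famnorm_ge0.
    by apply: ler_wpM2r => //; rewrite addr_ge0 ?famnorm_ge0.
pose s := famnorm S; have s0 : 0 <= s by apply: famnorm_ge0.
pose Q := K * s ^+ 2 + s; have Q0 : 0 <= Q by rewrite /Q; nonneg.
(* [B] is a lower bound required of the inverse of [t]. Its summands ensure, in turn, that [t] is at
   most 1, that the system is solvable, that [1%:M + T j] is invertible, that [T] lies within the
   radii [r1] and [rc], and that [c] is close enough to 1. *)
pose B := 1 + s / r + 2 * Q + Q / r1 + Q / rc + 2 * (n%:R * (K1 * (1 + r1) * Q)).
have sr0 : 0 <= s / r by rewrite divr_ge0 // ltW.
have Qr10 : 0 <= Q / r1 by rewrite divr_ge0 // ltW.
have Qrc0 : 0 <= Q / rc by rewrite divr_ge0 // ltW.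
have nK0 : 0 <= n%:R * (K1 * (1 + r1) * Q) by nonneg.
have B1 : 1 <= B by rewrite /B; lra.
have B0 : 0 < B by lra.
exists B^-1, (Kc * Q ^+ 2 + Kc * (K * s ^+ 2)); split; first by rewrite invr_gt0.
  by nonneg.
move=> t t0 tB.
have tB1 : t * B <= 1 by rewrite -ler_pdivlMr // div1r.
have small a : 0 <= a -> a <= B -> t * a <= 1.
  by move=> a0 aB; apply: le_trans tB1; rewrite ler_pM2l.
have t1 : t <= 1 by rewrite -[t]mulr1 small // ltW.
have tsr : t * s <= r.
  have : t * (s / r) <= 1 by apply: small => //; rewrite /B; lra.
  by rewrite mulrA ler_pdivrMr // mul1r.
have tQ2 : t * Q <= 2^-1.
  have : t * (2 * Q) <= 1 by apply: small; [nonneg|rewrite /B; lra].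
  lra.
have tQ1 : t * Q <= r1.
  have : t * (Q / r1) <= 1 by apply: small => //; rewrite /B; lra.
  by rewrite mulrA ler_pdivrMr // mul1r.
have tQc : t * Q <= rc.
  have : t * (Q / rc) <= 1 by apply: small => //; rewrite /B; lra.
  by rewrite mulrA ler_pdivrMr // mul1r.
have tn : t * (n%:R * (K1 * (1 + r1) * Q)) < 1.
  have : t * (2 * (n%:R * (K1 * (1 + r1) * Q))) <= 1.
    by apply: small; [nonneg|rewrite /B; lra].
  lra.
have nt : normc (- t%:C) = t by rewrite normcN normc_real gtr0_norm.
(* The sign: conjugation by [1%:M + T j] has derivative [- ad X X T j]. *)
have [||T hT dT] := hsolve (- t%:C *: S) 0.
- by rewrite famnormZ nt.
- by rewrite mxnorm0 ltW.
have DS0 : - (prod_deriv X X (ad X X (- t%:C *: S)) *m \prod_(j < p.+1) X j) = 0.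
  have -> : prod_deriv X X (ad X X (- t%:C *: S)) = 0.
    by rewrite adZ prod_derivZ hS scaler0.
  by rewrite mul0mx oppr0.
have dT' : famnorm (T - - t%:C *: S) <= K * s ^+ 2 * t ^+ 2.
  apply: le_trans dT _; rewrite DS0 subr0 mxnorm0 add0r famnormZ nt exprMn -/s.
  by rewrite mulrA mulrAC.
have TQ : famnorm T <= t * Q.
  have := famnormD (T - - t%:C *: S) (- t%:C *: S); rewrite subrK famnormZ nt -/s.
  move/le_trans; apply; rewrite /Q mulrDr lerD2r; apply: le_trans dT' _.
  rewrite mulrC; apply: ler_wpM2r; first by nonneg.
  by rewrite expr2 ler_piMr // ltW.
have uT j : 1%:M + T j \in unitmx.
  apply: unitmx_near1; apply: le_trans (famnorm_comp T j) _; lra.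
pose c := \tr (\prod_(j < p.+1) conj_family X T j) / n%:R.
have Fc : \prod_(j < p.+1) conj_family X T j = c%:M.
  have tr1 : traceless (1%:M : 'M[C]_n) = 0.
    by rewrite /traceless mxtrace_scalar divff // subrr.
  apply/subr0_eq; rewrite -[RHS]tr1; move: hT; rewrite pX addr0; exact.
have cn : c ^+ n = 1.
  rewrite -det_scalar -Fc.
  have dM (Y : 'I_p.+1 -> 'M[C]_n) : \det (\prod_(j < p.+1) Y j) = \prod_(j < p.+1) \det (Y j).
    by apply: (big_morph (fun A : 'M[C]_n => \det A)); [exact: det_mulmx|exact: det1].
  have dX : \prod_(j < p.+1) \det (X j) = 1 by rewrite -dM pX det1.
  rewrite dM -[RHS]dX; apply: eq_bigr => j _.
  rewrite /conj_family !det_mulmx mulrAC -det_mulmx mulmxV // det1 mul1r //.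
have c1 : c = 1.
  apply: (root1_near1 cn n0); apply: le_lt_trans tn.
  rewrite mulrCA; apply: ler_wpM2l; first exact: ler0n.
  have T0 := famnorm_ge0 T.
  have := hR1 T 0 (le_trans TQ tQ1); rewrite famnorm0 => /(_ (ltW r10)).
  rewrite addr0.
  have -> : \prod_(j < p.+1) conj_family X 0 j = 1%:M.
    rewrite -pX; apply: eq_bigr => j _.
    by rewrite /conj_family !ffunE addr0 mul1mx invmx1 mulmx1.
  rewrite subr0 Fc -raddfB => h1.
  have := mxnormD (\prod_(j < p.+1) conj_family X T j - 1%:M -
     - (prod_deriv X X (ad X X T) *m \prod_(j < p.+1) X j))
     (- (prod_deriv X X (ad X X T) *m \prod_(j < p.+1) X j)).
  rewrite subrK Fc -raddfB => h2.
  have := mxnorm_entry ((c - 1)%:M : 'M[C]_n) (Ordinal n0) (Ordinal n0).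
  rewrite mxE eqxx mulr1n => /le_trans; apply; apply: le_trans h2 _.
  apply: le_trans (lerD h1 (hD1 T)) _.
  have -> : t * (K1 * (1 + r1) * Q) = K1 * r1 * (t * Q) + K1 * (t * Q) by ring.
  apply: lerD; last by apply: ler_wpM2l.
  apply: ler_pM => //; first by nonneg.
  by apply: ler_wpM2l => //; apply: le_trans TQ _.
exists (conj_family X T), (fun j => 1%:M + T j); split.
- by rewrite Fc c1.
- by move=> j; split=> //; rewrite /conj_family mulmxKV.
move=> j; have [hDc _ hRc] := hc j.
have -> : conj_family X T j - X j - t%:C *: ad X X S j =
   (conj_family X T j - conj_family X 0 j - - ad X X (T - 0) j) +
   - ad X X (T - - t%:C *: S) j.
  have -> : conj_family X 0 j = X j.
    by rewrite /conj_family !ffunE addr0 mul1mx invmx1 mulmx1.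
  have -> : ad X X (T - - t%:C *: S) = ad X X T + t%:C *: ad X X S.
    by rewrite -adZ -(raddfD (ad X X)) scaleNr opprK.
  have -> : ad X X (T - 0) = ad X X T by rewrite subr0.
  rewrite [(ad X X T + _) j]ffunE [X in - (_ + X)]ffunE.
  by rewrite opprK opprD addrA addrK.
apply: le_trans (mxnormD _ _) _; rewrite mulrDl; apply: lerD.
  apply: le_trans (hRc T 0 (le_trans TQ tQc) _) _; first by rewrite famnorm0 ltW.
  rewrite famnorm0 addr0 subr0 -[leLHS]mulrA -[leRHS]mulrA; apply: ler_wpM2l => //.
  rewrite -exprMn expr2 mulrC (mulrC Q); apply: ler_pM; rewrite ?famnorm_ge0 //.
apply: le_trans (hDc _) _; rewrite -[leRHS]mulrA; exact: ler_wpM2l.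
Qed.

End Deformation.

(** * Simple deformations of extensions *)

Section FreeAlgebra.
Variables (F : closedFieldType) (J : Type).

Lemma ncoff_sum m n (X : J -> 'M[F]_m) B (Y : J -> 'M[F]_n) (I : finType) (f : I -> ncpoly F J) :
  exists g, [/\ nceval X g = \sum_i nceval X (f i), nceval Y g = \sum_i nceval Y (f i) &
    ncoff X B Y g = \sum_i ncoff X B Y (f i)].
Proof.
have [s hs] : exists s : seq I, s = index_enum I by exists (index_enum I).
rewrite -hs; elim: s {hs} => [|i s [g [h1 h2 h3]]].
  by exists (NCconst _ 0); rewrite !big_nil /= !raddf0.
by exists (NCadd (f i) g); rewrite !big_cons /= h1 h2 h3.
Qed.

Definition ncsub (f g : ncpoly F J) := NCadd f (NCmul (NCconst J (-1)) g).

Lemma nceval_sub m (X : J -> 'M[F]_m) f g : nceval X (ncsub f g) = nceval X f - nceval X g.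
Proof. by rewrite /= mul_scalar_mx scaleN1r. Qed.

Lemma ncoff_sub m n (X : J -> 'M[F]_m) B (Y : J -> 'M[F]_n) f g :
  ncoff X B Y (ncsub f g) = ncoff X B Y f - ncoff X B Y g.
Proof. by rewrite /= mul_scalar_mx scaleN1r mul0mx addr0. Qed.

Lemma delta_sandwich m n (A : 'M[F]_(m, n)) p q a b (i : 'I_p) (k : 'I_q) :
  delta_mx i a *m A *m delta_mx b k = A a b *: delta_mx i k :> 'M[F]_(p, q).
Proof.
apply/matrixP => x y; rewrite !mxE (bigD1 b) //= big1 => [|c nc]; last first.
  by rewrite [X in _ * X]mxE (negPf nc) mulr0.
rewrite !mxE eqxx /= addr0 (bigD1 a) //= big1 => [|c nc]; last first.
  by rewrite mxE (negPf nc) andbF mul0r.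
by rewrite !mxE eqxx andbT addr0; case: (x == i); case: (y == k); rewrite ?mul1r ?mulr1 ?mul0r ?mulr0.
Qed.

Lemma sandwich_span m n (A E : 'M[F]_(m, n)) : A != 0 ->
  exists (x : 'I_m -> 'I_n -> 'M[F]_m) (y : 'I_m -> 'I_n -> 'M[F]_n),
  E = \sum_i \sum_k x i k *m A *m y i k.
Proof.
move=> nA; have [a [b nab]] : exists a b, A a b != 0.
  apply: NNPP => H; case/eqP: nA; apply/matrixP => a b; rewrite mxE.
  by apply/eqP/negPn/negP => nab; apply: H; exists a, b.
exists (fun i k => (E i k / A a b) *: delta_mx i a), (fun i k => delta_mx b k).
rewrite {1}[E]matrix_sum_delta; apply: eq_bigr => i _; apply: eq_bigr => k _.
by rewrite -!scalemxAl delta_sandwich scalerA divfK.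
Qed.

Section Separation.
Variables (u v : nat) (U : J -> 'M[F]_u) (V : J -> 'M[F]_v).
Hypotheses (sU : simple U) (sV : simple V).
Hypothesis homVU : forall T, intertwines V U T -> T = 0.

(** If some polynomial kills [V] but not [U], Burnside's theorem spreads it to the identity of [U].
    Otherwise the action on [V] determines the action on [U], so the matrix units of [V] act on [U]
    and single out a copy of [V] inside [U]. *)
Lemma separation : exists2 f, nceval U f = 1%:M & nceval V f = 0.
Proof.
have [[f Vf Uf]|H] := classic (exists2 f, nceval V f = 0 & nceval U f != 0).
  have [x [y xy]] := sandwich_span 1%:M Uf.
  have hx i k := burnside sU (x i k); have hy i k := burnside sU (y i k).
  have hik (ik : 'I_u * 'I_u) : exists h, nceval U h = x ik.1 ik.2 *m nceval U f *m y ik.1 ik.2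
      /\ nceval V h = 0.
    have [f1 h1] := hx ik.1 ik.2; have [f2 h2] := hy ik.1 ik.2.
    by exists (NCmul (NCmul f1 f) f2); rewrite /= h1 h2 Vf mulmx0 mul0mx.
  have /fin_all_exists[h hh] := hik.
  have [k [k1 k2 _]] := ncoff_sum U (fun=> 0) V h.
  exists k; last by rewrite k2 big1 // => i _; case: (hh i).
  rewrite k1 xy pair_bigA; apply: eq_bigr => ik _; by case: (hh ik).
have VU f g : nceval V f = nceval V g -> nceval U f = nceval U g.
  move=> fg; apply/subr0_eq/eqP/negPn/negP => nfg; apply: H.
  by exists (ncsub f g); rewrite nceval_sub ?fg ?subrr.
have [v0 _] := sV; pose o := Ordinal v0.
have /fin_all_exists[e he] : forall ik : 'I_v * 'I_v, exists f, nceval V f = delta_mx ik.1 ik.2.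
  by move=> ik; apply: burnside.
have ne : nceval U (e (o, o)) != 0.
  apply/eqP => e0; have [u0 _] := sU.
  have [k [k1 k2 _]] := ncoff_sum U (fun=> 0) V (fun i => NCmul (NCmul (e (i, o)) (e (o, o))) (e (o, i))).
  have : nceval U (NCconst _ 1) = nceval U k.
    apply: VU; rewrite k2 /=; apply/matrixP => i j; rewrite summxE (bigD1 i) //= big1 ?addr0.
      by rewrite !he delta_sandwich !mxE !eqxx /= mul1r eq_sym.
    by move=> l nl; rewrite !he delta_sandwich !mxE eqxx eq_sym (negPf nl) mulr0.
  rewrite k1 big1 => [|i _]; last by rewrite /= e0 mulmx0 mul0mx.
  by case: (u) u0 U => // u' _ U' /matrixP/(_ 0 0)/eqP; rewrite !mxE eqxx oner_eq0.
have [y ny] := exists_row_neq0 ne.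
(* The vectors obtained from a nonzero vector in the image of [e (o, o)] by the units [e (o, i)]
   transform under [U] as the standard basis does under [V]. *)
pose T := \matrix_i (row y (nceval U (e (o, o))) *m nceval U (e (o, i))).
have T0 : T = 0.
  apply: homVU => j; apply/row_matrixP => i; rewrite !row_mul rowK.
  rewrite mulmx_sum_row -mulmxA.
  have [k [k1 k2 _]] := ncoff_sum U (fun=> 0) V (fun k => NCmul (NCconst _ (V j i k)) (e (o, k))).
  have : nceval U (NCmul (e (o, i)) (NCvar _ j)) = nceval U k.
    apply: VU; rewrite k2 /= he; apply/matrixP => a c; rewrite summxE mxE.
    rewrite (bigD1 i) //= big1 => [|l nl]; last by rewrite mxE (negPf nl) andbF mul0r.
    rewrite (bigD1 c) //= big1 => [|l nl]; last first.
      by rewrite he mul_scalar_mx !mxE [c == l]eq_sym (negPf nl) andbF mulr0.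
    rewrite !addr0 he mul_scalar_mx !mxE !eqxx !andbT.
    by case: (a == o); rewrite ?mul1r ?mulr1 ?mul0r ?mulr0.
  move=> /= ->; rewrite k1 mulmx_sumr; apply: eq_bigr => k' _.
  by rewrite /= rowK mul_scalar_mx -scalemxAr !mxE.
case/eqP: ny; have <- : row o T = row y (nceval U (e (o, o))).
  rewrite rowK -row_mul; congr row.
  have := VU (NCmul (e (o, o)) (e (o, o))) (e (o, o)); apply.
  by rewrite /= !he mul_delta_mx.
by rewrite T0 row0.
Qed.

(** Let [e] act as 1 on [U] and 0 on [V]. The commutator of the variable [j] with [e] acts as 0 on
    both, with corner [U j *m C - C *m V j - B j], where [C] is the corner of [e]. If all such
    corners vanished, [B] would split; so one is nonzero, and multiplication on both sides produces
    every corner. *)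
Lemma radical_full (B : J -> 'M[F]_(u, v)) :
  ~ (exists C, forall j, B j = U j *m C - C *m V j) ->
  forall E, exists f, [/\ nceval U f = 0, nceval V f = 0 & ncoff U B V f = E].
Proof.
move=> nB E; have [e Ue Ve] := separation.
have [f0 [Uf Vf Bf]] : exists f, [/\ nceval U f = 0, nceval V f = 0 & ncoff U B V f != 0].
  apply: NNPP => H; apply: nB; exists (ncoff U B V e) => j.
  have : ncoff U B V (ncsub (NCmul (NCvar _ j) e) (NCmul e (NCvar _ j))) = 0.
    apply/eqP/negPn/negP => n0; apply: H; exists (ncsub (NCmul (NCvar _ j) e) (NCmul e (NCvar _ j))).
    by split=> //; rewrite nceval_sub /= ?Ue ?Ve ?mulmx1 ?mul1mx ?mulmx0 ?mul0mx subrr.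
  rewrite ncoff_sub /= Ue Ve mulmx0 mul1mx addr0 opprD addrA.
  by move/eqP; rewrite addrAC subr_eq0 => /eqP.
have [x [y ->]] := sandwich_span E Bf.
have hik (ik : 'I_u * 'I_v) : exists h, [/\ nceval U h = 0, nceval V h = 0 &
    ncoff U B V h = x ik.1 ik.2 *m ncoff U B V f0 *m y ik.1 ik.2].
  have [f1 h1] := burnside sU (x ik.1 ik.2); have [f2 h2] := burnside sV (y ik.1 ik.2).
  exists (NCmul (NCmul f1 f0) f2).
  by rewrite /= h1 h2 Uf Vf !(mulmx0, mul0mx) add0r addr0.
have /fin_all_exists[h hh] := hik.
have [k [k1 k2 k3]] := ncoff_sum U B V h.
exists k; rewrite k1 k2 k3; split.
- by rewrite big1 // => i _; case: (hh i).
- by rewrite big1 // => i _; case: (hh i).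
by rewrite pair_bigA; apply: eq_bigr => ik _; case: (hh ik).
Qed.

End Separation.

(* If there were no such f, the derivative in the direction D would be a
   derivation of the full matrix algebra, hence inner. *)
Lemma nontrivial_derivative m (X D : J -> 'M[F]_m) : simple X ->
  ~ (exists C, forall j, D j = X j *m C - C *m X j) ->
  exists f, nceval X f = 0 /\ ncoff X D X f != 0.
Proof.
move=> sX nD; apply: NNPP => H; apply: nD.
have XD f g : nceval X f = nceval X g -> ncoff X D X f = ncoff X D X g.
  move=> fg; apply/subr0_eq/eqP/negPn/negP => nfg; apply: H.
  by exists (ncsub f g); rewrite nceval_sub ncoff_sub fg subrr.
have [m0 _] := sX; pose o := Ordinal m0.
have /fin_all_exists[e he] : forall i : 'I_m, exists f, nceval X f = delta_mx i o.
  by move=> i; apply: burnside.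
(* The usual generator of a derivation of a matrix algebra: the sum of the derivatives of the units
   [(i, o)], each times the unit [(o, i)]. *)
pose C := \sum_i ncoff X D X (e i) *m delta_mx o i.
exists (- C) => j; rewrite mulmxN mulNmx opprK addrC.
have hi i : X j *m ncoff X D X (e i) + D j *m delta_mx i o =
    \sum_k X j k i *: ncoff X D X (e k).
  have [k [k1 _ k3]] := ncoff_sum X D X (fun k => NCmul (NCconst _ (X j k i)) (e k)).
  have := XD (NCmul (NCvar _ j) (e i)) k; rewrite k1 k3 /= he => ->.
    by apply: eq_bigr => l _; rewrite mul_scalar_mx mul0mx addr0.
  apply/matrixP => a c; rewrite summxE mxE (bigD1 i) //= big1 ?addr0; last first.
    by move=> l nl; rewrite mxE (negPf nl) mulr0.
  rewrite (bigD1 a) //= big1 ?addr0 => [|l nl]; last first.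
    by rewrite he mul_scalar_mx !mxE [a == l]eq_sym (negPf nl) mulr0.
  by rewrite he mul_scalar_mx !mxE !eqxx.
have sum1 : \sum_i (delta_mx i o : 'M[F]_m) *m delta_mx o i = 1%:M.
  by rewrite mx1_sum_delta; apply: eq_bigr => i _; rewrite mul_delta_mx.
have : \sum_i (X j *m ncoff X D X (e i) + D j *m delta_mx i o) *m delta_mx o i = C *m X j.
  under eq_bigr do rewrite hi.
  rewrite mulmx_suml; under eq_bigr do rewrite mulmx_suml.
  rewrite exchange_big /=; apply: eq_bigr => k _.
  rewrite -mulmxA; under eq_bigr do rewrite -scalemxAl scalemxAr.
  rewrite -mulmx_sumr; congr (_ *m _); apply/matrixP => a c.
  rewrite summxE mxE (bigD1 c) //= big1 => [|l nl]; last first.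
    by rewrite !mxE [c == l]eq_sym (negPf nl) andbF mulr0.
  rewrite (bigD1 k) //= [X in _ = _ + X]big1 => [|l nl]; last first.
    by rewrite !mxE (negPf nl) andbF mul0r.
  by rewrite !mxE !eqxx !andbT !addr0 mulrC.
rewrite (eq_bigr (fun i => X j *m (ncoff X D X (e i) *m delta_mx o i) +
   D j *m (delta_mx i o *m delta_mx o i))); last first.
  by move=> i _; rewrite mulmxDl !mulmxA.
rewrite big_split /= -!mulmx_sumr sum1 mulmx1 -/C => <-.
by rewrite addrAC subrr add0r.
Qed.

End FreeAlgebra.

Lemma mul_remainder (F : comPzRingType) n (a b x y d e x' y' : 'M[F]_n) (t : F) :
  a = x + (t *: d + x') -> b = y + (t *: e + y') ->
  a *m b - x *m y - t *: (x *m e + d *m y) =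
  (x *m y' + x' *m y) + (t *: d + x') *m (t *: e + y').
Proof.
move=> ha hb; have [u hu] : exists u, u = t *: d + x' by exists (t *: d + x').
have [v hv] : exists v, v = t *: e + y' by exists (t *: e + y').
have -> : t *: (x *m e + d *m y) = x *m (v - y') + (u - x') *m y.
  by rewrite hu hv !addrK scalerDr scalemxAr scalemxAl.
rewrite -hu -hv in ha hb *; rewrite ha hb mulmxDl !mulmxDr mulmxBl mulmxN.
move: (x *m y) (x *m v) (u *m y) (u *m v) (x *m y') (x' *m y) => m1 m2 m3 m4 m5 m6.
by apply/matrixP => i j; rewrite !mxE; ring.
Qed.

(** * First-order approximation and openness of simplicity *)

Section Approximation.
Variables (R : realType) (J : Type) (n : nat).
Local Notation C := R[i].
Local Notation normc := ComplexField.Normc.normc.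
Variables (X D : J -> 'M[C]_n) (K : R).
Hypothesis K0 : 0 <= K.

Definition approximates (M : J -> 'M[C]_n) (t : R) :=
  forall j, mxnorm (M j - X j - t%:C *: D j) <= K * t ^+ 2.

Lemma nceval_approx f : exists K', 0 <= K' /\ forall t M, 0 < t -> t <= 1 ->
  approximates M t ->
  mxnorm (nceval M f - nceval X f - t%:C *: ncoff X D X f) <= K' * t ^+ 2.
Proof.
elim: f => [a|j|f [Kf [Kf0 hf]] g [Kg [Kg0 hg]]|f [Kf [Kf0 hf]] g [Kg [Kg0 hg]]] /=.
- exists 0; split=> // t M t0 t1 _; rewrite subrr scaler0 subr0 mxnorm0.
  by rewrite mul0r.
- by exists K; split=> // t M _ _; apply.
- exists (Kf + Kg); split=> [|t M t0 t1 hM]; first by nonneg.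
  have := mxnormD (nceval M f - nceval X f - t%:C *: ncoff X D X f)
    (nceval M g - nceval X g - t%:C *: ncoff X D X g).
  have -> : nceval M f - nceval X f - t%:C *: ncoff X D X f +
    (nceval M g - nceval X g - t%:C *: ncoff X D X g) = nceval M f + nceval M g -
    (nceval X f + nceval X g) - t%:C *: (ncoff X D X f + ncoff X D X g).
    by rewrite scalerDr !opprD addrACA; congr (_ + _); rewrite addrACA.
  move/le_trans; apply; rewrite mulrDl; apply: lerD; [exact: hf|exact: hg].
pose xf := mxnorm (nceval X f); pose xg := mxnorm (nceval X g).
pose df := mxnorm (ncoff X D X f); pose dg := mxnorm (ncoff X D X g).
have xf0 : 0 <= xf by apply: mxnorm_ge0.
have xg0 : 0 <= xg by apply: mxnorm_ge0.
have df0 : 0 <= df by apply: mxnorm_ge0.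
have dg0 : 0 <= dg by apply: mxnorm_ge0.
exists (xf * Kg + Kf * xg + (df + Kf) * (dg + Kg)); split=> [|t M t0 t1 hM]; first by nonneg.
have {}hf := hf t M t0 t1 hM; have {}hg := hg t M t0 t1 hM.
set ef := nceval M f - _ - _ in hf; set eg := nceval M g - _ - _ in hg.
pose yf := t%:C *: ncoff X D X f + ef; pose yg := t%:C *: ncoff X D X g + eg.
have Mf : nceval M f = nceval X f + yf by rewrite /yf /ef (addrC (_ *: _)) subrK addrC subrK.
have Mg : nceval M g = nceval X g + yg by rewrite /yg /eg (addrC (_ *: _)) subrK addrC subrK.
have -> : nceval M f *m nceval M g - nceval X f *m nceval X g -
    t%:C *: (nceval X f *m ncoff X D X g + ncoff X D X f *m nceval X g) =
    (nceval X f *m eg + ef *m nceval X g) + yf *m yg.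
  exact: mul_remainder Mf Mg.
have yle d e Ke (E : 'M[C]_n) (De : 'M[C]_n) : mxnorm De = d -> mxnorm E <= Ke * t ^+ 2 ->
    0 <= Ke -> e = t%:C *: De + E -> mxnorm e <= (d + Ke) * t.
  move=> hd hE Ke0 ->; apply: le_trans (mxnormD _ _) _; rewrite mxnormZ normc_real gtr0_norm // hd.
  rewrite mulrDl; apply: lerD; first by rewrite mulrC.
  apply: le_trans hE _; apply: ler_wpM2l => //.
  by rewrite expr2 ler_piMl // ltW.
have hyf : mxnorm yf <= (df + Kf) * t by apply: yle hf _ _.
have hyg : mxnorm yg <= (dg + Kg) * t by apply: yle hg _ _.
rewrite [leRHS]mulrDl; apply: le_trans (mxnormD _ _) _; apply: lerD.
  rewrite mulrDl; apply: le_trans (mxnormD _ _) _; apply: lerD; apply: le_trans (mxnormM _ _) _.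
    by rewrite -mulrA; apply: ler_wpM2l.
  by rewrite mulrAC; apply: ler_wpM2r.
apply: le_trans (mxnormM _ _) _.
have -> : (df + Kf) * (dg + Kg) * t ^+ 2 = (df + Kf) * t * ((dg + Kg) * t) by ring.
by apply: ler_pM; rewrite ?mxnorm_ge0.
Qed.

(** Every matrix unit is approximated up to O(t) by a matrix preserving all subspaces stable under
    [M]: either the value of [f] at [M], or this value divided by [t] when [f] vanishes at [X] and
    the unit appears only in its derivative. A nonzero stable space then contains approximations of
    all basis rows. *)
Lemma simple_near : (0 < n)%N ->
  (forall i k : 'I_n, exists f, nceval X f = delta_mx i k \/
     (nceval X f = 0 /\ ncoff X D X f = delta_mx i k)) ->
  exists r, 0 < r /\ forall t M, 0 < t -> t <= r -> approximates M t -> simple M.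
Proof.
move=> n0 hX.
have H (ik : 'I_n * 'I_n) : exists Ki : R, 0 <= Ki /\
    forall t M, 0 < t -> t <= 1 -> approximates M t -> exists2 E : 'M[C]_n,
      (forall k (W : 'M_(k, n)), (forall j, stablemx W (M j)) -> stablemx W E) &
      mxnorm (E - delta_mx ik.1 ik.2) <= Ki * t.
  case: ik => i k /=.
  have [f hf] := hX i k; have [K' [K'0 hK']] := nceval_approx f.
  have [fE|[f0 fE]] := hf.
    exists (K' + mxnorm (ncoff X D X f)); split=> [|t M t0 t1 hM]; first by rewrite addr_ge0 ?mxnorm_ge0.
    exists (nceval M f) => [m W sW|]; first exact: nceval_stable.
    have := mxnormD (nceval M f - nceval X f - t%:C *: ncoff X D X f) (t%:C *: ncoff X D X f).
    rewrite subrK fE => /le_trans; apply.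
    rewrite mulrDl; apply: lerD; last by rewrite mxnormZ normc_real gtr0_norm // mulrC.
    rewrite -fE; apply: le_trans (hK' t M t0 t1 hM) _; apply: ler_wpM2l => //.
    by rewrite expr2 ler_piMl // ltW.
  exists K'; split=> // t M t0 t1 hM.
  exists ((t%:C)^-1 *: nceval M f) => [m W sW|].
    by rewrite -scalemxAr scalemx_sub // nceval_stable.
  have tC : t%:C != 0 :> C.
    by apply/eqP => /(congr1 (@complex.Re R)) /= t00; rewrite t00 ltxx in t0.
  have -> : (t%:C)^-1 *: nceval M f - delta_mx i k =
     (t%:C)^-1 *: (nceval M f - nceval X f - t%:C *: ncoff X D X f).
    by rewrite f0 subr0 scalerBr scalerA mulVf // scale1r fE.
  rewrite mxnormZ ComplexField.Normc.normcV normc_real gtr0_norm //.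
  rewrite mulrC ler_pdivrMr // -mulrA -expr2; exact: hK'.
have /fin_all_exists[Ks hKs] := H.
pose B := \sum_ik Ks ik.
have B0 : 0 <= B by apply: sumr_ge0 => ik _; case: (hKs ik).
have KB ik : Ks ik <= B.
  by rewrite /B (bigD1 ik) //= lerDl; apply: sumr_ge0 => jk _; case: (hKs jk).
pose Q := 1 + 2 * (n%:R * (n%:R * B)); have Q1 : 1 <= Q by rewrite lerDl; nonneg.
have Q0 : 0 < Q by lra.
exists Q^-1; split=> [|t M t0 tQ hM]; first by rewrite invr_gt0.
have tQ1 : t * Q <= 1 by rewrite -ler_pdivlMr // div1r.
have t1 : t <= 1 by apply: le_trans tQ1; rewrite ler_peMr // ltW.
split=> // k W sW; have [->|nW] := eqVneq W 0; [by left|right].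
have [i0 nw] := exists_row_neq0 nW; set w := row i0 W in nw.
(* Dividing by the largest entry of [w] makes the error independent of [w]. *)
have [c hc] : exists c, forall i, normc (w 0 i) <= normc (w 0 c).
  pose o := Ordinal n0.
  by case: (@arg_maxP _ _ _ o xpredT (fun i => normc (w 0 i)) isT) => c _ hc; exists c => i; apply: hc.
have wc : w 0 c != 0.
  apply: contra nw => /eqP wc0; apply/eqP/rowP => i; rewrite [RHS]mxE.
  apply: ComplexField.Normc.eq0_normc; apply/eqP; rewrite eq_le normc_ge0 andbT.
  by apply: le_trans (hc i) _; rewrite wc0 ComplexField.Normc.normc0.
have /fin_all_exists[E hE] : forall i : 'I_n, exists E : 'M[C]_n,
    stablemx W E /\ mxnorm (E - delta_mx c i) <= B * t.
  move=> i; have [_ /(_ t M t0 t1 hM)[E sE hE]] := hKs (c, i).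
  exists E; split; first exact: sE.
  by apply: le_trans hE _; apply: ler_wpM2r; [exact: ltW|exact: KB].
pose Z := \matrix_i ((w 0 c)^-1 *: (w *m E i)).
have ZW : (Z <= W)%MS.
  apply/row_subP => i; rewrite rowK scalemx_sub // /w -row_mul.
  by apply: submx_trans (row_sub _ _) _; case: (hE i).
suff uZ : Z \in unitmx.
  by rewrite -sub1mx; apply: submx_trans ZW; rewrite sub1mx row_full_unit.
have -> : Z = 1%:M + (Z - 1%:M) by rewrite addrC subrK.
apply: unitmx_near1.
have nwc : 0 < normc (w 0 c).
  rewrite lt_neqAle normc_ge0 andbT eq_sym; apply/eqP => /ComplexField.Normc.eq0_normc h.
  by rewrite h eqxx in wc.
have rowB i : \sum_j normc ((Z - 1%:M) i j) <= n%:R * B * t.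
  have -> : \sum_j normc ((Z - 1%:M) i j) = mxnorm ((w 0 c)^-1 *: (w *m (E i - delta_mx c i))).
    rewrite /mxnorm big_ord1; apply: eq_bigr => j _.
    congr (normc _); rewrite mulmxBr scalerBr [LHS]mxE [RHS]mxE [Z i j]mxE.
    congr (_ + _); rewrite [LHS]mxE [RHS]mxE; congr (- _).
    rewrite [RHS]mxE [X in _ = _ * X]mxE (bigD1 c) //= big1 => [|l nl].
      by rewrite [delta_mx _ _ _ _]mxE eqxx addr0 /= mulrA mulVf // mul1r mxE eq_sym.
    by rewrite [delta_mx _ _ _ _]mxE (negPf nl) mulr0.
  rewrite mxnormZ ComplexField.Normc.normcV mulrC ler_pdivrMr //.
  apply: le_trans (mxnormM _ _) _.
  have wn : mxnorm w <= n%:R * normc (w 0 c).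
    rewrite /mxnorm big_ord1; apply: le_trans (ler_sum _ (fun i _ => hc i)) _.
    by rewrite sumr_const card_ord mulr_natl.
  apply: le_trans (ler_pM (mxnorm_ge0 _) (mxnorm_ge0 _) wn (hE i).2) _.
  by have -> : n%:R * normc (w 0 c) * (B * t) = n%:R * B * t * normc (w 0 c) by ring.
apply: le_trans (ler_sum _ (fun i _ => rowB i)) _.
rewrite sumr_const card_ord -(mulr_natl (n%:R * B * t)).
have : t * (2 * (n%:R * (n%:R * B))) <= 1.
  apply: le_trans tQ1; apply: ler_wpM2l; first exact: ltW.
  by rewrite /Q lerDr.
have -> : t * (2 * (n%:R * (n%:R * B))) = 2 * (n%:R * (n%:R * B * t)) by ring.
lra.
Qed.

Lemma nceval_neq0_near f : nceval X f = 0 -> ncoff X D X f != 0 ->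
  exists r, 0 < r /\ forall t M, 0 < t -> t <= r -> approximates M t -> nceval M f != 0.
Proof.
move=> f0 df; have [K' [K'0 hK']] := nceval_approx f.
set d := mxnorm (ncoff X D X f).
have d0 : 0 < d.
  rewrite lt_neqAle mxnorm_ge0 andbT eq_sym; apply/eqP => /mxnorm_eq0 h.
  by rewrite h eqxx in df.
exists (Num.min 1 (d / (2 * (K' + 1)))); split.
  by rewrite lt_min ltr01 divr_gt0 // mulr_gt0 // ltr_wpDl.
move=> t M t0; rewrite le_min => /andP[t1 td] hM; apply/eqP => Mf0.
have := hK' t M t0 t1 hM; rewrite Mf0 f0 subrr sub0r mxnormN mxnormZ normc_real gtr0_norm // -/d.
rewrite expr2 mulrA mulrC ler_pM2r //.
move: td; rewrite ler_pdivlMr ?mulr_gt0 ?ltr_wpDl // => td.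
have : 0 <= K' * t by rewrite mulr_ge0 // ltW.
lra.
Qed.

End Approximation.

Section BlockProjections.
Variables (F : comPzRingType) (m1 m2 n1 n2 : nat).
Local Notation M := 'M[F]_(m1 + m2, n1 + n2).

Lemma ulsubmx_linear : linear (fun A : M => ulsubmx A).
Proof. by move=> a A B; apply/matrixP => i j; rewrite !mxE. Qed.
HB.instance Definition _ := GRing.isLinear.Build F M 'M[F]_(m1, n1) *:%R
  (@ulsubmx F m1 m2 n1 n2) ulsubmx_linear.

Lemma ursubmx_linear : linear (fun A : M => ursubmx A).
Proof. by move=> a A B; apply/matrixP => i j; rewrite !mxE. Qed.
HB.instance Definition _ := GRing.isLinear.Build F M 'M[F]_(m1, n2) *:%R
  (@ursubmx F m1 m2 n1 n2) ursubmx_linear.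

Lemma dlsubmx_linear : linear (fun A : M => dlsubmx A).
Proof. by move=> a A B; apply/matrixP => i j; rewrite !mxE. Qed.
HB.instance Definition _ := GRing.isLinear.Build F M 'M[F]_(m2, n1) *:%R
  (@dlsubmx F m1 m2 n1 n2) dlsubmx_linear.

Lemma drsubmx_linear : linear (fun A : M => drsubmx A).
Proof. by move=> a A B; apply/matrixP => i j; rewrite !mxE. Qed.
HB.instance Definition _ := GRing.isLinear.Build F M 'M[F]_(m2, n2) *:%R
  (@drsubmx F m1 m2 n1 n2) drsubmx_linear.

End BlockProjections.

Lemma simple_hom_sym (F : fieldType) J m n (X : J -> 'M[F]_m) (Y : J -> 'M[F]_n) :
  simple X -> simple Y -> (forall T, intertwines X Y T -> T = 0) ->
  forall T, intertwines Y X T -> T = 0.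
Proof.
move=> sX sY h T hT; apply: NNPP => nT.
have TV := mulmxVp (simple_row_free sY hT nT).
have VT := mulVpmx (simple_row_full sX hT nT).
have : pinvmx T = 0.
  apply: h => j; move: (pinvmx T) TV VT => T' TV VT.
  by rewrite -[X j]mul1mx -VT -(mulmxA T') -hT -!mulmxA TV mulmx1.
move=> T'0; move: VT; rewrite T'0 mul0mx => /esym I0.
by apply: nT; rewrite -[T]mulmx1 I0 mulmx0.
Qed.

Section BlockDerivatives.
Variables (F : fieldType) (N u v : nat).
Variables (U : 'I_N -> 'M[F]_u) (B : {ffun 'I_N -> 'M[F]_(u, v)}) (V : 'I_N -> 'M[F]_v).
Hypotheses (uU : forall j, U j \in unitmx) (uV : forall j, V j \in unitmx).
Let X := block_family U B V.

Lemma invmx_block (a : 'M[F]_u) b (d : 'M[F]_v) : a \in unitmx -> d \in unitmx ->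
  exists y, invmx (block_mx a b 0 d) = block_mx (invmx a) y 0 (invmx d).
Proof.
move=> ua ud; exists (- (invmx a *m b *m invmx d)).
have h : block_mx a b 0 d *m block_mx (invmx a) (- (invmx a *m b *m invmx d)) 0 (invmx d) = 1%:M.
  rewrite mulmx_block !mulmx0 !mul0mx !addr0 !add0r mulmxV // mulmxV //.
  by rewrite mulmxN !mulmxA mulmxV // mul1mx addNr -scalar_mx_block.
have [uA _] := mulmx1_unit h.
by rewrite -[LHS]mulmx1 -h mulmxA mulVmx // mul1mx.
Qed.

(** Prefixes of an upper triangular family and their inverses are upper triangular with known
    diagonal blocks. The corners [x] and [y] may stay unspecified: they never reach the lower left
    block, nor the other blocks under the vanishing assumptions made below. *)
Lemma block_deriv_term (j : 'I_N) : exists x y, forall D : 'M[F]_(u + v),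
  prefix X j *m D *m invmx (prefix X j.+1) =
  block_mx (prefix U j) x 0 (prefix V j) *m D *m
  block_mx (invmx (prefix U j.+1)) y 0 (invmx (prefix V j.+1)).
Proof.
rewrite /X (prefix_block U B (ltnW (ltn_ord j)) uV) (prefix_block U B (ltn_ord j) uV).
have [y ->] := invmx_block ((\sum_(j0 < N | (j0 < j.+1)%N) prefix U j0 *m B j0 *m
  invmx (prefix V j0.+1)) *m prefix V j.+1) (prefix_unit j.+1 uU) (prefix_unit j.+1 uV).
by eexists _, y.
Qed.

Variable D : {ffun 'I_N -> 'M[F]_(u + v)}.

Lemma prod_deriv_block_dl :
  dlsubmx (prod_deriv X X D) = prod_deriv V U [ffun j => dlsubmx (D j)].
Proof.
rewrite /prod_deriv (raddf_sum (@dlsubmx F u v u v)) /=; apply: eq_bigr => j _.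
have [x [y ->]] := block_deriv_term j; rewrite ffunE -{1}[D j]submxK !mulmx_block.
by rewrite block_mxKdl !(mul0mx, mulmx0, addr0, add0r).
Qed.

Hypothesis Ddl : forall j, dlsubmx (D j) = 0.

Lemma prod_deriv_block_ul :
  ulsubmx (prod_deriv X X D) = prod_deriv U U [ffun j => ulsubmx (D j)].
Proof.
rewrite /prod_deriv (raddf_sum (@ulsubmx F u v u v)) /=; apply: eq_bigr => j _.
have [x [y ->]] := block_deriv_term j; rewrite ffunE -{1}[D j]submxK !mulmx_block.
by rewrite block_mxKul Ddl !(mul0mx, mulmx0, addr0, add0r).
Qed.

Lemma prod_deriv_block_dr :
  drsubmx (prod_deriv X X D) = prod_deriv V V [ffun j => drsubmx (D j)].
Proof.
rewrite /prod_deriv (raddf_sum (@drsubmx F u v u v)) /=; apply: eq_bigr => j _.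
have [x [y ->]] := block_deriv_term j; rewrite ffunE -{1}[D j]submxK !mulmx_block.
by rewrite block_mxKdr Ddl !(mul0mx, mulmx0, addr0, add0r).
Qed.

Lemma prod_deriv_block_ur : (forall j, ulsubmx (D j) = 0) -> (forall j, drsubmx (D j) = 0) ->
  ursubmx (prod_deriv X X D) = prod_deriv U V [ffun j => ursubmx (D j)].
Proof.
move=> Dul Ddr.
rewrite /prod_deriv (raddf_sum (@ursubmx F u v u v)) /=; apply: eq_bigr => j _.
have [x [y ->]] := block_deriv_term j; rewrite ffunE -{1}[D j]submxK !mulmx_block.
by rewrite block_mxKur Ddl Dul Ddr !(mul0mx, mulmx0, addr0, add0r).
Qed.

End BlockDerivatives.

Lemma ncoff_dl (F : fieldType) J u v (U : J -> 'M[F]_u) B (V : J -> 'M[F]_v)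
    (D : J -> 'M[F]_(u + v)) f :
  dlsubmx (ncoff (block_family U B V) D (block_family U B V) f) =
  ncoff V (fun j => dlsubmx (D j)) U f.
Proof.
elim: f => [a|j|f IHf g IHg|f IHf g IHg] //=; rewrite ?raddf0 //.
  by rewrite raddfD /= IHf IHg.
rewrite !nceval_block -[ncoff _ D _ f]submxK -[ncoff _ D _ g]submxK.
rewrite !mulmx_block (raddfD (@dlsubmx F u v u v)) /= !block_mxKdl !mul0mx mulmx0 addr0 add0r.
by rewrite IHf IHg.
Qed.

Section Transverse.
Variables (F : closedFieldType) (p : nat).
Hypothesis char0 : forall q, (0 < q)%N -> q%:R != 0 :> F.
Variables (es : 'I_p.+1 -> seq F) (b : nat).
Hypothesis size_es : forall j, size (es j) = b.
Hypothesis dim_gt : (coincidences es + 2 * (b * b) + 2 <= p.+1 * (b * b))%N.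

(** The surplus 2 in [dim_gt], multiplied by [s * t], leaves room for one linear condition [l]
    besides nontriviality. *)
Lemma typed_cocycle s t m n (X : 'I_p.+1 -> 'M[F]_m) (Y : 'I_p.+1 -> 'M[F]_n)
    (l : {linear {ffun 'I_p.+1 -> 'M[F]_(m, n)} -> F^o}) :
  typed es s X -> typed es t Y -> (0 < s)%N -> (0 < t)%N ->
  exists T, [/\ prod_deriv X Y (ad X Y T) = 0, l T = 0 &
    ~ exists K, ad X Y T = ad X Y (const_family p.+1 K)].
Proof.
move=> tX tY s0 t0; apply: nontrivial_cocycle.
rewrite (dim_lker_typed tX tY) (typed_size size_es tX) (typed_size size_es tY).
have := leq_mul (leqnn (s * t)) dim_gt; have : (0 < s * t)%N by rewrite muln_gt0 s0 t0.
rewrite !mulnDr; nia.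
Qed.

(** Isomorphic families are killed by the same polynomials. Here [f] kills [U] but has a nonzero
    derivative along [ad U U S], so this direction leaves the isomorphism class of [U]. *)
Lemma nontrivial_deformation s u (U : 'I_p.+1 -> 'M[F]_u) : (0 < s)%N ->
  typed es s U -> simple U ->
  exists S f, [/\ prod_deriv U U (ad U U S) = 0, nceval U f = 0 &
    ncoff U (ad U U S) U f != 0].
Proof.
move=> s0 tU sU; pose l0 : {linear {ffun 'I_p.+1 -> 'M[F]_(u, u)} -> F^o} := \0.
have [S [hS _ nS]] := typed_cocycle l0 tU tU s0 s0.
have [|f [Uf Df]] := @nontrivial_derivative F _ _ U (ad U U S) sU.
  by case=> Q hQ; apply: nS; exists Q; apply/ffunP => j; rewrite ad_const.
by exists S, f.
Qed.

Section NonIsomorphic.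
Variables (s t u v : nat) (U : 'I_p.+1 -> 'M[F]_u) (V : 'I_p.+1 -> 'M[F]_v).
Hypotheses (s0 : (0 < s)%N) (t0 : (0 < t)%N).
Hypotheses (tU : typed es s U) (tV : typed es t V) (sU : simple U) (sV : simple V).
Hypothesis homUV : forall T, intertwines U V T -> T = 0.
Let homVU := simple_hom_sym sU sV homUV.
Let uU := typed_unit tU.
Let uV := typed_unit tV.

Lemma extension_centralizer (B : 'I_p.+1 -> 'M[F]_(u, v)) :
  ~ (exists K, forall j, B j = U j *m K - K *m V j) ->
  forall T, intertwines (block_family U B V) (block_family U B V) T ->
  exists a, T = a%:M.
Proof.
move=> nB T hT; rewrite -[T]submxK in hT *.
move: (ulsubmx T) (ursubmx T) (dlsubmx T) (drsubmx T) hT => a x c d hT.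
have eqs j : [/\ U j *m a + B j *m c = a *m U j, U j *m x + B j *m d = a *m B j + x *m V j,
    V j *m c = c *m U j & V j *m d = c *m B j + d *m V j].
  have := hT j; rewrite /block_family !mulmx_block !mul0mx !mulmx0 !add0r !addr0.
  by case/eq_block_mx.
have c0 : c = 0 by apply: homVU => j; have [] := eqs j.
have [al ha] : exists al, a = al%:M.
  by apply: (schur sU) => j; have [<- _ _ _] := eqs j; rewrite c0 mulmx0 addr0.
have [de hd] : exists de, d = de%:M.
  by apply: (schur sV) => j; have [_ _ _ ->] := eqs j; rewrite c0 mul0mx add0r.
have hB j : (al - de) *: B j = U j *m x - x *m V j.
  have [_ h _ _] := eqs j; move: h; rewrite ha hd mul_mx_scalar mul_scalar_mx => h.
  by rewrite scalerBl; apply/eqP; rewrite subr_eq addrAC -h addrK || rewrite subr_eq addrAC eq_sym subr_eq h.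
have alde : al = de.
  apply/eqP; rewrite -subr_eq0; apply/negPn/negP => n0; apply: nB.
  exists ((al - de)^-1 *: x) => j.
  by rewrite -scalemxAr -scalemxAl -scalerBr -hB scalerA mulVf // scale1r.
have x0 : x = 0.
  apply: homUV => j; apply/eqP; rewrite -subr_eq0 -hB alde subrr scale0r //.
by exists al; rewrite ha hd c0 x0 alde -scalar_mx_block.
Qed.

(** The tangent vector is [low c + diag + up]. The nontrivial class [c] provides the lower left
    block, [diag] cancels the diagonal blocks of the linearized product, and [up] its upper right
    block, which is always possible since no nonzero map goes from [V] to [U]. Only [diag] meets an
    obstruction: these diagonal blocks must be traceless. *)
Lemma transverse_extension : exists (B : 'I_p.+1 -> 'M[F]_(u, v)) S,
  let X := block_family U B V in
  [/\ typed es (s + t) X, forall T, intertwines X X T -> exists a, T = a%:M,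
    prod_deriv X X (ad X X S) = 0 &
    forall i k : 'I_(u + v), exists f, nceval X f = delta_mx i k \/
     (nceval X f = 0 /\ ncoff X (ad X X S) X f = delta_mx i k)].
Proof.
have [u0 _] := sU; have [v0 _] := sV.
pose l0 : {linear {ffun 'I_p.+1 -> 'M[F]_(u, v)} -> F^o} := \0.
have [T0 [hT0 _ nT0]] := typed_cocycle l0 tU tV s0 t0.
set B := ad U V T0 in hT0 nT0.
have nB : ~ (exists K, forall j, B j = U j *m K - K *m V j).
  by case=> K hK; apply: nT0; exists K; apply/ffunP => j; rewrite ad_const.
pose X := block_family U B V.
have tX : typed es (s + t) X by apply: typed_extension.
pose L S := prod_deriv X X (ad X X S).
have LD S1 S2 : L (S1 + S2) = L S1 + L S2 by rewrite /L (raddfD (ad X X)) (raddfD (prod_deriv X X)).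
pose low (c : {ffun 'I_p.+1 -> 'M[F]_(v, u)}) : {ffun 'I_p.+1 -> 'M[F]_(u + v)} :=
  [ffun j => block_mx 0 0 (c j) 0].
have adE S j : ad X X S j =
    block_mx (U j *m ulsubmx (S j) + B j *m dlsubmx (S j) - ulsubmx (S j) *m U j)
     (U j *m ursubmx (S j) + B j *m drsubmx (S j) - (ulsubmx (S j) *m B j + ursubmx (S j) *m V j))
     (V j *m dlsubmx (S j) - dlsubmx (S j) *m U j)
     (V j *m drsubmx (S j) - (dlsubmx (S j) *m B j + drsubmx (S j) *m V j)).
  rewrite ffunE -{1 2}[S j]submxK /X /block_family !mulmx_block opp_block_mx add_block_mx.
  by rewrite !mul0mx !mulmx0 !add0r !addr0.
(* This trace is the condition imposed on [c] through the spare dimension of Ext. *)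
pose l c : F^o := \tr (ulsubmx (L (low c))).
have lowlin : linear low.
  move=> a x y; apply/ffunP => j; rewrite !ffunE scale_block_mx add_block_mx.
  by rewrite !scaler0 !addr0.
have llin : linear l.
  move=> a x y.
 rewrite /l.
 rewrite lowlin.
 rewrite /L.
 rewrite prod_deriv_ad_linear.
  by rewrite ulsubmx_linear mxtrace_is_scalar.
pose ll : {linear _ -> F^o} := HB.pack l (GRing.isLinear.Build _ _ _ _ l llin).
have [c [hc lc nc]] := typed_cocycle ll tV tU t0 s0.
have L_dl S : dlsubmx (L S) = prod_deriv V U (ad V U [ffun j => dlsubmx (S j)]).
  rewrite /L prod_deriv_block_dl //; congr prod_deriv; apply/ffunP => j.
  by rewrite ffunE adE block_mxKdl ad_apply ffunE.
have Lc_dl : dlsubmx (L (low c)) = 0.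
  rewrite L_dl -[RHS]hc; congr (prod_deriv _ _ (ad _ _ _)); apply/ffunP => j.
  by rewrite ffunE [low c j]ffunE block_mxKdl.
(* The total trace vanishes anyway, so the condition [l] settles both diagonal blocks. *)
have Lc_tr : \tr (drsubmx (L (low c))) = 0.
  have h : \tr (L (low c)) = 0 := mxtrace_prod_deriv (low c) (typed_unit tX).
  by rewrite -(submxK (L (low c))) mxtrace_block [\tr (ulsubmx _)]lc add0r in h.
have nz q (W : 'I_p.+1 -> 'M[F]_q) : simple W -> q%:R != 0 :> F.
  by case=> q0 _; apply: char0.
have [a ha] := prod_deriv_surj_traceless uU (nz _ _ sU) (fun T hT => schur sU hT)
  (Z := - ulsubmx (L (low c))) (ltac:(by rewrite linearN /= [\tr _]lc oppr0)).
have [d hd] := prod_deriv_surj_traceless uV (nz _ _ sV) (fun T hT => schur sV hT)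
  (Z := - drsubmx (L (low c))) (ltac:(by rewrite linearN /= Lc_tr oppr0)).
pose diag : {ffun 'I_p.+1 -> 'M[F]_(u + v)} := [ffun j => block_mx (a j) 0 0 (d j)].
have diag_dl j : dlsubmx (ad X X diag j) = 0.
  by rewrite adE block_mxKdl ffunE !block_mxKdl mulmx0 mul0mx subrr.
have Ld_dl : dlsubmx (L diag) = 0.
  rewrite L_dl (_ : [ffun j => _] = 0) ?prod_deriv_ad0 //.
  by apply/ffunP => j; rewrite ffunE [RHS]ffunE [X in dlsubmx X]ffunE block_mxKdl.
have Ld_ul : ulsubmx (L diag) = - ulsubmx (L (low c)).
  rewrite /L prod_deriv_block_ul // -ha; congr prod_deriv; apply/ffunP => j.
  rewrite ffunE [RHS]ad_apply adE block_mxKul [diag j]ffunE block_mxKul block_mxKdl.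
  by rewrite mulmx0 addr0.
have Ld_dr : drsubmx (L diag) = - drsubmx (L (low c)).
  rewrite /L prod_deriv_block_dr // -hd; congr prod_deriv; apply/ffunP => j.
  rewrite ffunE [RHS]ad_apply adE block_mxKdr [diag j]ffunE block_mxKdr block_mxKdl.
  by rewrite mul0mx add0r.
have [x hx] := prod_deriv_surj uV homVU (- ursubmx (L (low c) + L diag)).
pose up : {ffun 'I_p.+1 -> 'M[F]_(u + v)} := [ffun j => block_mx 0 (x j) 0 0].
have upE j : ad X X up j = block_mx 0 (ad U V x j) 0 0.
  rewrite adE [ad U V x j]ad_apply [up j]ffunE block_mxKul block_mxKur block_mxKdl block_mxKdr.
  by rewrite !(mulmx0, mul0mx, addr0, add0r, oppr0).
have Lu_ur : ursubmx (L up) = - ursubmx (L (low c) + L diag).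
  rewrite /L prod_deriv_block_ur //; first (rewrite -hx; congr prod_deriv; apply/ffunP => j).
  - by rewrite ffunE upE block_mxKur.
  - by move=> j; rewrite upE block_mxKdl.
  - by move=> j; rewrite upE block_mxKul.
  - by move=> j; rewrite upE block_mxKdr.
have up_dl j : dlsubmx (ad X X up j) = 0 by rewrite upE block_mxKdl.
have Lu_dl : dlsubmx (L up) = 0.
  rewrite L_dl (_ : [ffun j => _] = 0) ?prod_deriv_ad0 //.
  by apply/ffunP => j; rewrite ffunE [RHS]ffunE [X in dlsubmx X]ffunE block_mxKdl.
have Lu_ul : ulsubmx (L up) = 0.
  rewrite /L prod_deriv_block_ul // (_ : [ffun j => _] = 0) ?(raddf0 (prod_deriv U U)) //.
  by apply/ffunP => j; rewrite ffunE upE block_mxKul ffunE.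
have Lu_dr : drsubmx (L up) = 0.
  rewrite /L prod_deriv_block_dr // (_ : [ffun j => _] = 0) ?(raddf0 (prod_deriv V V)) //.
  by apply/ffunP => j; rewrite ffunE upE block_mxKdr ffunE.
pose S := low c + diag + up.
have hS : L S = 0.
  rewrite /S !LD -[LHS]submxK.
  rewrite (raddfD (@ulsubmx F u v u v)) (raddfD (@ursubmx F u v u v)).
  rewrite (raddfD (@dlsubmx F u v u v)) (raddfD (@drsubmx F u v u v)) /=.
  rewrite Lu_ur subrr Lu_ul Lu_dl Lu_dr !addr0.
  rewrite (raddfD (@ulsubmx F u v u v)) (raddfD (@dlsubmx F u v u v)) (raddfD (@drsubmx F u v u v)) /=.
  by rewrite Ld_ul Ld_dl Ld_dr Lc_dl addr0 !subrr block_mx0.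
have S_dl j : dlsubmx (ad X X S j) = V j *m c j - c j *m U j.
  rewrite adE block_mxKdl; have -> : dlsubmx (S j) = c j.
    rewrite /S !ffunE !(raddfD (@dlsubmx F u v u v)) /= !block_mxKdl.
    by rewrite !addr0.
  by [].
exists B, S; split=> //; first exact: extension_centralizer.
have XE f : nceval X f = block_mx (nceval U f) (ncoff U B V f) 0 (nceval V f).
  exact: nceval_block.
have radB := radical_full sU sV homVU nB.
have radD : forall E, exists f, [/\ nceval V f = 0, nceval U f = 0 &
    ncoff V (fun j => dlsubmx (ad X X S j)) U f = E].
  apply: radical_full => // -[Q hQ]; apply: nc; exists Q.
  by apply/ffunP => j; rewrite ad_const ad_apply -S_dl hQ.
have blk_ur E : exists f, nceval X f = block_mx 0 E 0 0.
  by have [f [h1 h2 h3]] := radB E; exists f; rewrite XE h1 h2 h3.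
have blk_ul E : exists f, nceval X f = block_mx E 0 0 0.
  have [e Ue Ve] := separation sU sV homVU.
  have [f Uf] := burnside sU E.
  have [g hg] := blk_ur (ncoff U B V (NCmul f e)).
  exists (ncsub (NCmul f e) g); rewrite nceval_sub hg XE /= Uf Ue Ve !(mulmx0, mulmx1).
  by rewrite opp_block_mx add_block_mx !oppr0 !addr0 subrr.
have blk_dr E : exists f, nceval X f = block_mx 0 0 0 E.
  have [e Ve Ue] := separation sV sU homUV.
  have [f Vf] := burnside sV E.
  have [g hg] := blk_ur (ncoff U B V (NCmul f e)).
  exists (ncsub (NCmul f e) g); rewrite nceval_sub hg XE /= Vf Ue Ve !(mulmx0, mulmx1).
  by rewrite opp_block_mx add_block_mx !oppr0 !addr0 subrr.
have blk_dl E : exists f, nceval X f = 0 /\ ncoff X (ad X X S) X f = block_mx 0 0 E 0.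
  have [f [Vf Uf Df]] := radD E.
  (* Sandwiching [f] between the idempotents of the two diagonal blocks isolates the lower left
     block of its derivative: the value of [f] at [X] has only an upper right block, killed by [h2]
     on the left and by [h1] on the right, so the derivatives of [h1] and [h2] drop out. *)
  have [h1 hh1] := blk_ul 1%:M; have [h2 hh2] := blk_dr 1%:M.
  have Xf : nceval X f = block_mx 0 (ncoff U B V f) 0 0 by rewrite XE Uf Vf.
  exists (NCmul (NCmul h2 f) h1); rewrite /= hh1 hh2 Xf.
  have -> : block_mx 0 0 0 1%:M *m block_mx 0 (ncoff U B V f) 0 0 = 0 :> 'M[F]_(u + v).
    by rewrite mulmx_block !(mulmx0, mul0mx) !addr0 block_mx0.
  rewrite !mul0mx add0r; split=> //.
  rewrite mulmxDl -!mulmxA.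
  have -> : block_mx 0 (ncoff U B V f) 0 0 *m block_mx 1%:M 0 0 0 = 0 :> 'M[F]_(u + v).
    by rewrite mulmx_block !(mulmx0, mul0mx) !addr0 block_mx0.
  rewrite mulmx0 addr0 -[ncoff X _ X f]submxK ncoff_dl Df !mulmx_block.
  by rewrite !(mulmx0, mul0mx, addr0, add0r, mulmx1, mul1mx).
move=> i k.
have dE : delta_mx i k = block_mx (ulsubmx (delta_mx i k)) (ursubmx (delta_mx i k))
   (dlsubmx (delta_mx i k)) (drsubmx (delta_mx i k)) :> 'M[F]_(u + v) by rewrite submxK.
rewrite dE; case: (split_ordP i) => i' ->; case: (split_ordP k) => k' ->.
- have [f hf] := blk_ul (delta_mx i' k'); exists f; left; rewrite hf.
  by congr block_mx; apply/matrixP => y z; rewrite !mxE ?eq_lshift ?eq_rshift ?eq_lrshift ?eq_rlshift ?andbF.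
- have [f hf] := blk_ur (delta_mx i' k'); exists f; left; rewrite hf.
  by congr block_mx; apply/matrixP => y z; rewrite !mxE ?eq_lshift ?eq_rshift ?eq_lrshift ?eq_rlshift ?andbF.
- have [f [hf hD]] := blk_dl (delta_mx i' k'); exists f; right; split=> //; rewrite hD.
  by congr block_mx; apply/matrixP => y z; rewrite !mxE ?eq_lshift ?eq_rshift ?eq_lrshift ?eq_rlshift ?andbF.
- have [f hf] := blk_dr (delta_mx i' k'); exists f; left; rewrite hf.
  by congr block_mx; apply/matrixP => y z; rewrite !mxE ?eq_lshift ?eq_rshift ?eq_lrshift ?eq_rlshift ?andbF.
Qed.

End NonIsomorphic.

End Transverse.

(** * Joining simple families by deformation *)

Section Join.
Variables (R : realType) (p : nat).
Local Notation C := R[i].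
Variables (es : 'I_p.+1 -> seq C) (b : nat).
Hypothesis size_es : forall j, size (es j) = b.
Hypothesis dim_gt : (coincidences es + 2 * (b * b) + 2 <= p.+1 * (b * b))%N.

Lemma typed_near s m (X : 'I_p.+1 -> 'M[C]_m) (S : {ffun 'I_p.+1 -> 'M[C]_m}) :
  (0 < m)%N -> typed es s X -> (forall T, intertwines X X T -> exists a, T = a%:M) ->
  prod_deriv X X (ad X X S) = 0 ->
  exists r K, [/\ 0 < r, 0 <= K & forall t, 0 < t -> t <= r ->
    exists M, typed es s M /\ approximates X (ad X X S) K M t].
Proof.
move=> m0 tX cX hS; have [r [K [r0 K0 H]]] := deformation m0 tX.1.2 cX hS.
exists r, K; split=> // t t0 tr; have [M [P [pM hP hM]]] := H t t0 tr.
exists M; split; last exact: hM.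
by apply: (typed_conj (P := P) tX _ _ pM) => j; case: (hP j).
Qed.

Lemma another_simple s u (U : 'I_p.+1 -> 'M[C]_u) : (0 < s)%N ->
  typed es s U -> simple U ->
  exists U' : 'I_p.+1 -> 'M[C]_u, [/\ typed es s U', simple U' &
    forall T, intertwines U U' T -> T = 0].
Proof.
move=> s0 tU sU; have [u0 _] := sU.
have [S [f [hS Uf Df]]] := nontrivial_deformation size_es dim_gt s0 tU sU.
have [r [K [r0 K0 H]]] := typed_near u0 tU (fun T hT => schur sU hT) hS.
have [r1 [r10 H1]] : exists r, 0 < r /\ forall t M, 0 < t -> t <= r ->
    approximates U (ad U U S) K M t -> simple M.
  apply: simple_near => // i k; have [h hh] := burnside sU (delta_mx i k).
  by exists h; left.
have [r2 [r20 H2]] := nceval_neq0_near K0 Uf Df.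
pose t := Num.min r (Num.min r1 r2).
have t0 : 0 < t by rewrite !lt_min r0 r10 r20.
have tr : t <= r by rewrite /t ge_min lexx.
have tr1 : t <= r1 by rewrite /t !ge_min lexx !orbT.
have tr2 : t <= r2 by rewrite /t !ge_min lexx !orbT.
have [M [tM aM]] := H t t0 tr; have sM := H1 t M t0 tr1 aM.
exists M; split=> // T hT; apply: NNPP => nT.
have := nceval_intertwines f hT; rewrite Uf mul0mx => /esym h0.
have VT := mulVpmx (simple_row_full sM hT nT).
have TV := mulmxVp (simple_row_free sU hT nT).
case/eqP: (H2 t M t0 tr2 aM); rewrite -[LHS]mul1mx.
have -> : 1%:M = pinvmx T *m T by [].
by rewrite -mulmxA h0 mulmx0.
Qed.

Lemma join_noniso s t u v (U : 'I_p.+1 -> 'M[C]_u) (V : 'I_p.+1 -> 'M[C]_v) :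
  (0 < s)%N -> (0 < t)%N -> typed es s U -> typed es t V -> simple U -> simple V ->
  (forall T, intertwines U V T -> T = 0) ->
  exists (m : nat) (M : 'I_p.+1 -> 'M[C]_m), typed es (s + t) M /\ simple M.
Proof.
move=> s0 t0 tU tV sU sV homUV.
have char0 q : (0 < q)%N -> q%:R != 0 :> C by move=> q0; rewrite pnatr_eq0 -lt0n.
have [B [S]] := transverse_extension char0 size_es dim_gt s0 t0 tU tV sU sV homUV.
set X := block_family U B V => -[tX cX hS units].
have uv0 : (0 < u + v)%N by rewrite addn_gt0; case: sU => ->.
have [r [K [r0 K0 H]]] := typed_near uv0 tX cX hS.
have [r1 [r10 H1]] := simple_near K0 uv0 units.
pose t1 := Num.min r r1.
have t10 : 0 < t1 by rewrite lt_min r0 r10.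
have t1r : t1 <= r by rewrite ge_min lexx.
have t1r1 : t1 <= r1 by rewrite ge_min lexx orbT.
have [M [tM aM]] := H t1 t10 t1r.
by exists (u + v)%N, M; split=> //; apply: (H1 t1).
Qed.

(** If [U] and [V] are isomorphic, [U] is replaced by a nearby simple family [U'] of the same type.
    A map from [V] to [U'] composed with U -> V would be a map from [U] to [U'], so it vanishes. *)
Lemma simple_join s t u v (U : 'I_p.+1 -> 'M[C]_u) (V : 'I_p.+1 -> 'M[C]_v) :
  (0 < s)%N -> (0 < t)%N -> typed es s U -> typed es t V -> simple U -> simple V ->
  exists (m : nat) (M : 'I_p.+1 -> 'M[C]_m), typed es (s + t) M /\ simple M.
Proof.
move=> s0 t0 tU tV sU sV.
have [homUV|/not_all_ex_not[T nT]] := classic (forall T, intertwines U V T -> T = 0).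
  exact: join_noniso s0 t0 tU tV sU sV homUV.
have [hT {}nT] := imply_to_and _ _ nT.
have [U' [tU' sU' homUU']] := another_simple s0 tU sU.
apply: (join_noniso s0 t0 tU' tV sU' sV); apply: simple_hom_sym => // Q hQ.
have := homUU' _ (intertwines_comp hT hQ).
have TV := mulVpmx (simple_row_full sV hT nT) => TQ0.
by rewrite -[Q]mul1mx -TV -mulmxA TQ0 mulmx0.
Qed.

Variables (g n : nat).
Hypothesis subtyped : forall m (X : 'I_p.+1 -> 'M[C]_m), semisimple_family es X ->
  (0 < m < n)%N ->
  (forall j, char_poly (X j) %| (\prod_(a <- es j) ('X - a%:P)) ^+ g) ->
  exists2 s, (0 < s < g)%N & typed es s X.

Lemma typed_simple s m (X : 'I_p.+1 -> 'M[C]_m) : (0 < s)%N -> (s <= g)%N -> (0 < m)%N ->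
  (m <= n)%N -> typed es s X ->
  exists (m' : nat) (M : 'I_p.+1 -> 'M[C]_m'), typed es s M /\ simple M.
Proof.
elim/ltn_ind: m s X => m IH s X s0 sg m0 mn tX.
have [sX|nX] := classic (simple X); first by exists m, X.
have [k [W [sW W0 Wm]]] := not_simple m0 nX.
have [y [x [P [P' [Y [B [Z [hx yx [PP' P'P] hM _]]]]]]]] := stable_block sW.
have [hY hZ hc _] := semisimple_split yx tX.1 PP' hM.
have dvd j : char_poly (X j) %| (\prod_(a <- es j) ('X - a%:P)) ^+ g.
  by rewrite tX.2 dvdp_exp2l.
have [s1 /andP[s10 _] tY] : exists2 s, (0 < s < g)%N & typed es s Y.
  by apply: subtyped => // [|j]; [lia|apply: dvdp_trans (dvd j); rewrite hc dvdp_mulr].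
have [s2 /andP[s20 _] tZ] : exists2 s, (0 < s < g)%N & typed es s Z.
  by apply: subtyped => // [|j]; [lia|apply: dvdp_trans (dvd j); rewrite hc dvdp_mull].
have eX := typed_size size_es tX; have eY := typed_size size_es tY.
have eZ := typed_size size_es tZ.
have ss : s = (s1 + s2)%N.
  have b0 : (0 < b)%N by case: (b) eX m0 => //; rewrite muln0 => ->.
  by apply/eqP; rewrite -(eqn_pmul2r b0) mulnDl -eX -eY -eZ yx.
have [||||mY [MY [tMY sMY]]] := IH y _ s1 Y s10 _ _ _ tY; try lia.
have [||||mZ [MZ [tMZ sMZ]]] := IH x _ s2 Z s20 _ _ _ tZ; try lia.
by rewrite ss; apply: simple_join sMY sMZ.
Qed.

End Join.

(** * Dimension of a conjugacy class *)

Section Homogenization.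
Variables (F : fieldType) (A : comNzRingType) (iota : F -> A) (ev : {rmorphism A -> F}).
Hypothesis ev_iota : forall c, ev (iota c) = c.
Variables (k : nat) (Y : 'I_k -> A) (q : A) (x : 'I_k -> F).
Hypothesis evY : forall i, ev (Y i) = ev q * x i.

(** The value [q ^+ h] times [H] at the point [Y / q], written without division. The ring [A] is
    left abstract because both a many-variable chart and a one-variable line are needed. *)
Definition homogenize h (H : {mpoly F[k]}) : A :=
  \sum_(m <- msupp H) iota (H@_m) * ((\prod_i Y i ^+ m i) * q ^+ (h - mdeg m)).

Lemma ev_homogenize h H : (msize H <= h.+1)%N -> ev (homogenize h H) = ev q ^+ h * H.@[x].
Proof.
move=> hH; rewrite /homogenize rmorph_sum mevalE mulr_sumr /=.
rewrite big_seq [RHS]big_seq; apply: eq_bigr => m mH.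
rewrite !rmorphM ev_iota rmorph_prod rmorphXn [RHS]mulrCA; congr (_ * _).
have -> : \prod_i ev (Y i ^+ m i) = ev q ^+ mdeg m * \prod_i x i ^+ m i.
  rewrite mdegE -prodrXr -big_split; apply: eq_bigr => i _.
  by rewrite rmorphXn evY exprMn.
rewrite mulrAC -exprD subnKC //.
by rewrite -ltnS; apply: leq_trans (msize_mdeg_lt mH) hH.
Qed.

Variables (e B h : nat) (f : 'I_e -> {mpoly F[k]}).
Hypothesis hf : forall i, (msize (f i) <= h.+1)%N.

(** The powers of [q] pad all monomials with exponents below [B] to the common denominator
    [q ^+ (h * B * e)], so that they can be combined linearly. *)
Definition box_monomial (m : {ffun 'I_e -> 'I_B}) : A :=
  \prod_i (homogenize h (f i) ^+ m i * q ^+ (h * (B - m i))).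

Definition box_poly (c : {ffun {ffun 'I_e -> 'I_B} -> F}) : {mpoly F[e]} :=
  \sum_m c m *: 'X_[[multinom (m i : nat) | i < e]].

Lemma ev_box_sum (c : {ffun {ffun 'I_e -> 'I_B} -> F}) : ev (\sum_m iota (c m) * box_monomial m) =
  ev q ^+ (h * B * e) * (box_poly c).@[fun i => (f i).@[x]].
Proof.
rewrite rmorph_sum /box_poly [meval _ _]raddf_sum /= mulr_sumr; apply: eq_bigr => m _.
rewrite rmorphM ev_iota mevalZ mevalX [RHS]mulrCA; congr (_ * _).
have -> : ev q ^+ (h * B * e) = \prod_(i < e) ev q ^+ (h * B).
  by rewrite prodr_const card_ord exprM.
rewrite /box_monomial rmorph_prod -big_split /=; apply: eq_bigr => i _.
rewrite rmorphM !rmorphXn ev_homogenize // exprMn mnmE mulrAC; congr (_ * _).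
by rewrite -!exprM -exprD -mulnDr subnKC // ltnW.
Qed.

Lemma box_poly_eq0 (c : {ffun {ffun 'I_e -> 'I_B} -> F}) : box_poly c = 0 -> c = 0.
Proof.
move=> c0; apply/ffunP => m; rewrite ffunE.
have := congr1 (mcoeff [multinom (m i : nat) | i < e]) c0.
rewrite mcoeff0 /box_poly raddf_sum /= (bigD1 m) //= big1 => [|m' nm].
  by rewrite mcoeffZ mcoeffX eqxx mulr1 addr0.
rewrite mcoeffZ mcoeffX; case: eqP => [/mnmP mm|]; last by rewrite mulr0.
case/eqP: nm; apply/ffunP => i; apply: val_inj.
by have := mm i; rewrite !mnmE.
Qed.

End Homogenization.

Lemma msizeM_add (F : fieldType) N (a b : {mpoly F[N]}) : (msize (a * b) <= msize a + msize b)%N.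
Proof.
have [->|a0] := eqVneq a 0; first by rewrite mul0r msize0.
have [->|b0] := eqVneq b 0; first by rewrite mulr0 msize0.
by rewrite msizeM // leq_pred.
Qed.

Lemma msizeX_exp (F : fieldType) N (a : {mpoly F[N]}) k : (msize (a ^+ k) <= k * msize a + 1)%N.
Proof.
elim: k => [|k IH]; first by rewrite expr0 msize1.
rewrite exprS; apply: leq_trans (msizeM_add _ _) _; rewrite mulSn -addnA leq_add2l.
exact: IH.
Qed.

Lemma msize_prod (F : fieldType) N (I : finType) (E : I -> {mpoly F[N]}) K :
  (forall i, (msize (E i) <= K)%N) -> (msize (\prod_i E i) <= #|I| * K + 1)%N.
Proof.
move=> hE; rewrite cardE /index_enum -enumT; elim: (enum I) => [|i s IH].
  by rewrite big_nil msize1.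
rewrite big_cons; apply: leq_trans (msizeM_add _ _) _.
by rewrite mulSn -addnA leq_add.
Qed.

(** There are [B ^ e] unknown coefficients, while at most [(B * k + 1) ^ N] monomials can occur. The
    latter is at most [B ^ N * (k + 1) ^ N], less than [B ^ N.+1], so a nonzero relation exists. *)
Lemma box_relation (F : fieldType) N e k B (W : {ffun 'I_e -> 'I_B} -> {mpoly F[N]}) :
  (N < e)%N -> ((k + 1) ^ N < B)%N -> (forall m, (msize (W m) <= B * k + 1)%N) ->
  exists2 c : {ffun {ffun 'I_e -> 'I_B} -> F}, c != 0 & \sum_m (c m)%:MP * W m = 0.
Proof.
move=> Ne Bk hW.
pose T := {ffun {ffun 'I_N -> 'I_(B * k + 1)} -> F^o}.
pose f (c : {ffun {ffun 'I_e -> 'I_B} -> F^o}) : T :=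
  [ffun r : {ffun 'I_N -> 'I_(B * k + 1)} => (\sum_m (c m : F)%:MP * W m)@_[multinom (r i : nat) | i < N]].
have flin : linear f.
  move=> x u v; apply/ffunP => r; rewrite !ffunE.
  have -> : \sum_m ((x *: u + v) m : F)%:MP * W m =
     x *: (\sum_m (u m : F)%:MP * W m) + \sum_m (v m : F)%:MP * W m.
    rewrite scaler_sumr -big_split; apply: eq_bigr => m _ /=.
    by rewrite !ffunE mpolyCD mulrDl mpolyCM -mul_mpolyC mulrA.
  by rewrite mcoeffD mcoeffZ.
pose fL : {linear _ -> T} := HB.pack f (GRing.isLinear.Build _ _ _ _ f flin).
have dT : dim T = ((B * k + 1) ^ N)%N.
  by rewrite -[RHS]muln1 -[in RHS](card_ord (B * k + 1)) -[in X in (_ ^ X)%N](card_ord N) -card_ffun.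
have dS : dim {ffun {ffun 'I_e -> 'I_B} -> F^o} = (B ^ e)%N.
  by rewrite -[RHS]muln1 -[in RHS](card_ord B) -[in X in (_ ^ X)%N](card_ord e) -card_ffun.
have mono x y : (x <= y)%N -> (x ^ N <= y ^ N)%N.
  by move=> xy; elim: (N) => // l IH; rewrite !expnS leq_mul.
have lt : ((B * k + 1) ^ N < B ^ e)%N.
  have B0 : (0 < B)%N by apply: leq_trans Bk.
  apply: (@leq_trans (B ^ N.+1)); last by apply: leq_pexp2l.
  rewrite expnS; apply: (@leq_ltn_trans ((B * (k + 1)) ^ N)).
    by apply: mono; rewrite mulnDr muln1 leq_add2l.
  by rewrite expnMn mulnC ltn_pmul2r // expn_gt0 B0.
have : lker (linfun fL) != 0%VS.
  apply: contraTneq lt => k0; rewrite -leqNgt -dS -dT -dimvf -(limg_ker_dim (linfun fL)).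
  by rewrite k0 capv0 dimv0 add0n -(@dimvf _ T) dimvS ?subvf.
rewrite -subv0 => /subvPn[c]; rewrite memv_ker (lfunE fL) memv0 => /eqP hc nc.
exists c => //; apply/mpolyP => r; rewrite mcoeff0.
have [small|/forallPn[i hi]] := boolP [forall i, (r i < B * k + 1)%N].
  have := congr1 (fun w : T => w [ffun i => Ordinal (forallP small i)]) hc.
  rewrite /= ffunE [RHS]ffunE => <-; congr (mcoeff _ _).
  by apply/mnmP => i; rewrite mnmE ffunE.
apply: memN_msupp_eq0; apply: msize_mdeg_ge.
apply: leq_trans (_ : (B * k + 1 <= _)%N).
  apply: leq_trans (msize_sum _ _ _) _; apply/bigmax_leqP => m _.
  apply: leq_trans (hW m); rewrite -mul_mpolyC || idtac; rewrite mul_mpolyC.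
  exact: msizeZ_le.
rewrite -leqNgt in hi; apply: leq_trans hi _; rewrite mdegE (bigD1 i) //=.
exact: leq_addr.
Qed.

Lemma poly_eq0_infinite (F : numFieldType) (P : {poly F}) : (forall x, P.[x] = 0) -> P = 0.
Proof.
move=> hP; apply/eqP/negPn/negP => nP.
have := @max_poly_roots _ P [seq i%:R | i <- iota 0 (size P)] nP.
rewrite size_map size_iota ltnn => H; apply: notF; apply: H.
  by apply/allP => x _; apply/eqP/hP.
rewrite map_inj_uniq ?iota_uniq // => i j /eqP; rewrite eqr_nat => /eqP; exact.
Qed.

Section ClassDimensionUpper.
Variables (F : numFieldType) (n : nat) (a : 'I_n -> F).
Let D : 'M[F]_n := diag_mx (\row_i a i).
Let moved := {ik : 'I_n * 'I_n | a ik.1 != a ik.2}.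
Local Notation N := #|{: moved}|.

(* Generic conjugating matrix: one variable for each pair of distinct diagonal
   entries. *)
Let chart : 'M[{mpoly F[N]}]_n := \matrix_(i, k)
  if insub (i, k) is Some y then 'X_(enum_rank (y : moved)) else (i == k)%:R%:MP.

Let evm (y : 'I_N -> F) : {rmorphism {mpoly F[N]} -> F} := meval y.

Lemma chart_eval (L : 'M[F]_n) : (forall i k, a i = a k -> L i k = (i == k)%:R) ->
  exists y, map_mx (evm y) chart = L.
Proof.
move=> hL; exists (fun j => L (val (enum_val j)).1 (val (enum_val j)).2).
apply/matrixP => i k; rewrite !mxE; case: insubP => [y _ hy|].
  by rewrite /= mevalXU enum_rankK hy.
by rewrite negbK => /eqP/hL ->; rewrite /= mevalC.
Qed.

(** The adjugate replaces the inverse, which makes the conjugate a fraction with denominator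
    [\det G], as homogenization requires. *)
Lemma mxvec_conj (A : comNzRingType) (ev : {rmorphism A -> F}) (iota : F -> A) (G : 'M[A]_n) :
  (forall c, ev (iota c) = c) -> map_mx ev G \in unitmx -> forall i,
  ev (mxvec (G *m map_mx iota D *m \adj G) 0 i) = ev (\det G) *
    mxvec (map_mx ev G *m D *m invmx (map_mx ev G)) 0 i.
Proof.
move=> ei uG i; have -> : ev (\det G) = \det (map_mx ev G) by rewrite det_map_mx.
have dG : \det (map_mx ev G) != 0 by rewrite -unitfE -unitmxE.
have -> : map_mx ev G *m D *m invmx (map_mx ev G) =
    (\det (map_mx ev G))^-1 *: map_mx ev (G *m map_mx iota D *m \adj G).
  rewrite !map_mxM map_mx_adj /invmx uG scalemxAr; congr (_ *m _ *m _).
  by apply/matrixP => j l; rewrite !mxE; case: eqP => // _; rewrite ?mulr1n ei.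
case/mxvec_indexP: i => j l; rewrite !mxvecE [X in _ = _ * X]mxE mulVKf // [RHS]mxE.
exact: erefl.
Qed.

(** More than [N] functions satisfy a polynomial relation on the image of the chart. A matrix [g]
    whose part [be] on coinciding eigenvalues is invertible gives the same conjugate as a chart
    point, since [be] commutes with [D]. A line from [g] to the identity extends the relation to
    every invertible [g]. *)
Lemma class_dimension_upper e (f : 'I_e -> {mpoly F[n * n]}) :
  (forall P : {mpoly F[e]}, (forall g, g \in unitmx ->
     P.@[fun i => (f i).@[mxvec (g *m D *m invmx g) 0]] = 0) -> P = 0) ->
  (e <= N)%N.
Proof.
move=> indep; rewrite leqNgt; apply/negP => Ne.
pose h := (\sum_i msize (f i))%N.
have hf i : (msize (f i) <= h.+1)%N by rewrite leqW // /h (bigD1 i) //= leq_addr.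
pose Yc i := mxvec (chart *m map_mx (@mpolyC N F) D *m \adj chart) 0 i.
pose qc := \det chart.
pose Fi i := homogenize (@mpolyC N F) Yc qc h (f i).
pose K1 := (\sum_i msize (Fi i) + msize qc)%N.
(* [kap] is chosen so that the size of each box monomial grows at most like [B * kap], uniformly in
   [B]; only then is [B] fixed, large with respect to [kap]. *)
pose kap := (e * (h.+1 * K1 + 2))%N.
pose B := ((kap + 1) ^ N).+1.
pose W (m : {ffun 'I_e -> 'I_B}) := box_monomial (@mpolyC N F) Yc qc h f m.
have hW m : (msize (W m) <= B * kap + 1)%N.
  have -> : (B * kap = #|'I_e| * (B * (h.+1 * K1 + 2)))%N by rewrite card_ord /kap mulnCA.
  apply: msize_prod => i; apply: leq_trans (msizeM_add _ _) _.
  apply: leq_trans (leq_add (msizeX_exp _ _) (msizeX_exp _ _)) _.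
  have FK : (msize (Fi i) <= K1)%N by rewrite /K1 (bigD1 i) //= -addnA leq_addr.
  have qK : (msize qc <= K1)%N by rewrite /K1 leq_addl.
  have mB : (m i <= B)%N by rewrite ltnW.
  have e1 : (m i * msize (Fi i) <= B * K1)%N by rewrite leq_mul.
  have e2 : (h * (B - m i) * msize qc <= h * B * K1)%N.
    by rewrite leq_mul // leq_mul // leq_subr.
  apply: leq_trans (leq_add (leq_add e1 (leqnn 1)) (leq_add e2 (leqnn 1))) _.
  have B1 : (0 < B)%N by [].
  rewrite mulnDr mulSn mulnDr mulnCA mulnA; lia.
have [c nc hc] := box_relation Ne (ltnSn _) hW.
have van (L : 'M[F]_n) : L \in unitmx -> (forall i k, a i = a k -> L i k = (i == k)%:R) ->
    (box_poly c).@[fun i => (f i).@[mxvec (L *m D *m invmx L) 0]] = 0.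
  move=> uL hL; have [y hy] := chart_eval hL.
  have evC x : evm y (@mpolyC N F x) = x by rewrite /= mevalC.
  have uy : map_mx (evm y) chart \in unitmx by rewrite hy.
  have hY := mxvec_conj evC uy.
  have := ev_box_sum evC hY hf c; rewrite hc rmorph0 => /esym/eqP.
  rewrite mulf_eq0 expf_eq0 -det_map_mx hy; case/orP => [/andP[_]|/eqP//].
  by move/eqP => d0; move: uL; rewrite unitmxE d0 unitr0.
have beta_van (g : 'M[F]_n) : g \in unitmx ->
    (\matrix_(i, k) (if a i == a k then g i k else 0)) \in unitmx ->
    (box_poly c).@[fun i => (f i).@[mxvec (g *m D *m invmx g) 0]] = 0.
  move=> ug; set be := \matrix_(i, k) _ => ub.
  have beD : be *m D = D *m be.
    apply/matrixP => i k; rewrite mul_mx_diag mul_diag_mx !mxE.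
    by case: eqP => [->|_]; [rewrite mulrC|rewrite mul0r mulr0].
  have biD : invmx be *m D = D *m invmx be.
    by apply: (can_inj (mulKmx ub)); rewrite mulKVmx // mulmxA beD mulmxK.
  have bi0 i k : a i != a k -> invmx be i k = 0.
    move=> ik; have /matrixP/(_ i k) := biD; rewrite mul_mx_diag mul_diag_mx !mxE => /eqP.
    by rewrite [a i * _]mulrC -subr_eq0 -mulrBr mulf_eq0 subr_eq0 [a k == _]eq_sym (negPf ik) orbF => /eqP.
  have [L LE] : exists L, L = g *m invmx be by exists (g *m invmx be).
  have uL : L \in unitmx by rewrite LE unitmx_mul ug unitmx_inv.
  have -> : g *m D *m invmx g = L *m D *m invmx L.
    have gE : g = L *m be by rewrite LE mulmxKV.
    apply: (can_inj (mulmxK ug)); rewrite mulmxKV //.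
    rewrite [X in X *m D]gE [X in _ = _ *m X]gE -!mulmxA beD mulKmx //.
  apply: van => // i k ik.
  (* Where eigenvalues coincide [g - be] vanishes, and [invmx be] has entries only there, so the
     correction to the identity vanishes at such positions, as the chart demands. *)
  have -> : L = 1%:M + (g - be) *m invmx be by rewrite LE mulmxBl mulmxV // addrC subrK.
  rewrite mxE [1%:M i k]mxE mxE big1 ?addr0 // => l _.
  have [il|il] := eqVneq (a i) (a l).
    by rewrite !mxE il eqxx subrr mul0r.
  by rewrite [X in _ * X]bi0 ?mulr0 // -ik eq_sym.
case/eqP: nc; apply: (@box_poly_eq0 F e B); apply: indep => g ug.
(* The line is [g] at 0 and the identity at 1. At 1 both [\det G] and [\det bG] equal 1, so they are
   nonzero polynomials; [psi] times them vanishes at every point, hence [psi = 0], and 0 is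
   substituted. *)
pose G : 'M[{poly F}]_n := (1 - 'X) *: map_mx polyC g + 'X%:M.
pose bG : 'M[{poly F}]_n := \matrix_(i, k) (if a i == a k then G i k else 0).
pose ev x : {rmorphism {poly F} -> F} := horner_eval x.
have evG x : map_mx (ev x) G = (1 - x) *: g + x%:M.
  apply/matrixP => i k; rewrite !mxE /= /horner_eval hornerD hornerM hornerD hornerN.
  by rewrite hornerMn !hornerX !hornerC.
have evb x : map_mx (ev x) bG = \matrix_(i, k) (if a i == a k then (map_mx (ev x) G) i k else 0).
  apply/matrixP => i k; rewrite !mxE; case: (a i == a k); rewrite ?mxE //.
  by rewrite /= /horner_eval horner0.
pose Yg i := mxvec (G *m map_mx polyC D *m \adj G) 0 i.
pose psi : {poly F} := \sum_m (c m)%:P * box_monomial polyC Yg (\det G) h f m.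
have evC x b : ev x b%:P = b by rewrite /= /horner_eval hornerC.
have evpsi x : map_mx (ev x) G \in unitmx ->
    ev x psi = ev x (\det G) ^+ (h * B * e) * (box_poly c).@[fun i =>
     (f i).@[mxvec (map_mx (ev x) G *m D *m invmx (map_mx (ev x) G)) 0]].
  by move=> uG; apply: (ev_box_sum (evC x) (mxvec_conj (evC x) uG) hf).
have psi0 : psi = 0.
  have : psi * \det G * \det bG = 0.
    apply: poly_eq0_infinite => x; rewrite -/(horner_eval x _) -/(ev x _ : F).
    rewrite !rmorphM; have [d0|dG] := eqVneq (ev x (\det G)) 0; first by rewrite d0 mulr0 mul0r.
    have [d0|db] := eqVneq (ev x (\det bG)) 0; first by rewrite d0 mulr0.
    have uG : map_mx (ev x) G \in unitmx by rewrite unitmxE unitfE det_map_mx.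
    rewrite evpsi // beta_van ?mulr0 ?mul0r // -evb.
    by rewrite unitmxE unitfE det_map_mx.
  move/eqP; rewrite !mulf_eq0 => /orP[/orP[/eqP//|]|] /eqP d0; exfalso.
    have := congr1 (ev 1) d0; rewrite rmorph0 -det_map_mx evG subrr scale0r add0r det1.
    by move/eqP; rewrite oner_eq0.
  have := congr1 (ev 1) d0; rewrite rmorph0 -det_map_mx evb evG subrr scale0r add0r.
  have -> : \matrix_(i, k) (if a i == a k then (1%:M : 'M[F]_n) i k else 0) = 1%:M.
    apply/matrixP => i k; rewrite !mxE; case: (eqVneq i k) => [->|_]; first by rewrite eqxx.
    by case: eqP.
  by rewrite det1 => /eqP; rewrite oner_eq0.
have G0 : map_mx (ev 0) G = g by rewrite evG subr0 scale1r raddf0 addr0.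
have := evpsi 0; rewrite psi0 rmorph0 G0 => /(_ ug)/esym/eqP.
rewrite mulf_eq0 expf_eq0 -det_map_mx G0; case/orP => [/andP[_]|/eqP//].
by move/eqP => d0; move: ug; rewrite unitmxE d0 unitr0.
Qed.

End ClassDimensionUpper.

Lemma digits_inj N B (f g : 'I_N -> nat) : (forall i, f i < B)%N -> (forall i, g i < B)%N ->
  (\sum_i f i * B ^ i = \sum_i g i * B ^ i)%N -> f =1 g.
Proof.
elim: N f g => [|N IH] f g hf hg; first by move=> _ [].
have expand (u : 'I_N.+1 -> nat) : (\sum_i u i * B ^ i = \sum_(i < N) u (lift ord0 i) * B ^ i * B + u ord0)%N.
  rewrite big_ord_recl expn0 muln1 addnC; congr (_ + _)%N.
  by apply: eq_bigr => i _; rewrite /= /bump add1n expnSr mulnA.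
rewrite !expand -!big_distrl /= => h.
have h0 : f ord0 = g ord0.
  by have := congr1 (modn^~ B) h; rewrite /= !modnMDl !modn_small.
move: h; rewrite h0 => /addIn /eqP; rewrite eqn_mul2r => /orP[/eqP B0|/eqP h].
  by have := hf ord0; rewrite B0.
have {}IH := IH (fun i => f (lift ord0 i)) (fun i => g (lift ord0 i)) (fun i => hf _) (fun i => hg _) h.
by move=> i; case: (unliftP ord0 i) => [j|] -> //; apply: IH.
Qed.

Section ClassDimensionLower.
Variable R : realType.
Local Notation C := R[i].
Local Notation normc := ComplexField.Normc.normc.

(* The Kronecker substitution [x_i := z ^ (B ^ i)] reduces to one variable. *)
Lemma mpoly_eq0_ball N (P : {mpoly C[N]}) (r : R) : 0 < r ->
  (forall x : 'I_N -> C, (forall i, normc (x i) <= r) -> P.@[x] = 0) -> P = 0.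
Proof.
move=> r0 hP; pose B := msize P.
pose ex (m : 'X_{1..N}) := (\sum_(i < N) m i * B ^ i)%N.
pose Q : {poly C} := \sum_(m <- msupp P) P@_m *: 'X^(ex m).
have mB m i : m \in msupp P -> (m i < B)%N.
  move=> /msize_mdeg_lt; apply: leq_ltn_trans; rewrite mdegE (bigD1 i) //=.
  exact: leq_addr.
have QE z : Q.[z] = P.@[fun i => z ^+ (B ^ i)].
  rewrite /Q horner_sum mevalE; apply: eq_bigr => m _.
  rewrite hornerZ hornerXn /ex -prodrXr; congr (_ * _); apply: eq_bigr => i _.
  by rewrite -exprM mulnC.
pose c := Num.min r 1.
have c0 : 0 < c by rewrite lt_min r0 ltr01.
have Q0 : Q = 0.
  apply/eqP/negPn/negP => nQ.
  (* Infinitely many distinct points, of modulus at most 1 so that their positive powers stay in the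
     ball. *)
  pose z k : C := (c / k.+1%:R)%:C.
  have zc k : normc (z k) <= c.
    rewrite normc_real ger0_norm; last by rewrite divr_ge0 // ltW.
    rewrite ler_pdivrMr ?ltr0n //; apply: ler_peMr; [exact: ltW|by rewrite ler1n].
  have := @max_poly_roots _ Q [seq z i | i <- iota 0 (size Q)] nQ.
  rewrite size_map size_iota ltnn => H; apply: notF; apply: H.
    apply/allP => _ /mapP[k _ ->]; rewrite /root QE hP // => i.
    case PB : B => [|B'].
      move: PB; rewrite /B => /eqP; rewrite msize_poly_eq0 => /eqP P0.
      by move: nQ; rewrite /Q P0 msupp0 big_nil eqxx.
    have : (0 < B'.+1 ^ i)%N by rewrite expn_gt0.
    case: (_ ^ _)%N => // l _.
    have z1 : normc (z k) <= 1 by apply: le_trans (zc k) _; rewrite ge_min lexx orbT.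
    have nX j : normc (z k ^+ j) <= 1.
      elim: j => [|j IH]; first by rewrite expr0 ComplexField.Normc.normc1.
      by rewrite exprS ComplexField.Normc.normcM mulr_ile1 ?normc_ge0.
    rewrite exprS ComplexField.Normc.normcM; apply: (@le_trans _ _ (normc (z k))).
      by apply: ler_piMr; [apply: normc_ge0|apply: nX].
    by apply: le_trans (zc k) _; rewrite ge_min lexx.
  rewrite map_inj_uniq ?iota_uniq // => i j /(congr1 (@complex.Re R)) /=.
  have nc : c != 0 by rewrite gt_eqF.
  by move/(mulfI nc)/invr_inj/eqP; rewrite eqr_nat eqSS => /eqP.
apply/mpolyP => m; rewrite mcoeff0; apply/eqP/negPn/negP; rewrite -mcoeff_msupp => hm.
have : Q`_(ex m) = P@_m.
  rewrite /Q coef_sum (bigD1_seq m) //= ?msupp_uniq // coefZ coefXn eqxx mulr1.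
  rewrite big_seq_cond big1 ?addr0 // => m' /andP[hm' nm].
  rewrite coefZ coefXn; case: eqP => [e|]; last by rewrite mulr0.
  case/eqP: nm; apply/mnmP => i; apply/esym/(digits_inj _ _ e) => j; exact: mB.
by rewrite Q0 coef0 => h; move: hm; rewrite mcoeff_msupp -h eqxx.
Qed.

Variables (n : nat) (a : 'I_n -> C).
Let D : 'M[C]_n := diag_mx (\row_i a i).
Let moved := {ik : 'I_n * 'I_n | a ik.1 != a ik.2}.
Local Notation N := #|{: moved}|.

Let off_diag (Z : 'M[C]_n) : 'M[C]_n := \matrix_(i, k) (if a i == a k then 0 else Z i k).

Lemma off_diag_linear : linear off_diag.
Proof.
move=> x u v; apply/matrixP => i k; rewrite !mxE.
by case: (a i == a k); rewrite ?mulr0 ?addr0.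
Qed.

(** A right inverse, on the positions with distinct eigenvalues, of the derivative [T |-> T D - D T]
    of conjugation, which multiplies the entry [(i, k)] by [a k - a i]. Elsewhere the inverse of 0
    is 0. *)
Let solve (Z : 'M[C]_n) : {ffun 'I_1 -> 'M[C]_n} :=
  [ffun=> \matrix_(i, k) ((a k - a i)^-1 * Z i k)].

Lemma solve_linear : linear solve.
Proof.
move=> x u v; apply/ffunP => j; rewrite !ffunE; apply/matrixP => i k; rewrite !mxE.
by rewrite mulrDr mulrCA.
Qed.

(** By [strict_solve], applied to one matrix and projected to the positions with distinct
    eigenvalues, these entries of a conjugate of [D] take all sufficiently small values; a
    polynomial vanishing on them vanishes on a ball. *)
Lemma class_dimension_lower : exists f : 'I_N -> {mpoly C[n * n]},
  forall P : {mpoly C[N]}, (forall g, g \in unitmx ->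
    P.@[fun j => (f j).@[mxvec (g *m D *m invmx g) 0]] = 0) -> P = 0.
Proof.
exists (fun j => 'X_(mxvec_index (val (enum_val j)).1 (val (enum_val j)).2)) => P hP.
pose pr : {linear 'M[C]_n -> 'M[C]_n} := HB.pack off_diag
  (GRing.isLinear.Build _ _ _ _ off_diag off_diag_linear).
pose G : {linear 'M[C]_n -> {ffun 'I_1 -> 'M[C]_n}} := HB.pack solve
  (GRing.isLinear.Build _ _ _ _ solve solve_linear).
pose X (_ : 'I_1) := D.
have [|||r [K [r0 K0 H]]] := @strict_solve R 1 n _ _ _ pr G (strict_conj X ord0).
- by move=> T T'; rewrite (raddfB (ad X X)) ffunE [X in _ + X]ffunE opprD.
- by move=> Z; apply/matrixP => i k; rewrite !mxE; case: (a i == a k).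
- move=> Z; rewrite ad_apply opprB /X mul_mx_diag mul_diag_mx /= /solve ffunE.
  apply/matrixP => i k; rewrite !mxE; case: eqP => // /eqP ne.
  have nz : a k - a i != 0 by rewrite subr_eq0 eq_sym.
  have -> : (a k - a i)^-1 * Z i k * a k - a i * ((a k - a i)^-1 * Z i k) =
    (a k - a i) * ((a k - a i)^-1 * Z i k) by ring.
  by rewrite mulVKf.
pose M : R := n%:R * n%:R; have M0 : 0 <= M by apply: mulr_ge0.
have Mr0 : 0 <= M / r by rewrite divr_ge0 // ltW.
have KM0 : 0 <= K * M by apply: mulr_ge0.
pose s := M / r + 2 * (K * M) + 1.
have s0 : 0 < s by rewrite /s; lra.
apply: (@mpoly_eq0_ball _ _ s^-1); first by rewrite invr_gt0.
move=> x hx.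
pose y : 'M[C]_n := \matrix_(i, k) if insub (i, k) is Some z then x (enum_rank (z : moved)) else 0.
have yM : mxnorm y <= M * s^-1.
  apply: (@le_trans _ _ (\sum_(i < n) \sum_(k < n) s^-1)).
    apply: ler_sum => i _; apply: ler_sum => k _; rewrite mxE.
    case: insubP => [z _ _|_]; first exact: hx.
    by rewrite ComplexField.Normc.normc0 invr_ge0 ltW.
  by rewrite !sumr_const !card_ord -mulrnA -[leLHS]mulr_natl natrM.
have small b : 0 <= b -> b <= s -> b * s^-1 <= 1.
  by move=> b0 bs; rewrite ler_pdivrMr // mul1r.
have [||T hT dT] := H 0 y.
- by rewrite famnorm0 ltW.
- apply: le_trans yM _.
  have : M / r * s^-1 <= 1 by apply: small => //; rewrite /s; lra.
  by rewrite mulrAC ler_pdivrMr // mul1r.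
have T2 : famnorm T <= 2^-1.
  move: dT; rewrite subr0 (raddf0 (ad X X)) ffunE oppr0 subr0 famnorm0 expr0n addr0.
  move/le_trans; apply; apply: (@le_trans _ _ (K * (M * s^-1))).
    exact: ler_wpM2l.
  have : 2 * (K * M) * s^-1 <= 1 by apply: small; rewrite /s; lra.
  by rewrite -!mulrA; lra.
have ug : 1%:M + T ord0 \in unitmx.
  by apply: unitmx_near1; apply: le_trans (famnorm_comp T ord0) T2.
rewrite -[RHS](hP _ ug); apply: meval_eq => j.
rewrite mevalXU mxvecE; case: (enum_val j) (enum_valK j) => -[i k] /= ik jE.
have e : ((1%:M + T ord0) *m D *m invmx (1%:M + T ord0)) i k = x j.
  have /matrixP/(_ i k) := hT; rewrite /= [LHS]mxE [RHS]mxE (negPf ik).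
  rewrite /conj_family /X => ->; rewrite !mxE.
  have -> : (i == k) = false by apply: (contraNF _ ik) => /eqP->.
  by rewrite mulr0n add0r (@insubT _ (fun u : 'I_n * 'I_n => a u.1 != a u.2) _ (i, k) ik) -jE.
by rewrite e.
Qed.

End ClassDimensionLower.

(** * Eigenvalues of the classes *)

Section Irreducible.
Variables (F : fieldType) (p n : nat) (M : 'I_p.+1 -> 'M[F]_n).

(** Irreducibility is stated for columns and simplicity for rows. The rows annihilating a stable
    space of columns form a stable row space, and the trace pairing recovers the columns. *)
Lemma simple_irreducible : simple M -> irreducible_tuple M.
Proof.
move=> [n0 sM] U sU.
have [||k [W hW]] := @subspace_rowspace F n (fun w => forall u, u \in U -> w *m u = 0).
- by move=> u _; rewrite mul0mx.
- by move=> a x y hx hy u Uu; rewrite mulmxDl -scalemxAl hx // hy // scaler0 addr0.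
case: (sM _ W) => [j|W0|fW].
- apply/row_subP => i; apply/hW => u Uu; rewrite row_mul -mulmxA.
  by apply: ((hW (row i W)).2 (row_sub i W)); apply: sU.
- right; apply/vspaceP => v; rewrite memvf; apply: (@trace_dual F n 1 (fun v => v \in U)).
  + exact: mem0v.
  + by move=> a x y Ux Uy; apply: memvD Uy; apply: memvZ.
  move=> S hS; have : (S <= W)%MS.
    apply/hW => u Uu; apply/matrixP => i j; rewrite !ord1 [RHS]mxE.
    by have := hS u Uu; rewrite /mxtrace big_ord1.
  by rewrite W0 => /submx0null.
left; apply/vspaceP => v; rewrite memv0; apply/idP/eqP => [Uv|->]; last exact: mem0v.
apply/row_matrixP => i; rewrite row0 rowE.
by apply: ((hW (delta_mx 0 i)).2 _ v Uv); rewrite submx_full.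
Qed.

Lemma irreducible_simple : (0 < n)%N -> irreducible_tuple M -> simple M.
Proof.
move=> n0 iM; split=> // k W sW; pose U := lker (linfun (fun v : 'cV[F]_n => W *m v)).
have memU v : (v \in U) = (W *m v == 0) by rewrite memv_ker lfunE.
case: (iM U) => [j v|U0|Ufull].
- rewrite !memU mulmxA => /eqP h; have /submxP[E ->] := sW j.
  by rewrite -mulmxA h mulmx0.
- right; apply: contraT => nW.
  have : kermx W^T != 0 by rewrite kermx_eq0 /row_free mxrank_tr.
  case/exists_row_neq0=> i; set u := row i _ => nu.
  have uW : u *m W^T = 0 by apply/sub_kermxP; apply: row_sub.
  have : u^T \in U by rewrite memU -[W]trmxK -trmx_mul uW trmx0.
  by rewrite U0 memv0 -trmx0 (inj_eq trmx_inj) (negPf nu).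
left; apply/matrixP => i j; rewrite [RHS]mxE.
have : delta_mx j 0 \in U by rewrite Ufull memvf.
by rewrite memU -colE => /eqP/matrixP/(_ i 0); rewrite !mxE.
Qed.

End Irreducible.

Lemma annihilated_diagonal (F : fieldType) n (X P : 'M[F]_n) d (rs : seq F) :
  P \in unitmx -> P *m X = diag_mx (\row_i d i) *m P -> (forall i, d i \in rs) ->
  annihilated rs X.
Proof.
move=> uP hP drs.
apply: (@annihilated_conj _ rs _ _ X (diag_mx (\row_i d i)) (invmx P) P).
- by apply: (can_inj (mulKmx uP)); rewrite mulKVmx // mulmxA hP mulmxK.
- exact: mulVmx.
rewrite /annihilated.
have prodE l : \prod_(a <- l) (diag_mx (\row_i d i) - a%:M) =
    diag_mx (\row_i \prod_(a <- l) (d i - a)).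
  elim: l => [|a l IH].
    by rewrite big_nil; apply/matrixP => i j; rewrite !mxE big_nil.
  rewrite big_cons IH; have -> : diag_mx (\row_i d i) - a%:M = diag_mx (\row_i (d i - a)).
    by apply/matrixP => i j; rewrite !mxE; case: eqP => [->|]; rewrite ?mulr1n ?mulr0n ?subrr.
  rewrite -mulmxE mulmx_diag; congr diag_mx; apply/rowP => i.
  by rewrite !mxE big_cons.
rewrite prodE; apply/matrixP => i j.
by rewrite !mxE (big_rem _ (drs i)) /= subrr mul0r mul0rn.
Qed.

Lemma diagonal_conj_class (F : fieldType) n (X P Y Q : 'M[F]_n) d e :
  P \in unitmx -> P *m X = diag_mx (\row_i d i) *m P ->
  Q \in unitmx -> Q *m Y = diag_mx (\row_i e i) *m Q ->
  perm_eq [seq d i | i <- enum 'I_n] [seq e i | i <- enum 'I_n] -> conj_class X Y.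
Proof.
move=> uP hP uQ hQ de.
have [s hs] : exists s : 'S_n, forall i, d i = e (s i).
  have : perm_eq [tuple d i | i < n] [tuple e i | i < n] by [].
  case/tuple_permP=> s hs; exists s => i.
  have := congr1 (fun t => nth (d i) t i) hs.
  rewrite -[LHS]tnth_nth tnth_mktuple -[RHS]tnth_nth tnth_mktuple tnth_mktuple.
  exact.
pose S : 'M[F]_n := perm_mx s; have uS : S \in unitmx by apply: unitmx_perm.
have DS : diag_mx (\row_i d i) *m S = S *m diag_mx (\row_i e i).
  apply/matrixP => i j; rewrite mul_diag_mx mul_mx_diag !mxE.
  by case: eqP => [<-|_]; rewrite ?mulr0 ?mul0r // hs mulrC.
exists (invmx Q *m invmx S *m P).
  by rewrite !unitmx_mul !unitmx_inv uQ uS uP.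
have uR : invmx Q *m invmx S *m P \in unitmx by rewrite !unitmx_mul !unitmx_inv uQ uS uP.
apply: (can_inj (mulmxK uR)); rewrite mulmxKV // -!mulmxA hP.
apply: (can_inj (mulKmx uQ)); rewrite mulmxA hQ -!mulmxA mulKVmx // mulKVmx //.
apply: (can_inj (mulKmx uS)); rewrite mulKVmx // mulmxA -DS -!mulmxA mulKVmx //.
Qed.

(** Turns a sub-multiset of eigenvalues into an index set, the form in which non-genericity
    relations are stated. *)
Lemma exists_selection (F : comNzRingType) n (sigma : 'I_n -> F) (l : seq F) :
  (forall a, count_mem a l <= #|[set k | sigma k == a]|)%N ->
  exists Phi : {set 'I_n}, [/\ #|Phi| = size l,
    forall a, #|[set k in Phi | sigma k == a]| = count_mem a l &
    \prod_(k in Phi) sigma k = \prod_(a <- l) a].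
Proof.
elim: l => [|b l IH] hl.
  exists finset.set0; rewrite cards0 big_set0 big_nil; split=> // a.
  by apply/eqP; rewrite cards_eq0; apply/eqP/setP => k; rewrite !inE.
have [|Phi [cPhi hPhi pPhi]] := IH.
  by move=> a; apply: leq_trans (hl a); rewrite /= leq_addl.
have [k kPhi kb] : exists2 k, k \notin Phi & sigma k == b.
  apply: NNPP => H; have := hl b; rewrite /= eqxx add1n ltnNge -hPhi => /negP; apply.
  apply: subset_leq_card; apply/fintype.subsetP => k; rewrite !inE => kb; rewrite kb andbT.
  by apply: contraT => kPhi; exfalso; apply: H; exists k.
exists (k |: Phi); split.
- by rewrite cardsU1 kPhi cPhi.
- move=> a; rewrite /= -hPhi; have [ba|ba] := eqVneq b a.
    have -> : [set x in k |: Phi | sigma x == a] = k |: [set x in Phi | sigma x == a].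
      apply/setP => x; rewrite !inE; case: (eqVneq x k) => [->|] //=.
      by rewrite (eqP kb) ba eqxx.
    by rewrite cardsU1 !inE (negPf kPhi).
  rewrite add0n; congr (#|pred_of_set _|); apply/setP => x; rewrite !inE.
  by case: (eqVneq x k) => [->|] //=; rewrite (eqP kb) (negPf ba) andbF.
by rewrite big_setU1 //= big_cons pPhi (eqP kb).
Qed.

(** Equal pairs off the diagonal come in twos, and the diagonal contributes [size l], of the same
    parity as its square. This makes the sum of the [rho_j] even. *)
Lemma odd_coincidences (F : eqType) (l : seq F) :
  odd (\sum_(a <- l) \sum_(b <- l) (a == b)) = odd (size l * size l).
Proof.
elim: l => [|x l IH]; first by rewrite big_nil.
rewrite big_cons big_cons eqxx.
under [X in (_ + X)%N]eq_bigr do rewrite big_cons.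
rewrite big_split.
have -> : (\sum_(a <- l) (a == x) = \sum_(b <- l) (x == b))%N.
  by apply: eq_bigr => a _; rewrite eq_sym.
set c := (\sum_(b <- l) _)%N; set S := (\sum_(a <- l) \sum_(b <- l) _)%N in IH *.
have -> : (1 + c + (c + S) = S + (c.*2).+1)%N by rewrite -addnn; lia.
have -> : (size (x :: l) * size (x :: l) = size l * size l + (size l).*2.+1)%N.
  by rewrite /= -addnn; lia.
by rewrite !oddD /= !odd_double IH.
Qed.

Lemma diagonalizable_spectrum (F : fieldType) n (A : 'M[F]_n) (s : 'I_n -> F) :
  diagonalizable A -> char_poly A = \prod_(k < n) ('X - (s k)%:P) ->
  exists2 P, P \in unitmx & P *m A = diag_mx (\row_i s i) *m P.
Proof.
case=> Q uQ /diagonalizable_forPex[D /(simmxP uQ) hQ] hA.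
have hQ' : Q *m A = diag_mx (\row_i D 0 i) *m Q.
  by rewrite hQ; congr (diag_mx _ *m _); apply/rowP => i; rewrite mxE.
have := hA; rewrite (char_poly_diagonal uQ hQ') => sD.
have u1 : (1%:M : 'M[F]_n) \in unitmx by rewrite unitmx1.
have e1 : 1%:M *m diag_mx (\row_i s i) = diag_mx (\row_i s i) *m 1%:M.
  by rewrite mul1mx mulmx1.
case: (diagonal_conj_class uQ hQ' u1 e1) => [|P uP hP].
  by apply: prod_XsubC_eq; rewrite big_map [RHS]big_map enumT.
by exists P => //; rewrite hP mulmxKV.
Qed.

Lemma dvdp_count_mem (F : fieldType) (s t : seq F) a :
  \prod_(b <- s) ('X - b%:P) %| \prod_(b <- t) ('X - b%:P) ->
  (count_mem a s <= count_mem a t)%N.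
Proof.
case/dvdp_prod_XsubC=> m; rewrite eqp_monic ?monic_prod_XsubC // => /eqP/prod_XsubC_eq st.
by rewrite (seq.permP st); apply/leq_count_subseq/mask_subseq.
Qed.

Lemma det_prod (F : comNzRingType) m (I : Type) (r : seq I) (X : I -> 'M[F]_m) :
  \det (\prod_(i <- r) X i) = \prod_(i <- r) \det (X i).
Proof.
elim: r => [|i r IH]; first by rewrite !big_nil det1.
by rewrite !big_cons -mulmxE det_mulmx IH.
Qed.

Lemma card_moved (F : eqType) n (a : 'I_n -> F) :
  (#|{: {ik : 'I_n * 'I_n | a ik.1 != a ik.2}}| +
   \sum_(i < n) \sum_(k < n) (a i == a k) = n * n)%N.
Proof.
rewrite card_sig pair_big /= -[X in _ = (X * X)%N](card_ord n) -card_prod.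
rewrite -(cardC [pred ik : 'I_n * 'I_n | a ik.1 != a ik.2]); congr (_ + _)%N.
rewrite -sum1_card [RHS]big_mkcond /=; apply: eq_bigr => ik _.
by rewrite !inE negbK; case: eqP.
Qed.

Lemma conj_class_dimension (R : realType) n (A P : 'M[R[i]]_n) (a : 'I_n -> R[i]) d :
  P \in unitmx -> P *m A = diag_mx (\row_i a i) *m P ->
  has_dimension (conj_class A) d ->
  d = #|{: {ik : 'I_n * 'I_n | a ik.1 != a ik.2}}|.
Proof.
move=> uP hP [[f indf] maxd]; apply/eqP; rewrite eqn_leq; apply/andP; split.
  apply: (class_dimension_upper (f := f)) => Q hQ; apply: indf => _ [g ug ->].
  have uh : g *m invmx P \in unitmx by rewrite unitmx_mul unitmx_inv ug.
  have -> : g *m A *m invmx g =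
      (g *m invmx P) *m diag_mx (\row_i a i) *m invmx (g *m invmx P); last exact: hQ.
    apply: (can_inj (mulmxK uh)); rewrite mulmxKV // mulmxA mulmxKV // -!mulmxA.
    by congr (_ *m _); apply: (can_inj (mulKmx uP)); rewrite mulKVmx // mulmxA hP mulmxK.
have [h hh] := class_dimension_lower a.
apply: (maxd _ h) => Q hQ; apply: hh => g ug; apply: hQ.
have uh : g *m P \in unitmx by rewrite unitmx_mul ug.
exists (g *m P) => //; apply: (can_inj (mulmxK uh)).
by rewrite mulmxKV // mulmxA mulmxKV // -!mulmxA hP.
Qed.

(** * Reduced spectra, classes and relative genericity *)

Section ReducedSpectrum.
Variables (F : fieldType) (n p : nat) (sigma : 'I_p.+1 -> 'I_n -> F) (g : nat).
Hypothesis dvd_mult : forall j k, (g %| mult sigma j (sigma j k))%N.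

(** The roots of [chi_j], the [g]-th root of the characteristic polynomial, listed with
    multiplicity. *)
Definition reduced_spectrum j : seq F :=
  flatten [seq nseq (mult sigma j a %/ g) a | a <- undup (codom (sigma j))].

Lemma count_codom j a : count_mem a (codom (sigma j)) = mult sigma j a.
Proof.
rewrite /mult -sum1_card -sum1_count codomE big_map enumT.
by apply: eq_bigl => k; rewrite inE.
Qed.

Lemma count_reduced j a : count_mem a (reduced_spectrum j) = (mult sigma j a %/ g)%N.
Proof.
rewrite /reduced_spectrum count_flatten -map_comp sumnE big_map.
have [au|au] := boolP (a \in undup (codom (sigma j))); last first.
  move: au; rewrite mem_undup => /count_memPn; rewrite count_codom => a0.
  rewrite big1_seq ?a0 ?div0n // => b /andP[_]; rewrite mem_undup => hb /=.
  by rewrite count_nseq /=; case: eqP => [->|//]; rewrite a0 div0n.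
rewrite (bigD1_seq a) ?undup_uniq //= count_nseq /= eqxx mul1n big1 ?addn0 //.
by move=> b /negPf ba; rewrite count_nseq /= ba mul0n.
Qed.

Lemma count_flatten_nseq s (l : seq F) a :
  count_mem a (flatten (nseq s l)) = (s * count_mem a l)%N.
Proof. by rewrite count_flatten map_nseq sumn_nseq mulnC. Qed.

Lemma perm_reduced j : perm_eq (codom (sigma j)) (flatten (nseq g (reduced_spectrum j))).
Proof.
apply/allP => a _; rewrite /= count_flatten_nseq count_reduced count_codom mulnC.
rewrite divnK // -count_codom; have [|/count_memPn -> //] := boolP (a \in codom (sigma j)).
by case/codomP=> k ->; rewrite count_codom.
Qed.

Lemma size_reduced j : (size (reduced_spectrum j) * g = n)%N.
Proof.
have := perm_size (perm_reduced j); rewrite size_codom card_ord.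
by rewrite size_flatten /shape map_nseq sumn_nseq => <-.
Qed.

Lemma prod_spectrum j : \prod_(k < n) ('X - (sigma j k)%:P) =
  (\prod_(a <- reduced_spectrum j) ('X - a%:P)) ^+ g.
Proof.
rewrite -prod_flatten_nseq -(perm_big _ (perm_reduced j)) /= codomE big_map.
by rewrite enumT.
Qed.

Section Classes.
Variables (A P : 'I_p.+1 -> 'M[F]_n).
Hypothesis uP : forall j, P j \in unitmx.
Hypothesis hP : forall j, P j *m A j = diag_mx (\row_i sigma j i) *m P j.

Lemma in_classes_typed M : product_one_in_classes A M -> typed reduced_spectrum g M.
Proof.
case=> hM pM.
have dM j : exists2 Q, Q \in unitmx & Q *m M j = diag_mx (\row_i sigma j i) *m Q.
  have [Q uQ ->] := hM j; exists (P j *m invmx Q).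
    by rewrite unitmx_mul unitmx_inv uQ uP.
  by rewrite !mulmxA mulmxKV // hP.
split; [split=> // j|move=> j]; have [Q uQ hQ] := dM j.
  apply: (annihilated_diagonal uQ hQ) => i; rewrite mem_undup -has_pred1 has_count.
  have : (0 < g * count_mem (sigma j i) (reduced_spectrum j))%N.
    rewrite -count_flatten_nseq -(seq.permP (perm_reduced j)) -has_count has_pred1.
    exact: codom_f.
  by rewrite muln_gt0 => /andP[].
by rewrite (char_poly_diagonal uQ hQ) prod_spectrum.
Qed.

Lemma typed_in_classes M : typed reduced_spectrum g M -> product_one_in_classes A M.
Proof.
move=> tM; have [[_ pM] _] := tM; split=> // j.
have [Q [d [hQ hd]]] := typed_diagonalized tM; have [uQ hQj] := hQ j.
apply: (diagonal_conj_class (uP j) (hP j) uQ hQj).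
by rewrite -codomE (perm_trans (perm_reduced j)) // perm_sym.
Qed.

End Classes.

(** The eigenvalues of the [X j] select index sets of common size [m], and the determinant of the
    product gives the equality to 1. This is a non-genericity relation, hence some multiple [s] of
    gamma-star, which says that the eigenvalues are [s] copies of the reduced spectrum. *)
Lemma generic_subtyped m (X : 'I_p.+1 -> 'M[F]_m) :
  (forall Phi, nongenericity_relation sigma Phi ->
    exists2 s, (1 <= s < g)%N & is_multiple sigma g s Phi) ->
  semisimple_family reduced_spectrum X -> (0 < m < n)%N ->
  (forall j, char_poly (X j) %| (\prod_(a <- reduced_spectrum j) ('X - a%:P)) ^+ g) ->
  exists2 s, (0 < s < g)%N & typed reduced_spectrum s X.
Proof.
move=> hgen hX hm dvdX; have [aX pX] := hX.
have /fin_all_exists[P hP] : forall j, exists Pj, exists d, Pj \in unitmx /\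
    Pj *m X j = diag_mx (\row_i d i) *m Pj.
  by move=> j; apply: annihilated_diag (aX j); apply: undup_uniq.
have /fin_all_exists[d hd] := hP.
pose l j := [seq d j i | i <- enum 'I_m].
have charX j : char_poly (X j) = \prod_(a <- l j) ('X - a%:P).
  by have [uQ hQ] := hd j; rewrite (char_poly_diagonal uQ hQ) big_map enumT.
have /fin_all_exists[Phi hPhi] : forall j, exists Phi : {set 'I_n}, [/\ #|Phi| = size (l j),
    forall a, #|[set k in Phi | sigma j k == a]| = count_mem a (l j) &
    \prod_(k in Phi) sigma j k = \prod_(a <- l j) a].
  move=> j; apply: exists_selection => a; rewrite -[X in (_ <= X)%N]/(mult sigma j a).
  rewrite -count_codom (seq.permP (perm_reduced j)); apply: dvdp_count_mem.
  by rewrite -charX prod_flatten_nseq.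
case: (hgen Phi) => [|s hs hmul].
  split; first by exists m => // j; have [-> _ _] := hPhi j; rewrite size_map size_enum_ord.
  rewrite -[RHS](det1 F m) -pX det_prod; apply: eq_bigr => j _; have [_ _ ->] := hPhi j.
  have [uQ hQ] := hd j; have nQ : \det (P j) != 0 by rewrite -unitfE -unitmxE.
  apply: (mulIf nQ); rewrite [RHS]mulrC -det_mulmx hQ det_mulmx det_diag big_map enumT.
  by congr (_ * _); apply: eq_bigr => i _; rewrite mxE.
exists s => //; split=> // j; rewrite charX -prod_flatten_nseq; apply: perm_big.
have [_ hl _] := hPhi j; apply/allP => a _ /=.
by rewrite -hl hmul count_flatten_nseq count_reduced.
Qed.

Lemma sum_coincidences j :
  (\sum_(i < n) \sum_(k < n) (sigma j i == sigma j k) = g * g *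
    \sum_(a <- reduced_spectrum j) \sum_(b <- reduced_spectrum j) (a == b))%N.
Proof. by apply: count_coincidences; rewrite -codomE perm_reduced. Qed.

End ReducedSpectrum.

Lemma odd_total_coincidences (F : fieldType) p b (es : 'I_p.+1 -> seq F) :
  (forall j, size (es j) = b) -> odd (coincidences es) = odd (p.+1 * (b * b)).
Proof.
move=> hb; rewrite -[p.+1 in RHS]card_ord -sum_nat_const /coincidences.
apply: (big_ind2 (fun x y => odd x = odd y)) => // [x x' y y' hx hy|j _].
  by rewrite !oddD hx hy.
by rewrite odd_coincidences hb.
Qed.
Theorem lemma6 (R : realType) (n p : nat)
  (* the classes C_j = conj_class (A j) *)
  (A : 'I_p.+1 -> 'M[R[i]]_n)
  (hunit : forall j, A j \in unitmx)
  (hdiag : forall j, diagonalizable (A j))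
  (hdet : \prod_(j < p.+1) \det (A j) = 1)
  (d : 'I_p.+1 -> nat)
  (hd : forall j, has_dimension (conj_class (A j)) (d j))
  (sigma : 'I_p.+1 -> 'I_n -> R[i])
  (hsigma : forall j, char_poly (A j) = \prod_(k < n) ('X - (sigma j k)%:P))
  (hq : (1 < mult_gcd sigma)%N)
  (m0 : nat)
  (hm0 : (m0 < mult_gcd sigma)%N)
  (hxi : xi sigma = expi (2 * pi * m0%:R / (mult_gcd sigma)%:R))
  (hgen : relatively_generic sigma m0)
  (hprim : ~ (mult_gcd sigma).-primitive_root (xi sigma)) :
  ((\sum_(j < p.+1) d j = 2 * n ^ 2)%N ->
     forall M : 'I_p.+1 -> 'M[R[i]]_n, product_one_in_classes A M ->
       (trivial_centralizer M <-> irreducible_tuple M)) /\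
  ((2 * n ^ 2 + 2 <= \sum_(j < p.+1) d j)%N ->
     (exists M : 'I_p.+1 -> 'M[R[i]]_n, product_one_in_classes A M) ->
     exists M : 'I_p.+1 -> 'M[R[i]]_n,
       product_one_in_classes A M /\ irreducible_tuple M).
Proof.
have [_ g_gt1 hrel] := hgen.
set g := gcdn m0 (mult_gcd sigma) in g_gt1 hrel.
have g_gt0 : (0 < g)%N := ltnW g_gt1.
have n_gt0 : (0 < n)%N.
  rewrite lt0n; apply/eqP => n0; move: hq; rewrite /mult_gcd big1 // => j _.
  by subst n; rewrite big_ord0.
have gdvd j k : (g %| mult sigma j (sigma j k))%N.
  apply: dvdn_trans (dvdn_gcdr _ _) _; rewrite /mult_gcd.
  by apply: (biggcdn_inf j) => //; apply: (biggcdn_inf k).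
have /fin_all_exists2[P uP hP] : forall j, exists2 P, P \in unitmx &
    P *m A j = diag_mx (\row_i sigma j i) *m P.
  by move=> j; apply: diagonalizable_spectrum (hdiag j) (hsigma j).
pose es := reduced_spectrum sigma g; pose b := (n %/ g)%N; pose K := coincidences es.
have esg j : (size (es j) * g = n)%N := size_reduced gdvd j.
have esb j : size (es j) = b by rewrite /b -(esg j) mulnK.
have bg : (b * g = n)%N by rewrite -(esb ord0).
(* Each [d j] is [n * n] minus the number of coinciding pairs, and repeating the reduced spectrum
   [g] times multiplies that number by [g * g]. *)
have dimE : (\sum_(j < p.+1) d j + g * g * K = g * g * (p.+1 * (b * b)))%N.
  rewrite /K /coincidences big_distrr -big_split /=.
  transitivity (\sum_(j < p.+1) n * n)%N.
    apply: eq_bigr => j _; rewrite (conj_class_dimension (uP j) (hP j) (hd j)).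
    by rewrite -(sum_coincidences gdvd) card_moved.
  by rewrite sum_nat_const card_ord -bg; lia.
have gg : (0 < g * g)%N by rewrite muln_gt0 g_gt0.
have subtyped m (X : 'I_p.+1 -> 'M[R[i]]_m) :=
  @generic_subtyped _ n p sigma g gdvd m X hrel.
split=> [dim M hM|dim [M hM]]; have tM := in_classes_typed gdvd uP hP hM.
  split=> [centM|irrM X hX].
    apply: simple_irreducible; apply: (trivial_centralizer_simple esb subtyped _ tM) => //.
      rewrite -(leq_pmul2l gg) -dimE dim -/K -bg; lia.
    by move=> T hT; apply: centM => j; rewrite hT.
  by apply: schur (irreducible_simple n_gt0 irrM) _ => j; rewrite hX.
(* After division by [g * g] the hypothesis only says that the sum of the [rho_j] exceeds
   [2 * (b * b)]; its evenness restores the margin 2. *)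
have dim_gt : (K + 2 * (b * b) + 2 <= p.+1 * (b * b))%N.
  have lt : (K + 2 * (b * b) < p.+1 * (b * b))%N.
    rewrite -(ltn_pmul2l gg) -dimE.
    have -> : (g * g * (K + 2 * (b * b)) = 2 * n ^ 2 + g * g * K)%N by rewrite -bg; lia.
    by rewrite ltn_add2r; apply: leq_trans dim; rewrite addn2.
  have := odd_total_coincidences esb; rewrite -/K; move: lt.
  move: (p.+1 * (b * b))%N (b * b)%N => x y; lia.
have [m' [M' [tM' sM']]] := typed_simple esb dim_gt subtyped g_gt0 (leqnn g) n_gt0 (leqnn n) tM.
have m'n : m' = n by rewrite (typed_size esb tM') mulnC.
move: m'n M' tM' sM' => -> M' tM' sM'; exists M'; split; last exact: simple_irreducible.
exact: (typed_in_classes gdvd uP hP).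
Qed.
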